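(* Let $\{(X_n,Y_n)\}_{n\ge 0}$ be a randomly reinforced urn (as defined in the context) with initial composition $(x,y)$, $x,y\ge 0$, $x+y>0$, and reinforcement distributions $\mu,\nu$ on $[0,\beta]$. Assume $m_\mu=m_\nu=m>0$. Let $$H=m^{-2}\left(Z_\infty\int_0^\beta k^2\,\nu(dk)+(1-Z_\infty)\int_0^\beta k^2\,\mu(dk)\right).$$ For $n\ge 1$ let $K_n(\omega,\cdot)$ be a version of the (regular) conditional distribution of $\sqrt n\,(Z_n-Z_\infty)$ given $\mathcal A_n$, i.e. $K_n(\omega,B)=P(\sqrt n(Z_n-Z_\infty)\in B\mid \mathcal A_n)(\omega)$ for Borel sets $B\subseteq\mathbb R$. Then, for almost every $\omega\in\Omega$, the sequence of probability distributions $\{K_n(\omega,\cdot)\}_{n\ge1}$ converges weakly to the Gaussian distribution $$N\big(0,\;H(\omega)\,Z_\infty(\omega)\,(1-Z_\infty(\omega))\big).$$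
   Context: Randomly reinforced urn (RRU). On a probability space $(\Omega,\mathcal A,P)$ let $\{U_n\}_{n\ge1}$ be i.i.d. uniform on $[0,1]$, and let $\{(V_n,W_n)\}_{n\ge1}$ be i.i.d. bivariate random vectors, each of whose components is uniform on $[0,1]$ ($V_n$ and $W_n$ may be dependent on each other); the sequences $\{U_n\}$ and $\{(V_n,W_n)\}$ are independent. Let $\beta>0$ and let $\mu,\nu$ be probability distributions on $[0,\beta]$ with means $m_\mu,m_\nu$ and quantile functions $q_\mu,q_\nu$. Set $R_X(n)=q_\mu(V_n)$ and $R_Y(n)=q_\nu(W_n)$, so $R_X(n)\sim\mu$ and $R_Y(n)\sim\nu$. Set $X_0=x$, $Y_0=y$ and, for $n\ge0$, $$X_{n+1}=X_n+R_X(n+1)\delta_{n+1},\qquad Y_{n+1}=Y_n+R_Y(n+1)(1-\delta_{n+1}),$$ where $\delta_{n+1}$ is the indicator of the event $\{U_{n+1}\le X_n/(X_n+Y_n)\}$. Let $Z_n=X_n/(X_n+Y_n)$ and $\mathcal A_n=\sigma(U_1,\dots,U_n,(V_1,W_1),\dots,(V_n,W_n))$. It is known that $Z_n$ converges almost surely to a random variable $Z_\infty\in[0,1]$. The distribution $N(0,0)$ is understood as the point mass at $0$. *)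

(* Defs.v *)
From HB Require Import structures.
From mathcomp Require Import all_boot all_order all_algebra finmap.
From mathcomp Require Import all_classical all_reals all_analysis.

Set Implicit Arguments.
Unset Strict Implicit.
Unset Printing Implicit Defensive.

Import Order.TTheory GRing.Theory Num.Theory.
Import numFieldNormedType.Exports.

Local Open Scope classical_set_scope.
Local Open Scope ring_scope.

Section random_variables.
Context d (T : measurableType d) (R : realType) (P : probability T R).

Definition indep_systems (F G : set_system T) : Prop :=
  forall A B, F A -> G B -> P (A `&` B) = (P A * P B)%E.

Definition mutually_indep (I : choiceType) (F : I -> set_system T) : Prop :=
  forall (J : {fset I}) (A : I -> set T), (forall i, i \in J -> F i (A i)) ->
    P (\bigcap_(i in [set` J]) A i) = (\prod_(i <- J) P (A i))%E.

Context d' (S : measurableType d').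

Definition sigma_seq (X : {RV P >-> S}^nat) : set_system T :=
  <<s \bigcup_n g_sigma_algebra_preimage (X n) >>.

Definition iid (X : {RV P >-> S}^nat) : Prop :=
  mutually_indep (fun n => g_sigma_algebra_preimage (X n)) /\
  forall n B, measurable B -> distribution P (X n) B = distribution P (X 0) B.

(* [K] is a probability kernel on the carrier of [T] equipped with [<<s G >>]
   instead of its own sigma-algebra: the required [<<s G >>]-measurability of
   [K ^~ B] is thus part of its type. *)
Definition cond_distribution (G : set_system T)
    (K : R.-pker g_sigma_algebraType G ~> S) (X : T -> S) : Prop :=
  forall B A, measurable B -> <<s G >> A ->
    (\int[P]_(w in A) K w B)%E = P (A `&` X @^-1` B).

End random_variables.

Section laws_on_the_line.
Context (R : realType).
Local Notation RR := (measurableTypeR R).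

Definition uniform01 d (T : measurableType d) (P : probability T R)
    (X : T -> R) : Prop :=
  forall B, measurable B -> P (X @^-1` B) = uniform_prob (@ltr01 R) B.

(* For [t] outside ]0, 1] the set may be empty or unbounded below, in which
   case [inf] returns 0; this is a null event when [t] is uniform on [0, 1]. *)
Definition quantile (mu : probability RR R) (t : R) : R :=
  inf [set r : R | (t%:E <= mu `]-oo, r]%classic)%E].

(* [v] is the variance, assumed nonnegative, whereas [normal_prob] takes a
   standard deviation and is not a point mass when the latter is 0. *)
Definition gaussian (a v : R) : probability RR R :=
  if v == 0 then @dirac _ RR a R : probability RR R
  else normal_prob a (Num.sqrt v) : probability RR R.

Definition weak_cvg (mu_ : {measure set RR -> \bar R}^nat)
    (mu : {measure set RR -> \bar R}) : Prop :=
  forall f : R -> R, continuous f -> (exists M, forall r, `|f r| <= M) ->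
    \int[mu_ n]_r f r @[n --> \oo] --> \int[mu]_r f r.

End laws_on_the_line.

(* The driving sequences are indexed from 0: [U n] and [VW n] are the
   variables U_{n+1} and (V_{n+1}, W_{n+1}) used in the (n+1)-st draw, so that
   the history up to time [n] involves the indices [i < n]. *)
Section urn.
Context d (T : measurableType d) (R : realType) (P : probability T R).
Local Notation RR := (measurableTypeR R).
Variables (U : {RV P >-> R}^nat) (VW : {RV P >-> (R * R)%type}^nat).
Variables (mu nu : probability RR R) (x y : R).

Definition first_fraction (c : R * R) : R := c.1 / (c.1 + c.2).

Fixpoint urn (n : nat) (w : T) : R * R :=
  if n is n'.+1 then
    let c := urn n' w in
    let delta : R := (U n' w <= first_fraction c)%R%:R in
    (c.1 + quantile mu (VW n' w).1 * delta,
     c.2 + quantile nu (VW n' w).2 * (1 - delta))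
  else (x, y).

Definition urn_prop (n : nat) (w : T) : R := first_fraction (urn n w).

Definition urn_filtration (n : nat) : set_system T :=
  <<s \bigcup_(i in `I_n) (g_sigma_algebra_preimage (U i) `|`
                           g_sigma_algebra_preimage (VW i)) >>.

End urn.

(* Main.v *)
(* Write [D_k = X_k + Y_k] and [S(z) = z (1 - z) ((1 - z) p + z q)], where [p]
   and [q] are the second moments of [mu] and [nu]. The [k]-th draw changes
   [Z_k] by [L / D_(k+1)], where, given the past, [L] has mean 0 and second
   moment [S(Z_k)], while [D_k] increases by [m] in mean. Hence, for fixed [n]
   and [l = sqrt n], the process
     [cos (t l (Z_k - Z_n) + phi) exp (- t^2 l^2 S(Z_k) / (2 m D_k))], [k >= n],
   is a martingale up to conditional errors of order [1 / D_k^2]. As [1 / D_k]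
   decreases in conditional mean by at least a multiple of [1 / D_k^2], these
   errors add up to [O(1 / D_n)], for a constant depending on [l]. Letting
   [k -> oo] evaluates [E(cos (t l (Zoo - Z_n) + phi) | A_n)] up to an error
   that vanishes as [n -> oo], because [D_n / n -> m] almost surely (by a fourth
   moment bound). The same argument applied to [(Z_k - Z_n)^2] gives tightness.
   For a tight sequence, weak convergence follows from that of the integrals of
   [cos (j x / M + k pi / 2)], with [j], [k] integers: on [-M, M], a continuous
   function of [x] is a continuous function of [sin (x / M)], hence close to a
   trigonometric polynomial. Only countably many integrals are involved, so a
   single null set suffices. *)
Require Import Defs.
From HB Require Import structures.
From mathcomp Require Import all_boot all_order all_algebra finmap.
From mathcomp Require Import all_classical all_reals all_analysis.
From mathcomp Require Import measurable_realfun ring lra.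

Set Implicit Arguments.
Unset Strict Implicit.
Unset Printing Implicit Defensive.

Import Order.TTheory GRing.Theory Num.Theory.
Import numFieldNormedType.Exports.

Local Open Scope classical_set_scope.
Local Open Scope ring_scope.

(** * The characteristic function of the normal distribution *)

(** No conditional expectation is ever formed. A claim given [A_n] is an inequality between
    integrals against an arbitrary bounded nonnegative [A_n]-measurable weight [xi]; indicators as
    weights, compared with the kernel [K n], turn it into an almost sure inequality. The exponent
    S(Z_k) / D_k depends on the current state only, so its drift can be read off from one draw: to
    leading order 1 / D_k falls by m / D_k^2 in mean, and t^2 / (2 m) is the factor for which this
    cancels the quadratic term of the cosine. As 1 / D_k tends to 0, the exponential tends to 1, and
    the limit in k leaves the bare cosine. The scale l stays a free parameter because the error
    bound l / D_n + l^3 / D_n^2 + l^4 / D_n^3 must hold with a constant independent of it: at l =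
    sqrt n, with D_n of order n, every term is of order 1 / sqrt n. The phase phi covers cosine and
    sine at once and keeps all computations real. *)

Section density.
Context d (T : measurableType d) (R : realType).
Variables (mu nu : {measure set T -> \bar R}) (p : T -> R).
Hypotheses (mp : measurable_fun setT p) (p0 : forall x, 0 <= p x).
Hypothesis nuE : forall A, measurable A -> nu A = (\int[mu]_(x in A) (p x)%:E)%E.

Import HBNNSimple.

(** By linearity only level sets remain, and for them the claim is [nuE]; negative levels have empty
    preimage. *)
Let integral_density_nnsfun (f : {nnsfun T >-> R}) :
  (\int[nu]_x (f x)%:E = \int[mu]_x ((f x)%:E * (p x)%:E))%E.
Proof.
rewrite integralT_nnsfun sintegralE.
under [RHS]eq_integral.
  move=> x _; rewrite fimfunE -fsumEFin// ge0_mule_fsuml; last first.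
    by move=> r; rewrite EFinM nnfun_muleindic_ge0.
  over.
rewrite ge0_integral_fsum//; last 2 first.
  - move=> r; apply/emeasurable_funM; last exact/measurable_EFinP.
    by apply/measurable_EFinP; apply: measurable_funM.
  - move=> n x _; rewrite mule_ge0//; last by rewrite lee_fin.
    by rewrite EFinM nnfun_muleindic_ge0.
apply: eq_fsbigr => r _; have [r0|r0] := ltP r 0.
  rewrite preimage_nnfun0// measure0 mule0 integral0_eq// => x _.
  by rewrite indicE in_set0 mulr0 mul0e.
rewrite nuE//.
under [RHS]eq_integral do rewrite EFinM -muleA.
rewrite ge0_integralZl//.
- congr (_ * _)%E; rewrite integral_mkcond; apply: eq_integral => x _.
  by rewrite patchE indicE; case: ifPn; rewrite ?mul1e ?mul0e.
- apply/emeasurable_funM; exact/measurable_EFinP.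
- by move=> x _; rewrite mule_ge0// lee_fin.
Qed.

Lemma ge0_integral_density (f : T -> \bar R) :
  measurable_fun setT f -> (forall x, 0 <= f x)%E ->
  (\int[nu]_x f x = \int[mu]_x (f x * (p x)%:E))%E.
Proof.
move=> mf f0; pose f_ := nnsfun_approx measurableT mf.
have cvf x : (f_ n x)%:E @[n --> \oo] --> f x by exact: cvg_nnsfun_approx.
have ndf x : {homo (fun n => f_ n x) : n m / (n <= m)%N >-> n <= m}.
  by move=> n m nm; exact/lefP/nd_nnsfun_approx.
transitivity (lim (\int[nu]_x (f_ n x)%:E @[n --> \oo])%E).
  rewrite -monotone_convergence//=.
  - by apply: eq_integral => x _; apply/esym/cvg_lim.
  - by move=> n; exact/measurable_EFinP/measurable_funTS.
  - by move=> n ? _; rewrite lee_fin.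
  - by move=> x _ n m nm; rewrite lee_fin; exact: ndf.
transitivity (lim (\int[mu]_x ((f_ n x)%:E * (p x)%:E) @[n --> \oo])%E).
  by apply: congr_lim; apply/funext => n /=; exact: integral_density_nnsfun.
rewrite -monotone_convergence//=.
- apply: eq_integral => x _; apply/cvg_lim => //.
  by apply: cvgeZr => //; exact: cvf.
- move=> n; apply/emeasurable_funM; exact/measurable_EFinP.
- by move=> n x _; rewrite mule_ge0// lee_fin.
- by move=> x _ n m nm; rewrite lee_wpmul2r// ?lee_fin//; exact: ndf.
Qed.

Lemma Rintegral_density (f : T -> R) : measurable_fun setT f ->
  \int[nu]_x f x = \int[mu]_x (f x * p x).
Proof.
move=> mf; rewrite /Rintegral [in LHS]integralE [in RHS]integralE.
congr (fine (_ - _)).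
  rewrite ge0_integral_density//; last exact/measurable_funepos/measurable_EFinP.
  apply: eq_integral => x _; rewrite !funeposE /=.
  by rewrite -!EFin_max -EFinM maxr_pMl// mul0r.
rewrite ge0_integral_density//; last exact/measurable_funeneg/measurable_EFinP.
apply: eq_integral => x _; rewrite !funenegE /=.
by rewrite -!EFin_max -EFinM maxr_pMl// mul0r mulNr.
Qed.

End density.
(** Follows from |y| <= 1 + y^2 <= exp(y^2). It lets part of a Gaussian exponent absorb a factor
    |x|. *)
Lemma le_mul_expRN (R : realType) (y : R) : `|y| * expR (- y ^+ 2) <= 1.
Proof.
rewrite expRN ler_pdivrMr ?expR_gt0// mul1r.
have := expR_ge1Dx (y ^+ 2); have := real_normK (num_real y) => h1 h2.
rewrite -{1}h1 in h2; nra.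
Qed.

Section gaussian_characteristic_function.
Context (R : realType) (s f : R).
Hypothesis s0 : 0 < s.
Local Notation p := (normal_pdf 0 s).
Local Notation mu := (@lebesgue_measure R).

Let sneq0 : s != 0. Proof. by rewrite gt_eqF. Qed.

Let pE x : p x = normal_peak s * expR (- (s ^- 2 / 2) * x ^+ 2).
Proof.
rewrite normal_pdfE//= /normal_fun subr0; congr (_ * expR _).
by rewrite -mulr_natr; field.
Qed.

Let cp : continuous p. Proof. exact: continuous_normal_pdf. Qed.

Let intp : mu.-integrable setT (EFin \o p).
Proof. exact: integrable_normal_pdf. Qed.

Let int_bounded_p (g : R -> R) M : measurable_fun setT g ->
  (forall x, `|g x| <= M) -> mu.-integrable setT (EFin \o (fun x => g x * p x)).
Proof.
move=> mf fM; apply: (@le_integrable _ _ _ mu _ measurableT _ (fun x => (M%:E * (p x)%:E)%E)).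
- apply/measurable_EFinP/measurable_funM => //; exact: measurable_normal_pdf.
- move=> x _; rewrite /= lee_fin !normrM ler_wpM2r//.
  by rewrite (le_trans (fM x))// ler_norm.
- exact: integrableZl.
Qed.

(** The density with doubled variance: half of the exponent of [p] pays for the factor |x| in |x|
    p(x), the other half is the exponent of [q]. *)
Let q := normal_pdf 0 (Num.sqrt 2 * s).

Let xp_le x : `|x| * p x <= 2 * s * Num.sqrt 2 * q x.
Proof.
have q0 : Num.sqrt 2 * s != 0 by rewrite mulf_neq0// gt_eqF// sqrtr_gt0.
have -> : q x = normal_peak s * (Num.sqrt 2)^-1 * expR (- (s ^- 2 / 4) * x ^+ 2).
  rewrite /q normal_pdfE//= /normal_fun subr0; congr (_ * expR _).
    rewrite /normal_peak -invfM; congr (_^-1).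
    rewrite exprMn sqr_sqrtr// -mulrA -mulrnAr sqrtrM// mulrC//.
  by rewrite exprMn sqr_sqrtr// -mulr_natr; field.
rewrite pE.
have -> : - (s ^- 2 / 2) * x ^+ 2 =
    - (x / (2 * s)) ^+ 2 + - (s ^- 2 / 4) * x ^+ 2 by field.
rewrite expRD.
have := le_mul_expRN (x / (2 * s)).
rewrite normrM normfV (ger0_norm (_ : 0 <= 2 * s)); last by rewrite mulr_ge0// ltW.
set e := expR (- _ ^+ 2); set e' := expR _ => h.
have {}h : `|x| * e <= 2 * s.
  by rewrite -[leRHS]mul1r -ler_pdivrMr ?mulr_gt0// mulrAC.
have e0 : 0 <= e' by exact: expR_ge0.
have r2 : Num.sqrt 2 != 0 :> R by rewrite gt_eqF// sqrtr_gt0.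
have np := normal_peak_ge0 s.
have -> : `|x| * (normal_peak s * (e * e')) = (`|x| * e) * (normal_peak s * e') by ring.
have -> : 2 * s * Num.sqrt 2 * (normal_peak s / Num.sqrt 2 * e') =
  2 * s * (normal_peak s * e') by field.
by rewrite ler_wpM2r// mulr_ge0.
Qed.

Let intq : mu.-integrable setT (EFin \o q).
Proof. exact: integrable_normal_pdf. Qed.

Let intxp : mu.-integrable setT (EFin \o (fun x => `|x| * p x)).
Proof.
apply: (@le_integrable _ _ _ mu _ measurableT _
    (fun x => ((2 * s * Num.sqrt 2)%:E * (q x)%:E)%E)).
- apply/measurable_EFinP/measurable_funM; first exact: normr_measurable.
  exact: measurable_normal_pdf.
- move=> x _; rewrite /= lee_fin ger0_norm ?mulr_ge0 ?normal_pdf_ge0//.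
  by rewrite (le_trans (xp_le x))// ler_norm.
- exact: integrableZl.
Qed.

Let p_cvg0 : p n%:R @[n --> \oo] --> 0.
Proof.
apply: (@squeeze_cvgr _ _ _ _ (cst 0)
  (fun n => (2 * s * Num.sqrt 2 * normal_peak (Num.sqrt 2 * s)) * n%:R^-1)).
- near=> n; rewrite normal_pdf_ge0/= ler_pdivlMr; last first.
    by rewrite ltr0n; near: n; exact: nbhs_infty_gt.
  rewrite mulrC; have := xp_le n%:R; rewrite ger0_norm//; move/le_trans; apply.
  apply: ler_wpM2l; first by rewrite !mulr_ge0// ltW.
  apply: normal_pdf_ub.
  by rewrite mulf_neq0// gt_eqF// sqrtr_gt0.
- exact: cvg_cst.
- rewrite -[X in _ --> X](mulr0 (2 * s * Num.sqrt 2 * normal_peak (Num.sqrt 2 * s))).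
  apply: cvgM; first exact: cvg_cst.
  by rewrite -(cvg_shiftS (fun n => n%:R^-1 : R)); exact: cvg_harmonic.
Unshelve. all: end_near. Qed.

(** A primitive chosen for integration by parts: the integral of its derivative [H'] relates the
    integral of the cosine to that of x times the sine. *)
Let H t x := sin (t * x + f) * p x.
Let H' t x := t * (cos (t * x + f) * p x) - s ^- 2 * (sin (t * x + f) * x * p x).

Let is_derive_p (x : R) : is_derive x (1 : R) (p : R -> R) (- (s ^- 2) * x * p x).
Proof.
rewrite (_ : p = fun x => normal_peak s * expR (- (s ^- 2 / 2) * x ^+ 2)); last first.
  by apply/funext => y; rewrite pE.
by apply: trigger_derive; rewrite /GRing.scale/=; field.
Qed.

Let is_derive_H t (x : R) : is_derive x (1 : R) (H t : R -> R) (H' t x).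
Proof.
have dp := is_derive_p x.
by apply: trigger_derive; rewrite /GRing.scale/= /H'; ring.
Qed.

Let measurable_sinM t : measurable_fun setT (fun x : R => sin (t * x + f)).
Proof.
apply: measurableT_comp; last by apply: measurable_funD => //; exact: mulrl_measurable.
apply: continuous_measurable_fun; exact: continuous_sin.
Qed.

Let measurable_cosM t : measurable_fun setT (fun x : R => cos (t * x + f)).
Proof.
apply: measurableT_comp; last by apply: measurable_funD => //; exact: mulrl_measurable.
apply: continuous_measurable_fun; exact: continuous_cos.
Qed.

Let normr_sin (x : R) : `|sin x| <= 1.
Proof. by rewrite ler_norml sin_geN1 sin_le1. Qed.

Let normr_cos (x : R) : `|cos x| <= 1.
Proof. by rewrite ler_norml cos_geN1 cos_le1. Qed.

Let int_sinxp t : mu.-integrable setT (EFin \o (fun x => sin (t * x + f) * x * p x)).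
Proof.
apply: (@le_integrable _ _ _ mu _ measurableT _ (EFin \o (fun x => `|x| * p x))) => //.
- apply/measurable_EFinP/measurable_funM; last exact: measurable_normal_pdf.
  by apply: measurable_funM => //; exact: measurable_sinM.
- move=> x _; rewrite /= lee_fin !normrM normr_id.
  by rewrite ler_wpM2r// -[leRHS]mul1r ler_wpM2r.
Qed.

Let int_cosp t : mu.-integrable setT (EFin \o (fun x => cos (t * x + f) * p x)).
Proof. exact: (int_bounded_p (measurable_cosM t) (fun x => normr_cos (t * x + f))). Qed.

Let int_H' t : mu.-integrable setT (EFin \o H' t).
Proof.
rewrite (_ : _ \o _ = (fun x => t%:E * (cos (t * x + f) * p x)%:E - (s ^- 2)%:E * (sin
  (t * x + f) * x * p x)%:E)%E); last first.
  by apply/funext => x; rewrite /H' /= EFinB !EFinM.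
apply: integrableB => //.
  exact: (@integrableZl _ _ _ mu setT measurableT t _ (int_cosp t)).
exact: (@integrableZl _ _ _ mu setT measurableT (s ^- 2) _ (int_sinxp t)).
Qed.

Let cH' t : continuous (H' t).
Proof.
move=> x; rewrite /H'.
have cs : {for x, continuous (fun x => sin (t * x + f))}.
  apply: (@continuous_comp _ _ _ (fun x => t * x + f) sin); last exact: continuous_sin.
  apply: cvgD; [exact: mulrl_continuous|exact: cvg_cst].
have cc : {for x, continuous (fun x => cos (t * x + f))}.
  apply: (@continuous_comp _ _ _ (fun x => t * x + f) cos); last exact: continuous_cos.
  apply: cvgD; [exact: mulrl_continuous|exact: cvg_cst].
apply: cvgB; apply: cvgM; try exact: cvg_cst; apply: cvgM => //; try exact: cp.
by apply: cvgM => //; exact: cvg_id.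
Qed.

(** The fundamental theorem on [-(n+1), n+1] leaves boundary terms of size at most 2 p(n+1), which
    vanish; dominated convergence identifies the limit of the integrals. *)
Let integral_H' t : \int[mu]_x H' t x = 0.
Proof.
pose B n := `[- n.+1%:R, n.+1%:R]%classic : set R.
have FTC n : \int[mu]_(x in B n) H' t x = H t n.+1%:R - H t (- n.+1%:R).
  rewrite /Rintegral (@continuous_FTC2 _ _ (H t))//.
  - by rewrite ltrNl gtrN// ltr0Sn.
  - by apply: continuous_subspaceT; exact: cH'.
  - have dH x : derivable (H t) x 1 by have [] := is_derive_H t x.
    have cH : continuous (H t).
      by move=> x; apply: differentiable_continuous; exact/derivable1_diffP.
    split => //; first by apply: cvg_at_right_filter; exact: cH.
    by apply: cvg_at_left_filter; exact: cH.
  - by move=> x _; rewrite derive1E; exact: derive_val.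
have pN x : p (- x) = p x by rewrite !pE sqrrN.
have l0 : H t n.+1%:R - H t (- n.+1%:R) @[n --> \oo] --> 0.
  apply: norm_cvg0; apply: (@squeeze_cvgr _ _ _ _ (cst 0) (fun n => 2 * p n.+1%:R)).
  - near=> n; rewrite normr_ge0/= /H pN mulr2n mulrDl mul1r.
    have := normal_pdf_ge0 0 s n.+1%:R => pn0.
    by rewrite (le_trans (ler_normB _ _))// lerD// normrM (ger0_norm pn0) ler_piMl.
  - exact: cvg_cst.
  - rewrite -[X in _ --> X](mulr0 2); apply: cvgM; first exact: cvg_cst.
    by rewrite (cvg_shiftS (fun n => p n%:R)).
have mB n : measurable (B n) by exact: measurable_itv.
have mH' : measurable_fun setT (H' t) by apply: continuous_measurable_fun; exact: cH'.
have [|||||_ _ H0] := @dominated_convergence _ _ _ mu setT measurableT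
  (fun n x => (H' t x * \1_(B n) x)%:E) (fun x => (H' t x)%:E) (fun x => `|(H' t x)%:E|%E).
- by move=> n; apply/measurable_EFinP; exact: (measurable_funM mH' (measurable_indic (mB n))).
- by have /integrableP[] := int_H' t.
- apply/aeW => x _; apply: cvg_near_cst; near=> n.
  rewrite indicE mem_set ?mulr1// /B/= in_itv/= -ler_norml.
  rewrite (@le_trans _ _ n%:R) ?ler_nat//; near: n; exact: nbhs_infty_ger.
- exact: (integrable_abse (int_H' t)).
- apply/aeW => x n _; rewrite /= lee_fin normrM ler_piMr// indicE.
  by case: (_ \in _); rewrite ?normr1 ?normr0.
apply/esym; apply: cvg_unique l0 _ => //.
have E n : H t n.+1%:R - H t (- n.+1%:R) = fine (\int[mu]_x (H' t x * \1_(B n) x)%:E).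
  rewrite -FTC /Rintegral integral_mkcond; congr fine.
  by apply: eq_integral => x _; rewrite patchE indicE; case: ifPn; rewrite ?mulr1 ?mulr0.
rewrite /=; under eq_cvg do rewrite E.
rewrite /Rintegral; apply: fine_cvg; rewrite fineK; first exact: H0.
by apply: integrable_fin_num => //; exact: int_H'.
Unshelve. all: end_near. Qed.

Let phi t := \int[mu]_x (cos (t * x + f) * p x).

(** Differentiating under the integral produces the integral of -x sin(t x + f) p(x), which
    [integral_H'] expresses through [phi] again. The domination is by |x| p(x). *)
Let is_derive_phi t : is_derive t (1 : R) (phi : R -> R) (- (s ^+ 2 * t * phi t)).
Proof.
pose g u x := cos (u * x + f) * p x.
have dg u x : is_derive u (1 : R) ((g ^~ x) : R -> R) (- (sin (u * x + f) * x * p x)).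
  by apply: trigger_derive; rewrite /GRing.scale/=; ring.
have d1g u x : partial1of2 g u x = - (sin (u * x + f) * x * p x).
  by rewrite partial1of2E; exact: derive_val.
have It : `]t - 1, t + 1[%classic t by rewrite /= in_itv/= ltrBlDr ltrDl ltr01.
have G0 x : 0 <= `|x| * p x by rewrite mulr_ge0// normal_pdf_ge0.
have Gub u x : `|partial1of2 g u x| <= `|x| * p x.
  rewrite d1g normrN !normrM (ger0_norm (normal_pdf_ge0 0 s x)).
  by rewrite ler_wpM2r ?normal_pdf_ge0// -[leRHS]mul1r ler_wpM2r.
have phiE : phi = fun u => \int[mu]_x g u x by [].
have intg u : `]t - 1, t + 1[%classic u -> mu.-integrable setT (EFin \o g u) by move=> _;
  exact: int_cosp.
have derg u x : `]t - 1, t + 1[%classic u -> [set: R] x -> derivable (g ^~ x) u 1.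
  by move=> _ _; have [] := dg u x.
have dphi : derivable phi t 1.
  by rewrite phiE; exact: (derivable_under_integral measurableT It intg derg G0 intxp
    (fun u x _ _ => Gub u x)).
apply: DeriveDef => //.
rewrite -derive1E phiE (differentiation_under_integral measurableT It intg derg G0 intxp
  (fun u x _ _ => Gub u x)).
under eq_Rintegral do rewrite d1g.
have := integral_H' t; rewrite /H' RintegralB//; last 2 first.
  exact: (@integrableZl _ _ _ mu setT measurableT t _ (int_cosp t)).
  exact: (@integrableZl _ _ _ mu setT measurableT (s ^- 2) _ (int_sinxp t)).
rewrite !RintegralZl// => /eqP; rewrite subr_eq0 => /eqP h.
under eq_Rintegral do rewrite -mulN1r.
rewrite RintegralZl// mulN1r; congr (- _).
rewrite -mulrA -/(phi t) h mulrA divff ?mul1r//.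
by rewrite sqrf_eq0.
Qed.

Lemma Rintegral_cos_normal_pdf t :
  \int[mu]_x (cos (t * x + f) * p x) = cos f * expR (- (s ^+ 2 * t ^+ 2) / 2).
Proof.
(* The integrating factor of the differential equation phi' = - s^2 t phi. *)
pose psi t := phi t * expR (s ^+ 2 * t ^+ 2 / 2).
have : psi t = psi 0.
  apply: is_derive_0_is_cst => u; have dp := is_derive_phi u.
  by apply: trigger_derive; rewrite /GRing.scale/=; field.
rewrite /psi expr0n/= mulr0 mul0r expR0 mulr1 mulNr expRN.
have -> : phi 0 = cos f.
  rewrite /phi; under eq_Rintegral do rewrite mul0r add0r.
  by rewrite RintegralZl// /Rintegral integral_normal_pdf/= mulr1.
by move=> <-; rewrite mulfK// gt_eqF// expR_gt0.
Qed.

Lemma Rintegral_cos_normal_prob t :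
  \int[normal_prob 0 s]_x cos (t * x + f) = cos f * expR (- (s ^+ 2 * t ^+ 2) / 2).
Proof.
rewrite -Rintegral_cos_normal_pdf; apply: Rintegral_density => //.
- exact: measurable_normal_pdf.
- by move=> x; exact: normal_pdf_ge0.
- exact: measurable_cosM.
Qed.

End gaussian_characteristic_function.

(** * Approximation by trigonometric sums *)

Section bernstein.
Context (R : realType).
Implicit Types (h : nat -> R) (x : R).

(* The expectation of [h] under the binomial distribution with parameters [n]
   and [x], by conditioning on the first trial. *)
Fixpoint binomial_mean (n : nat) h x : R :=
  if n is n'.+1 then
    x * binomial_mean n' (h \o S) x + (1 - x) * binomial_mean n' h x
  else h 0.

Lemma binomial_meanD n h1 h2 x :
  binomial_mean n (fun k => h1 k + h2 k) x =
  binomial_mean n h1 x + binomial_mean n h2 x.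
Proof.
elim: n h1 h2 => [|n IH] h1 h2 //=.
rewrite (IH (h1 \o S) (h2 \o S)) IH; ring.
Qed.

Lemma binomial_meanZ n a h x :
  binomial_mean n (fun k => a * h k) x = a * binomial_mean n h x.
Proof.
elim: n h => [|n IH] h //=.
rewrite (IH (h \o S)) IH; ring.
Qed.

Lemma binomial_mean_cst n a x : binomial_mean n (fun=> a) x = a.
Proof. by elim: n => [|n IH] //=; rewrite (_ : _ \o _ = fun=> a)// IH; ring. Qed.

Lemma le_binomial_mean n h1 h2 x : 0 <= x <= 1 ->
  (forall k, (k <= n)%N -> h1 k <= h2 k) ->
  binomial_mean n h1 x <= binomial_mean n h2 x.
Proof.
move=> /andP[x0 x1]; elim: n h1 h2 => [|n IH] h1 h2 h12 /=; first exact: h12.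
by rewrite lerD// ler_wpM2l ?subr_ge0// IH// => k kn; apply: h12 => //=; rewrite leqW.
Qed.

(** The shift [a] is there for the induction, where passing to [h \o S] replaces [a] by [a + 1].
    With a = - n x this is the binomial variance n x (1 - x). *)
Lemma binomial_mean2 n a x :
  binomial_mean n (fun k => (k%:R + a) ^+ 2) x =
  (n%:R * x + a) ^+ 2 + n%:R * x * (1 - x).
Proof.
elim: n a => [|n IH] a /=; first by rewrite !mul0r addr0.
rewrite (_ : _ \o S = fun k => (k%:R + (a + 1)) ^+ 2); last first.
  by apply/funext => k /=; rewrite -natr1; congr (_ ^+ 2); ring.
rewrite !IH -natr1; ring.
Qed.

Lemma unif_continuous_itv01 (g : R -> R) (e : R) : continuous g -> 0 < e ->
  exists2 d : R, 0 < d & forall x y, 0 <= x <= 1 -> `|x - y| < d -> `|g x - g y| < e.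
Proof.
move=> cg e0.
have /compact_near_coveringP := @segment_compact R 0 1.
move=> /(_ R (0 : R)^'+ (fun d x => forall y, `|x - y| < d -> `|g x - g y| < e) _).
case.
  move=> x _.
  have e2 : 0 < e / 2 by rewrite divr_gt0.
  have /cvgrPdist_lt/(_ _ e2)[d /= d0 Hd] := cg x.
  have d2 : 0 < d / 2 by rewrite divr_gt0.
  exists (ball x (d / 2), [set r | r < d / 2]) => /=.
    by split; [exact: nbhsx_ballx|exact: nbhs_right_lt].
  move=> [x' r] /= [xx' rd] y x'y.
  have h1 : `|g x - g x'| < e / 2 by apply: Hd; rewrite /ball/= in xx' *; lra.
  have h2 : `|g x - g y| < e / 2.
    apply: Hd => /=; have := ler_distD x' x y; rewrite /ball/= in xx'; lra.
  have := ler_distD (g x) (g x') (g y); rewrite (distrC (g x') (g x)); lra.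
move=> d /= d0 Hd.
exists (d / 2); first by rewrite divr_gt0.
move=> x y x01 xy; apply: (Hd (d / 2)) => //=.
- by rewrite sub0r normrN gtr0_norm ?divr_gt0//; lra.
- by rewrite divr_gt0.
Qed.

(** Chebyshev's argument: the polynomial is the mean of [g] at a binomial frequency, whose variance
    about x is at most 1 / (n + 1). *)
Lemma bernstein_approximation (g : R -> R) (e : R) : continuous g ->
  (exists M : R, forall x, `|g x| <= M) -> 0 < e ->
  exists n, forall x, 0 <= x <= 1 ->
    `|g x - binomial_mean n.+1 (fun k => g (k%:R / n.+1%:R)) x| <= e.
Proof.
move=> cg [M gM] e0; have e2 : 0 < e / 2 by rewrite divr_gt0.
have [d d0 Hd] := unif_continuous_itv01 cg e2.
have M0 : 0 <= M by rewrite (le_trans _ (gM 0)).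
pose C : R := 2 * M / d ^+ 2.
have C0 : 0 <= C by rewrite /C divr_ge0 ?sqr_ge0 ?mulr_ge0.
(* For y close to x uniform continuity gives e / 2; otherwise the quadratic term exceeds 2 M, which
   bounds any difference of values of [g]. *)
have gC x y : 0 <= x <= 1 -> `|g x - g y| <= e / 2 + C * (y - x) ^+ 2.
  move=> x01; have [xy|xy] := ltP `|x - y| d.
    by rewrite (le_trans (ltW (Hd _ _ x01 xy)))// lerDl mulr_ge0// sqr_ge0.
  have : 2 * M <= C * (y - x) ^+ 2.
    rewrite /C mulrAC ler_pdivlMr ?exprn_gt0// ler_wpM2l ?mulr_ge0//.
    by rewrite -(real_normK (num_real (y - x))) ler_sqr ?nnegrE ?(ltW d0)// distrC.
  have := gM x; have := gM y; have := ler_normB (g x) (g y); lra.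
pose n := Num.truncn (C / (e / 2)); exists n => x x01.
have [x0 x1] := andP x01.
have nC : C / n.+1%:R <= e / 2.
  rewrite ler_pdivrMr ?ltr0Sn// mulrC -ler_pdivrMr//; apply/ltW.
  by have /andP[] := truncn_itv (divr_ge0 C0 (ltW e2)).
set B := binomial_mean _ _ _.
(* The two signs of [a] give the two halves of the absolute value. *)
have le1 (a : R) : (a = 1 \/ a = -1) -> a * (g x - B) <= e.
  move=> a1.
  have -> : a * (g x - B) =
      binomial_mean n.+1 (fun k => a * (g x - g (k%:R / n.+1%:R))) x.
    rewrite binomial_meanZ; congr (_ * _).
    rewrite (_ : (fun k => _) = (fun k => g x + -1 * g (k%:R / n.+1%:R))).
      by rewrite binomial_meanD binomial_mean_cst binomial_meanZ mulN1r.
    by apply/funext => k; rewrite mulN1r.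
  apply: (@le_trans _ _ (binomial_mean n.+1
     (fun k => e / 2 + (C / n.+1%:R ^+ 2) * (k%:R + - (n.+1%:R * x)) ^+ 2) x)).
    apply: le_binomial_mean => // k _.
    have := gC x (k%:R / n.+1%:R) x01.
    have -> : C * (k%:R / n.+1%:R - x) ^+ 2 =
       C / n.+1%:R ^+ 2 * (k%:R + - (n.+1%:R * x)) ^+ 2.
      by have: n.+1%:R != 0 :> R by []; move: n.+1%:R => N N0; field.
    apply: le_trans; rewrite (le_trans (ler_norm _))// normrM.
    by case: a1 => ->; rewrite ?normrN normr1 mul1r.
  rewrite binomial_meanD binomial_mean_cst binomial_meanZ binomial_mean2.
  have -> : C / n.+1%:R ^+ 2 *
     ((n.+1%:R * x - n.+1%:R * x) ^+ 2 + n.+1%:R * x * (1 - x)) =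
     C / n.+1%:R * (x * (1 - x)).
    by have: n.+1%:R != 0 :> R by []; move: n.+1%:R => N N0; field.
  have Cn : 0 <= C / n.+1%:R by rewrite divr_ge0.
  have : C / n.+1%:R * (x * (1 - x)) <= C / n.+1%:R.
    by rewrite ler_piMr//; nra.
  by move=> h; rewrite [leRHS]splitr lerD2l (le_trans h).
rewrite ler_norml; apply/andP; split.
- by have := le1 _ (or_intror erefl); lra.
- by have := le1 _ (or_introl erefl); lra.
Qed.

End bernstein.

Section trigonometric_approximation.
Context (R : realType).

(** Phases in multiples of pi / 2 make cosines and sines a single family, closed under
    multiplication by sin(x / M), while the generators for a given [M] remain countable. *)
Inductive trig_sum (M : R) : (R -> R) -> Prop :=
| trig_sum_cos (j k : int) :
    trig_sum M (fun x => cos (j%:~R / M * x + k%:~R * (pi / 2)))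
| trig_sumD f g : trig_sum M f -> trig_sum M g -> trig_sum M (fun x => f x + g x)
| trig_sumZ a f : trig_sum M f -> trig_sum M (fun x => a * f x).

Lemma eq_trig_sum M f g : f =1 g -> trig_sum M f -> trig_sum M g.
Proof. by move=> /funext ->. Qed.

Lemma trig_sum_cst M a : trig_sum M (fun=> a).
Proof.
apply: (eq_trig_sum _ (trig_sumZ a (trig_sum_cos M 0 0))) => x /=.
by rewrite mul0r mul0r mul0r addr0 cos0 mulr1.
Qed.

(** Product-to-sum: 2 cos A sin B = sin(A + B) - sin(A - B), and both sines are cosines with the
    phase moved by a quarter turn. *)
Lemma trig_sumM_sin M f : trig_sum M f -> trig_sum M (fun x => f x * sin (x / M)).
Proof.
elim=> [j k|g h _ IHg _ IHh|a g _ IH].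
- apply: (eq_trig_sum _ (trig_sumD
    (trig_sumZ 2^-1 (trig_sum_cos M (j + 1) (k - 1)))
    (trig_sumZ 2^-1 (trig_sum_cos M (j - 1) (k + 1))))) => x /=.
  rewrite !intrD !intrN.
  set A := j%:~R / M * x + k%:~R * (pi / 2).
  have -> : (j%:~R + 1%:~R) / M * x + (k%:~R - 1%:~R) * (pi / 2) = A + x / M - pi / 2.
    by rewrite /A; ring.
  have -> : (j%:~R - 1%:~R) / M * x + (k%:~R + 1%:~R) * (pi / 2) = A - x / M + pi / 2.
    by rewrite /A; ring.
  by rewrite cosBpihalf cosDpihalf sinD sinB; field.
- by apply: (eq_trig_sum _ (trig_sumD IHg IHh)) => x /=; rewrite mulrDl.
- by apply: (eq_trig_sum _ (trig_sumZ a IH)) => x /=; rewrite mulrA.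
Qed.

Lemma trig_sum_binomial_mean M n (h : nat -> R) :
  trig_sum M (fun x => binomial_mean n h ((1 + sin (x / M)) / 2)).
Proof.
elim: n h => [|n IH] h /=; first exact: trig_sum_cst.
have H1 := IH (h \o S); have H0 := IH h.
apply: (eq_trig_sum _ (trig_sumZ 2^-1 (trig_sumD
  (trig_sumD H1 (trig_sumM_sin H1))
  (trig_sumD H0 (trig_sumZ (-1) (trig_sumM_sin H0)))))) => x /=.
by field.
Qed.

(* [x |-> sin (x / M)] is injective on [-M, M], hence [f] coincides there with a
   continuous function of it, to which Bernstein polynomials apply. *)
Lemma trig_sum_approximation (f : R -> R) (B M e : R) : continuous f ->
  (forall x, `|f x| <= B) -> 0 < M -> 0 < e ->
  exists h, [/\ trig_sum M h, (forall x, `|x| <= M -> `|f x - h x| <= e) &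
    forall x, `|h x| <= B + e].
Proof.
move=> cf fB M0 e0.
pose c : R := sin 1.
have pi1 : 1 <= pi / 2 :> R := pihalf_ge1 R.
have c0 : 0 < c.
  by rewrite /c -sin0 ltr_sin ?in_itv/=; lra.
have c1 : c < 1.
  rewrite lt_neqAle sin_le1 andbT; apply/eqP => s1.
  have := cos2Dsin2 (1 : R); rewrite -/c s1 expr1n => /eqP.
  rewrite -subr_eq0 addrK sqrf_eq0; apply/negP; rewrite gt_eqF//.
  exact: cos1_gt0.
(* If u = (1 + sin(x / M)) / 2, then 2 u - 1 is the sine, and |x / M| <= 1 <= pi / 2 keeps it in
   [-c, c], where the clamp does nothing. Elsewhere the clamp keeps the argument of [asin] strictly
   inside (-1, 1), where [asin] is continuous. *)
pose cl (u : R) : R := Num.max (- c) (Num.min c (2 * u - 1)).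
have clb u : -1 < cl u < 1.
  by rewrite /cl lt_max gt_max gt_min; apply/andP; split; lra.
pose g u := f (M * asin (cl u)).
have cg : continuous g.
  move=> u; apply: (@continuous_comp _ _ _ (fun u => M * asin (cl u)) f); last exact: cf.
  apply: cvgM; first exact: cvg_cst.
  apply: (@continuous_comp _ _ _ cl (@asin R)); last exact: continuous_asin.
  apply: continuous_max; first exact: cvg_cst.
  apply: continuous_min; first exact: cvg_cst.
  apply: cvgB; last exact: cvg_cst.
  by apply: cvgM; [exact: cvg_cst|exact: cvg_id].
have gB : exists K : R, forall x, `|g x| <= K by exists B => x; exact: fB.
have [n Hn] := bernstein_approximation cg gB e0.
pose u x : R := (1 + sin (x / M)) / 2.
have u01 x : 0 <= u x <= 1.
  rewrite /u; have := sin_geN1 (x / M); have := sin_le1 (x / M); lra.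
exists (fun x => binomial_mean n.+1 (fun k => g (k%:R / n.+1%:R)) (u x)).
split; first exact: trig_sum_binomial_mean.
- move=> x xM; rewrite (_ : f x = g (u x)); first exact: Hn.
  have xM1 : -1 <= x / M <= 1.
    by rewrite -ler_norml normrM normfV (gtr0_norm M0) ler_pdivrMr// mul1r.
  have xp : x / M \in `[(- (pi / 2)), pi / 2] by rewrite in_itv/=; lra.
  have s1 : sin (x / M) <= c.
    by rewrite /c leNgt ltr_sin//; [lra|rewrite in_itv/=; lra].
  have s2 : - c <= sin (x / M).
    by rewrite /c -sinN leNgt ltr_sin//; [lra|rewrite in_itv/=; lra].
  rewrite /g (_ : cl (u x) = sin (x / M)) ?sinK//.
    by congr f; field; rewrite gt_eqF.
  rewrite /cl /u (_ : 2 * _ - 1 = sin (x / M)); last by field.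
  by rewrite min_r// max_r.
- move=> x; have := Hn _ (u01 x); set b := binomial_mean _ _ _ => h.
  have := fB (M * asin (cl (u x))); rewrite -/(g (u x)).
  rewrite (_ : b = g (u x) - (g (u x) - b)); last by ring.
  by move=> ?; rewrite (le_trans (ler_normB _ _))// lerD//.
Qed.

End trigonometric_approximation.

(** * Weak convergence from trigonometric integrals *)

Section bounded_measurable.
Context d (T : measurableType d) (R : realType).
Implicit Types f g : T -> R.

(** A class closed under the algebraic operations and integrable for every measure of mass 1, so
    that integrals can be rearranged freely. Applied on a carrier [g_sigma_algebraType G], it also
    expresses measurability with respect to the past. *)
Definition bounded_mfun f :=
  measurable_fun setT f /\ exists M : R, forall x, `|f x| <= M.

Lemma bounded_mfun_cst a : bounded_mfun (fun=> a).
Proof. by split => //; exists `|a|. Qed.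

Lemma bounded_mfunD f g : bounded_mfun f -> bounded_mfun g ->
  bounded_mfun (fun x => f x + g x).
Proof.
move=> [mf [M fM]] [mg [N gN]]; split; first exact: measurable_funD.
by exists (M + N) => x; rewrite (le_trans (ler_normD _ _))// lerD.
Qed.

Lemma bounded_mfunM f g : bounded_mfun f -> bounded_mfun g ->
  bounded_mfun (fun x => f x * g x).
Proof.
move=> [mf [M fM]] [mg [N gN]]; split; first exact: measurable_funM.
by exists (M * N) => x; rewrite normrM ler_pM.
Qed.

Lemma bounded_mfunN f : bounded_mfun f -> bounded_mfun (fun x => - f x).
Proof.
move=> [mf [M fM]]; split; first exact: measurableT_comp.
by exists M => x; rewrite normrN.
Qed.

Lemma bounded_mfunB f g : bounded_mfun f -> bounded_mfun g ->
  bounded_mfun (fun x => f x - g x).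
Proof. by move=> bf bg; apply: bounded_mfunD => //; exact: bounded_mfunN. Qed.

Lemma bounded_mfunX f n : bounded_mfun f -> bounded_mfun (fun x => f x ^+ n).
Proof.
move=> bf; elim: n => [|n IH]; first exact: bounded_mfun_cst.
by under eq_fun do rewrite exprS; exact: bounded_mfunM.
Qed.

Lemma bounded_mfun_norm f : bounded_mfun f -> bounded_mfun (fun x => `|f x|).
Proof.
move=> [mf [M fM]]; split; first exact: measurableT_comp.
by exists M => x; rewrite normr_id.
Qed.

Lemma bounded_mfun_indic A : measurable A -> bounded_mfun (\1_A : T -> R).
Proof.
move=> mA; split; first exact: measurable_indic.
by exists 1 => x; rewrite indicE; case: (_ \in _); rewrite ?normr1 ?normr0.
Qed.

Context (mu : {measure set T -> \bar R}).
Hypothesis mu1 : mu setT = 1%E.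

Lemma bounded_mfun_integrable f :
  bounded_mfun f -> mu.-integrable setT (EFin \o f).
Proof.
move=> [mf [M fM]]; apply: measurable_bounded_integrable => //.
  by rewrite mu1 ltry.
exists M; split; first exact: num_real.
by move=> x Mx t _ /=; rewrite (le_trans (fM t))// ltW.
Qed.

Lemma RintegralD_bounded f g : bounded_mfun f -> bounded_mfun g ->
  \int[mu]_x (f x + g x) = \int[mu]_x f x + \int[mu]_x g x.
Proof. by move=> bf bg; rewrite RintegralD//; exact: bounded_mfun_integrable. Qed.

Lemma RintegralB_bounded f g : bounded_mfun f -> bounded_mfun g ->
  \int[mu]_x (f x - g x) = \int[mu]_x f x - \int[mu]_x g x.
Proof. by move=> bf bg; rewrite RintegralB//; exact: bounded_mfun_integrable. Qed.

Lemma RintegralZl_bounded a f : bounded_mfun f ->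
  \int[mu]_x (a * f x) = a * \int[mu]_x f x.
Proof. by move=> bf; rewrite RintegralZl//; exact: bounded_mfun_integrable. Qed.

Lemma Rintegral_cst1 a : \int[mu]_x a = a.
Proof. by rewrite Rintegral_cst// mu1 mulr1. Qed.

Lemma le_Rintegral_bounded f g : bounded_mfun f -> bounded_mfun g ->
  (forall x, f x <= g x) -> \int[mu]_x f x <= \int[mu]_x g x.
Proof.
by move=> bf bg fg; apply: le_Rintegral => //; exact: bounded_mfun_integrable.
Qed.

Lemma le_normr_Rintegral_bounded f g : bounded_mfun f -> bounded_mfun g ->
  (forall x, `|f x| <= g x) -> `|\int[mu]_x f x| <= \int[mu]_x g x.
Proof.
move=> bf bg fg; have := bounded_mfun_integrable bf.
move/(le_normr_Rintegral measurableT)/le_trans; apply.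
by apply: le_Rintegral_bounded => //; exact: bounded_mfun_norm.
Qed.

Lemma EFin_Rintegral_bounded f : bounded_mfun f ->
  (\int[mu]_x f x)%:E = (\int[mu]_x (f x)%:E)%E.
Proof.
move=> /bounded_mfun_integrable fi; rewrite /Rintegral fineK//.
exact: integrable_fin_num.
Qed.

Lemma Rintegral_indic1 A : measurable A -> \int[mu]_x \1_A x = fine (mu A).
Proof. by move=> mA; rewrite /Rintegral integral_indic// setIT. Qed.

End bounded_measurable.

Section weak_convergence.
Context (R : realType).
Local Notation RR := (measurableTypeR R).

Lemma bounded_mfun_continuous (f : R -> R) (B : R) : continuous f ->
  (forall x, `|f x| <= B) -> bounded_mfun (f : RR -> R).
Proof. by move=> cf fB; split; [exact: continuous_measurable_fun|exists B]. Qed.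

Lemma trig_sum_continuous M (f : R -> R) : trig_sum M f -> continuous f.
Proof.
elim=> [j k|g h _ cg _ ch|a g _ cg] x.
- apply: (@continuous_comp _ _ _ (fun x => j%:~R / M * x + k%:~R * (pi / 2)) cos).
    by apply: cvgD; [exact: mulrl_continuous|exact: cvg_cst].
  exact: continuous_cos.
- exact: (cvgD (cg x) (ch x)).
- exact: (cvgM (cvg_cst _) (cg x)).
Qed.

Lemma trig_sum_bounded M (f : R -> R) : trig_sum M f -> bounded_mfun (f : RR -> R).
Proof.
move=> tf; split; first by apply: continuous_measurable_fun; exact: trig_sum_continuous tf.
elim: tf => [j k|g h _ [A gA] _ [B hB]|a g _ [A gA]].
- by exists 1 => x; rewrite ler_norml cos_geN1 cos_le1.
- by exists (A + B) => x; rewrite (le_trans (ler_normD _ _))// lerD.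
- by exists (`|a| * A) => x; rewrite normrM ler_wpM2l.
Qed.

Lemma trig_sum_cvg M (mu_ : nat -> {measure set RR -> \bar R})
    (nu : {measure set RR -> \bar R}) :
  (forall n, mu_ n setT = 1%E) -> nu setT = 1%E ->
  (forall j k : int,
    \int[mu_ n]_x cos (j%:~R / M * x + k%:~R * (pi / 2)) @[n --> \oo] -->
    \int[nu]_x cos (j%:~R / M * x + k%:~R * (pi / 2))) ->
  forall f, trig_sum M f ->
    \int[mu_ n]_x f x @[n --> \oo] --> \int[nu]_x f x.
Proof.
move=> mu1 nu1 Hcos f; elim=> [j k|g h tg IHg th IHh|a g tg IH]; first exact: Hcos.
- have bg := trig_sum_bounded tg; have bh := trig_sum_bounded th.
  rewrite (RintegralD_bounded nu1 bg bh).
  under eq_cvg do rewrite (RintegralD_bounded (mu1 _) bg bh).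
  exact: cvgD.
- have bg := trig_sum_bounded tg.
  rewrite (RintegralZl_bounded nu1 _ bg).
  under eq_cvg do rewrite (RintegralZl_bounded (mu1 _) _ bg).
  by apply: cvgM => //; exact: cvg_cst.
Qed.

Let tail (M : R) : set RR := [set x | M < `|x|].

Let measurable_tail M : measurable (tail M).
Proof.
rewrite -[tail M]setTI.
by apply: measurable_fun_ltr => //; exact: normr_measurable.
Qed.

(** Pointwise, the difference is at most [e] plus [B] times the indicator of the tail. *)
Lemma dist_Rintegral_tail (mu : {measure set RR -> \bar R}) (f h : R -> R) (M B e : R) :
  mu setT = 1%E -> 0 <= B -> bounded_mfun (f : RR -> R) -> bounded_mfun (h : RR -> R) ->
  (forall x, `|f x - h x| <= B) -> (forall x, `|x| <= M -> `|f x - h x| <= e) -> 0 <= e ->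
  `|\int[mu]_x f x - \int[mu]_x h x| <= e + B * fine (mu (tail M)).
Proof.
move=> mu1 B0 bf bh fhB fhe e0.
rewrite -(RintegralB_bounded mu1 bf bh).
have bi := bounded_mfun_indic R (measurable_tail M).
have bBi := bounded_mfunM (bounded_mfun_cst _ B) bi.
have := @le_normr_Rintegral_bounded _ _ _ mu mu1 (fun x => f x - h x)
  (fun x => e + B * \1_(tail M) x) (bounded_mfunB bf bh)
  (bounded_mfunD (bounded_mfun_cst _ e) bBi).
rewrite (RintegralD_bounded mu1 (bounded_mfun_cst _ e) bBi) (Rintegral_cst1 mu1).
rewrite (RintegralZl_bounded mu1 _ bi) Rintegral_indic1//; apply => x.
rewrite indicE; have [_|] := boolP (x \in tail M);
  first by rewrite mulr1 (le_trans (fhB x))// lerDr.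
by rewrite notin_setE /tail/= => /negP; rewrite -leNgt mulr0 addr0; exact: fhe.
Qed.

Lemma prob_tail_cvg0 (nu : probability RR R) :
  fine (nu (tail M.+1%:R)) @[M --> \oo] --> 0.
Proof.
have : nu (tail n.+1%:R) @[n --> \oo] --> nu (\bigcap_n tail n.+1%:R).
  apply: nonincreasing_cvg_mu => //.
  - by rewrite (le_lt_trans (probability_le1 _ _))// ltry.
  - exact: bigcapT_measurable.
  - by move=> n m nm; apply/subsetPset => x /=; apply: le_lt_trans; rewrite ler_nat.
rewrite (_ : \bigcap_n _ = set0) ?measure0; last first.
  rewrite -subset0 => x /(_ (Num.truncn `|x|) I)/=.
  by have /andP[_ ] := truncn_itv (normr_ge0 x) => /lt_trans/[apply]; rewrite ltxx.
by move/fine_cvg.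
Qed.

(** One integer serves as truncation level and as frequency scale: it is first chosen to make the
    tails small, and only then is the test function approximated on the truncated interval. *)
Lemma weak_cvg_trig (mu_ : nat -> {measure set RR -> \bar R}) (nu : probability RR R) :
  (forall n, mu_ n setT = 1%E) ->
  (forall (M : nat) (j k : int),
    \int[mu_ n]_x cos (j%:~R / M.+1%:R * x + k%:~R * (pi / 2)) @[n --> \oo] -->
    \int[nu]_x cos (j%:~R / M.+1%:R * x + k%:~R * (pi / 2))) ->
  (exists C : R, forall M : nat, \forall n \near \oo,
    (mu_ n [set x | (M.+1%:R < `|x|)%R] <= (C / M.+1%:R)%:E)%E) ->
  weak_cvg mu_ nu.
Proof.
move=> mu1 Hcos [C HC] f cf [B fB].
have B0 : 0 <= B by rewrite (le_trans _ (fB 0)).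
have nu1 : nu setT = 1%E by exact: probability_setT.
apply/cvgrPdist_le => /= e e0.
(* Three errors of size at most (B + 2) e' add up: replacing the test function by the trigonometric
   sum under [nu], the same under [mu_ n], and the convergence for the sum. Each replacement costs
   e' + (2 B + e') e' / 2, which is at most (B + 2) e' since e' <= 1. *)
pose e' := Num.min 1 (e / (4 * (B + 2))).
have e'0 : 0 < e' by rewrite lt_min ltr01 divr_gt0// mulr_gt0//; lra.
have e'1 : e' <= 1 by rewrite ge_min lexx.
have e'e : (B + 2) * e' * 4 <= e.
  have : e' <= e / (4 * (B + 2)) by rewrite ge_min lexx orbT.
  by rewrite ler_pdivlMr ?mulr_gt0//; lra.
have [M [nuM CM]] : exists M : nat,
  fine (nu (tail M.+1%:R)) <= e' / 2 /\ C / M.+1%:R <= e' / 2.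
  near \oo => M; exists M; split; near: M.
    have e20 : 0 < e' / 2 by rewrite divr_gt0.
    have /cvgrPdist_le/(_ _ e20) := prob_tail_cvg0 nu.
    apply: filterS => M; rewrite sub0r normrN; apply: le_trans; exact: ler_norm.
  have : C * (M.+1%:R)^-1 @[M --> \oo] --> C * 0.
    by apply: cvgM; [exact: cvg_cst|exact: cvg_harmonic].
  rewrite mulr0 => /cvgrPdist_le/(_ (e' / 2) _); rewrite divr_gt0// => /(_ isT).
  apply: filterS => M; rewrite sub0r normrN; apply: le_trans; exact: ler_norm.
have M0 : 0 < M.+1%:R :> R by rewrite ltr0Sn.
have [h [th fh hB]] := trig_sum_approximation cf fB M0 e'0.
have bf := bounded_mfun_continuous cf fB; have bh := trig_sum_bounded th.
have fhB x : `|f x - h x| <= 2 * B + e'.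
  by rewrite (le_trans (ler_normB _ _))//; have := fB x; have := hB x; lra.
have Be0 : 0 <= 2 * B + e' by lra.
have D (mu : {measure set RR -> \bar R}) : mu setT =
  1%E -> fine (mu (tail M.+1%:R)) <= e' / 2 ->
    `|\int[mu]_x f x - \int[mu]_x h x| <= (B + 2) * e'.
  move=> mmu1 muM; rewrite (le_trans (dist_Rintegral_tail mmu1 Be0 bf bh fhB fh (ltW e'0)))//.
  have := ler_wpM2l Be0 muM; nra.
have /cvgrPdist_le/(_ _ (mulr_gt0 (_ : 0 < B + 2) e'0)) := trig_sum_cvg mu1 nu1 (Hcos M) th.
have B2 : 0 < B + 2 by lra.
move=> /(_ B2); apply: filterS2 (HC M) => n HCn Hn.
have h1 := D _ nu1 nuM.
have h2 : `|\int[mu_ n]_x f x - \int[mu_ n]_x h x| <= (B + 2) * e'.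
  apply: D => //; rewrite (le_trans _ CM)// -lee_fin fineK//.
  rewrite ge0_fin_numE//; apply: le_lt_trans HCn _; exact: ltry.
have := ler_distD (\int[nu]_x h x) (\int[nu]_x f x) (\int[mu_ n]_x f x).
have := ler_distD (\int[mu_ n]_x h x) (\int[nu]_x h x) (\int[mu_ n]_x f x).
rewrite (distrC (\int[mu_ n]_x h x) (\int[mu_ n]_x f x)).
have := mulr_gt0 B2 e'0; lra.
Unshelve. all: end_near. Qed.

End weak_convergence.

(** * Independence of a draw and the past *)

Section independence.
Context d (T : measurableType d) (R : realType) (P : probability T R).

(** Both sides are finite measures in A, a restriction and a multiple of [P]; agreeing on a system
    stable under intersection, they agree on the sigma-algebra it generates. *)
Lemma indep_sigma_algebra (G : set_system T) (B : set T) :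
  setI_closed G -> G `<=` measurable -> measurable B ->
  (forall A, G A -> P (A `&` B) = (P A * P B)%E) ->
  forall A, <<s G >> A -> P (A `&` B) = (P A * P B)%E.
Proof.
move=> GI Gm mB indepG A sA.
have PB0 : 0 <= fine (P B) by rewrite fine_ge0.
pose m1 : {measure set T -> \bar R} := mrestr P mB.
pose m2 : {measure set T -> \bar R} := mscale (NngNum PB0) P.
have m1E X : m1 X = P (X `&` B) by [].
have m2E X : m2 X = (P X * P B)%E.
  by rewrite muleC -[in RHS](@fineK _ (P B)) ?fin_num_measure.
rewrite -m1E -m2E.
have GT : [set X | G X /\ X `<=` setT] = G.
  by apply/seteqP; split => [X []|X GX].
apply: (g_sigma_algebra_measure_unique_trace G setT); rewrite ?GT//.
- by rewrite m1E m2E setTI probability_setT mul1e.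
- by move=> X GX; rewrite m1E m2E indepG.
- by rewrite m1E setTI (le_lt_trans (probability_le1 _ _))// ltry.
Qed.

Lemma mutually_indep_fsetU1 (I : choiceType) (F : I -> set_system T)
    (J : {fset I}) (p : I) (A : I -> set T) :
  mutually_indep P F -> p \notin J ->
  (forall i, i \in (p |` J)%fset -> F i (A i)) ->
  P (\bigcap_(i in [set` J]) A i `&` A p) =
  (P (\bigcap_(i in [set` J]) A i) * P (A p))%E.
Proof.
move=> indF pJ FA.
have := indF (p |` J)%fset A FA; rewrite big_fsetU1//= => h.
rewrite (indF J A); last by move=> i iJ; apply: FA; rewrite inE iJ orbT.
rewrite muleC -h; congr (P _).
apply/seteqP; split=> [w [Jw pw] i /=|w Hw].
  by rewrite !inE => /orP[/eqP ->//|]; exact: Jw.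
by split=> [i iJ|]; apply: Hw => /=; rewrite !inE ?eqxx// iJ orbT.
Qed.

Section two_families.
Variables (I1 I2 : choiceType) (F1 : I1 -> set_system T) (F2 : I2 -> set_system T).
Hypotheses (F1T : forall i, F1 i setT) (F2T : forall j, F2 j setT).
Hypotheses (F1I : forall i, setI_closed (F1 i)) (F2I : forall j, setI_closed (F2 j)).
Hypotheses (F1m : forall i, F1 i `<=` measurable) (F2m : forall j, F2 j `<=` measurable).
Hypotheses (indF1 : mutually_indep P F1) (indF2 : mutually_indep P F2).
Hypothesis indF : indep_systems P <<s \bigcup_i F1 i >> <<s \bigcup_j F2 j >>.

Let bigcap_fset_sigma (I : choiceType) (F : I -> set_system T) (J : {fset I}) A :
  (forall i, i \in J -> F i (A i)) -> (<<s \bigcup_i F i >>) (\bigcap_(i in [set` J]) A i).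
Proof.
move=> FA; apply: (@fin_bigcap_measurable _ (g_sigma_algebraType (\bigcup_i F i))) => //.
by move=> i iJ; apply: sub_sigma_algebra; exists i => //; exact: FA.
Qed.

(** It suffices to take A = C1 [&] C2 with one event per index. Independence between the families
    splits off C2, and mutual independence within the first family separates C1 from B because [p]
    is a fresh index. *)
Lemma indep_two_families (J1 : {fset I1}) (J2 : {fset I2}) p A B :
  p \notin J1 -> F1 p B ->
  <<s \bigcup_(i in [set` J1]) F1 i `|` \bigcup_(j in [set` J2]) F2 j >> A ->
  P (A `&` B) = (P A * P B)%E.
Proof.
move=> pJ1 FB.
pose G : set_system T := [set A | exists A1 A2,
  [/\ forall i, F1 i (A1 i), forall j, F2 j (A2 j) &
      A = \bigcap_(i in [set` J1]) A1 i `&` \bigcap_(j in [set` J2]) A2 j]].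
have GI : setI_closed G.
  move=> X Y [X1 [X2 [FX1 FX2 ->]]] [Y1 [Y2 [FY1 FY2 ->]]].
  exists (fun i => X1 i `&` Y1 i), (fun j => X2 j `&` Y2 j); split.
  - by move=> i; exact: F1I.
  - by move=> i; exact: F2I.
  - by rewrite !bigcapI setIACA.
have Gm : G `<=` measurable.
  move=> X [X1 [X2 [FX1 FX2 ->]]]; apply: measurableI; apply: fin_bigcap_measurable => // i _.
    exact: (F1m (FX1 i)).
  exact: (F2m (FX2 i)).
have subG : <<s \bigcup_(i in [set` J1]) F1 i `|` \bigcup_(j in [set` J2]) F2 j >> `<=`
  <<s G >>.
  apply: smallest_sub; first exact: smallest_sigma_algebra.
  move=> X [[i iJ FX]|[j jJ FX]]; apply: sub_sigma_algebra.
  - exists (fun k => if k == i then X else setT), (fun=> setT); split => //.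
      by move=> k; case: eqP => [->|].
    apply/seteqP; split => [w Xw|w [/(_ i iJ)]]; last by rewrite eqxx.
    by split => // k _; case: ifP.
  - exists (fun=> setT), (fun k => if k == j then X else setT); split => //.
      by move=> k; case: eqP => [->|].
    apply/seteqP; split => [w Xw|w [_ /(_ j jJ)]]; last by rewrite eqxx.
    by split => // k _; case: ifP.
move=> /subG; apply: indep_sigma_algebra => //; first exact: (F1m FB).
move=> X [X1 [X2 [FX1 FX2 ->]]].
set C1 := \bigcap_(i in _) X1 i; set C2 := \bigcap_(i in _) X2 i.
have sC1 : (<<s \bigcup_i F1 i >>) C1 by exact: bigcap_fset_sigma.
have sC2 : (<<s \bigcup_i F2 i >>) C2 by exact: bigcap_fset_sigma.
have sB : (<<s \bigcup_i F1 i >>) B by apply: sub_sigma_algebra; exists p.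
have sC1B : (<<s \bigcup_i F1 i >>) (C1 `&` B).
  exact: (@measurableI _ (g_sigma_algebraType (\bigcup_i F1 i))).
rewrite setIAC (indF sC1B sC2) (indF sC1 sC2) muleAC; congr (_ * _)%E.
pose X1' i := if i == p then B else X1 i.
have E1 : C1 = \bigcap_(i in [set` J1]) X1' i.
  apply: eq_bigcapr => i /= iJ; rewrite /X1'; case: eqP => // ip.
  by rewrite -ip iJ in pJ1.
have E2 : B = X1' p by rewrite /X1' eqxx.
rewrite E1 [in LHS]E2 [in RHS]E2; apply: (mutually_indep_fsetU1 indF1) => // i _.
by rewrite /X1'; case: eqP => [->|].
Qed.

End two_families.
End independence.

Section independent_integral.
Context d d1 d2 (T : measurableType d) (T1 : measurableType d1)
  (T2 : measurableType d2) (R : realType) (P : probability T R).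
Variables (X : T -> T1) (Y : T -> T2).
Hypotheses (mX : measurable_fun setT X) (mY : measurable_fun setT Y).
Hypothesis indXY : forall A B, measurable A -> measurable B ->
  P (X @^-1` A `&` Y @^-1` B) = (P (X @^-1` A) * P (Y @^-1` B))%E.

Lemma bounded_mfun_comp (f : T1 -> R) : bounded_mfun f ->
  bounded_mfun (fun w => f (X w)).
Proof. by move=> [mf [M fM]]; split; [exact: measurableT_comp|exists M]. Qed.

(** Independence says that the pair has the product law, and Fubini does the rest. This replaces
    conditional expectations: freeze X, average over Y. *)
Lemma indep_Rintegral (G : T1 * T2 -> R) : bounded_mfun G ->
  \int[P]_w G (X w, Y w) = \int[P]_w \int[P]_w' G (X w, Y w').
Proof.
move=> bG; have [mG _] := bG.
pose X' : {mfun T >-> T1} := HB.pack X (isMeasurableFun.Build _ _ _ _ X mX).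
pose Y' : {mfun T >-> T2} := HB.pack Y (isMeasurableFun.Build _ _ _ _ Y mY).
pose XY w := (X w, Y w).
have mXY : measurable_fun setT XY by exact: measurable_fun_pair.
pose XY' : {mfun T >-> (T1 * T2)%type} := HB.pack XY (isMeasurableFun.Build _ _ _ _ XY mXY).
pose m1 := distribution P X'; pose m2 := distribution P Y'; pose m12 := distribution P XY'.
have m12E A : measurable A -> (m1 \x m2)%E A = m12 A.
  apply: product_measure_unique => A' B' mA mB.
  by rewrite -[RHS](indXY mA mB).
have GM z : bounded_mfun (fun w' => G (z, Y w')).
  have [_ [M GM]] := bG; split; last by exists M.
  by apply: measurableT_comp => //; apply: measurable_fun_pair.
have m121 : (m1 \x m2)%E setT = 1%E by rewrite m12E//; exact: probability_setT.
have iG := bounded_mfun_integrable m121 bG.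
have P1 : P setT = 1%E by exact: probability_setT.
have bGXY : bounded_mfun (fun w => G (X w, Y w)).
  by have [_ [M HM]] := bG; split; [exact: measurableT_comp|exists M].
have -> : \int[P]_w G (X w, Y w) = fine (\int[m12]_z (G z)%:E).
  rewrite /Rintegral (@integral_distribution _ _ _ _ _ P XY' (EFin \o G))//.
    exact/measurable_EFinP.
  exact: (bounded_mfun_integrable P1 bGXY).
rewrite (eq_measure_integral (m1 \x m2)%E); last by move=> A mA _; exact/esym/m12E.
rewrite -integral12_prod_meas1//.
pose H z := \int[P]_w' G (z, Y w').
have HE z : (\int[m2]_y (G (z, y))%:E)%E = (H z)%:E.
  rewrite /H EFin_Rintegral_bounded//
    (@integral_distribution _ _ _ _ _ P Y' (fun y => (G (z, y))%:E))//.
    by apply/measurable_EFinP; apply: measurableT_comp => //; exact: measurable_fun_pair.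
  exact: (bounded_mfun_integrable P1 (GM z)).
have bH : bounded_mfun H.
  split.
    have := measurable_fubini_F iG; rewrite /fubini_F.
    by under eq_fun do rewrite HE; move/measurable_EFinP.
  have [_ [M HM]] := bG; exists M => z.
  rewrite -[leRHS](Rintegral_cst1 P1).
  by apply: le_normr_Rintegral_bounded => //; exact: bounded_mfun_cst.
under eq_integral do rewrite /fubini_F HE.
rewrite (@integral_distribution _ _ _ _ _ P X' (EFin \o H))//.
- by apply/measurable_EFinP; case: bH.
- exact: (bounded_mfun_integrable P1 (bounded_mfun_comp bH)).
Qed.

End independent_integral.

Section sub_sigma_algebra.
Context d (T : measurableType d) (R : realType).
Implicit Types G : set_system T.

(** The identity onto the coarser space is a random variable that carries all the information in
    [G]; in this form the past can be frozen by [indep_Rintegral]. *)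
Lemma measurable_id_sigma_algebra G : G `<=` measurable ->
  measurable_fun setT (id : T -> g_sigma_algebraType G).
Proof.
move=> Gm _ A mA; rewrite setTI preimage_id.
by apply: (smallest_sub _ Gm) mA; exact: sigma_algebra_measurable.
Qed.

Lemma measurable_fun_sub_sigma_algebra d' (T' : measurableType d') G1 G2 (f : T -> T') :
  G1 `<=` <<s G2 >> ->
  measurable_fun (setT : set (g_sigma_algebraType G1)) f ->
  measurable_fun (setT : set (g_sigma_algebraType G2)) f.
Proof.
move=> G12 mf _ A mA; have := mf measurableT A mA; rewrite !setTI => sA.
by apply: (smallest_sub _ G12) sA; exact: smallest_sigma_algebra.
Qed.

Lemma bounded_mfun_sub G (f : g_sigma_algebraType G -> R) : G `<=` measurable ->
  bounded_mfun f -> bounded_mfun (f : T -> R).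
Proof.
move=> Gm [mf [M fM]]; split; last by exists M.
exact: (measurableT_comp mf (measurable_id_sigma_algebra Gm)).
Qed.

Lemma bounded_mfun_le (f g : T -> R) : measurable_fun setT f ->
  measurable_fun setT g -> bounded_mfun (fun x => (f x <= g x)%R%:R : R).
Proof.
move=> mf mg; have := measurable_fun_ler mf mg.
move=> /(_ measurableT [set true] I); rewrite setTI => mE.
have := bounded_mfun_indic R mE; congr (bounded_mfun _); apply/funext => x.
by rewrite indicE; congr (nat_of_bool _)%:R; apply/idP/idP; rewrite inE/=.
Qed.

Lemma bounded_mfun_sub_sigma_algebra G1 G2 (f : T -> R) : G1 `<=` <<s G2 >> ->
  bounded_mfun (f : g_sigma_algebraType G1 -> R) ->
  bounded_mfun (f : g_sigma_algebraType G2 -> R).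
Proof.
move=> G12 [mf [M fM]]; split; last by exists M.
exact: measurable_fun_sub_sigma_algebra mf.
Qed.

Lemma g_sigma_algebra_preimageT d' (T' : measurableType d') (X : T -> T') :
  g_sigma_algebra_preimage X setT.
Proof. by exists setT => //; rewrite setTI preimage_setT. Qed.

Lemma g_sigma_algebra_preimageI d' (T' : measurableType d') (X : T -> T') :
  setI_closed (g_sigma_algebra_preimage X).
Proof. exact: (@measurableI _ (g_sigma_algebra_preimageType X)). Qed.

Lemma g_sigma_algebra_preimage_sub d' (T' : measurableType d') (X : T -> T') :
  measurable_fun setT X -> g_sigma_algebra_preimage X `<=` measurable.
Proof. by move=> mX _ [B mB <-]; exact: mX. Qed.

End sub_sigma_algebra.

Section uniform.
Context d (T : measurableType d) (R : realType) (P : probability T R).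

Lemma uniform01_le (X : T -> R) (r : R) : measurable_fun setT X -> uniform01 P X ->
  0 <= r <= 1 -> \int[P]_w ((X w <= r)%R%:R) = r.
Proof.
move=> mX uX /andP[r0 r1].
pose B : set (measurableTypeR R) := `]-oo, r]%classic.
have mE : measurable (X @^-1` B).
  by rewrite -[_ @^-1` _]setTI; apply: mX => //; exact: measurable_itv.
rewrite (_ : (fun w => _) = \1_(X @^-1` B)); last first.
  apply/funext => w; rewrite indicE; congr (nat_of_bool _)%:R.
  by apply/idP/idP; rewrite inE/= /B/= in_itv.
rewrite Rintegral_indic1//.
transitivity (fine (uniform_prob (@ltr01 R) B)).
  by congr fine; apply: uX; exact: measurable_itv.
rewrite /uniform_prob integral_uniform_pdf /B.
rewrite (_ : `]-oo, r] `&` `[0, 1] = `[0, r]%classic); last first.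
  apply/seteqP; split => t /=; rewrite !in_itv/=; [by move=> [-> /andP[->]]|].
  by move=> /andP[-> tr]; rewrite tr (le_trans tr r1).
under eq_integral.
  move=> t; rewrite inE/= in_itv/= => /andP[t0 tr].
  rewrite /uniform_pdf t0 (le_trans tr r1) subr0 invr1.
  over.
rewrite integral_cst//= mul1e lebesgue_measure_itv/= lte_fin.
case: ltP => [_|]; first by rewrite /= oppr0 addr0.
by move=> r0'; apply/eqP; rewrite eq_le r0 r0'.
Qed.

End uniform.

(** * Independence of a draw and its reinforcements from the history of the urn *)

Section urn_independence.
Context d (T : measurableType d) (R : realType) (P : probability T R).
Variables (U : {RV P >-> R}^nat) (VW : {RV P >-> (R * R)%type}^nat).
Hypotheses (iidU : iid U) (uU : forall n, uniform01 P (U n)) (iidVW : iid VW).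
Hypothesis indUV : indep_systems P (sigma_seq U) (sigma_seq VW).
Local Notation A_ := (urn_filtration U VW).
Local Notation FU := (fun n => g_sigma_algebra_preimage (U n)).
Local Notation FV := (fun n => g_sigma_algebra_preimage (VW n)).
Local Notation J_ n := (fset_set `I_n).

Let FUm n : FU n `<=` measurable.
Proof. exact: g_sigma_algebra_preimage_sub. Qed.

Let FVm n : FV n `<=` measurable.
Proof. exact: g_sigma_algebra_preimage_sub. Qed.

Let J_E n : [set` J_ n] = `I_n.
Proof. by rewrite fset_setK. Qed.

Let notin_J n : n \notin J_ n.
Proof. by rewrite in_fset_set// notin_setE/= ltnn. Qed.

(** The two lengths differ when [VW k] is shown independent of the past together with [U k], that
    is, of [gens k.+1 k]: the pair [VW k] multiplies an indicator that involves [U k]. *)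
Let gens p q : set_system T :=
  \bigcup_(i in `I_p) FU i `|` \bigcup_(j in `I_q) FV j.

Let gens_sub p q : gens p q `<=` measurable.
Proof. by move=> X [[i _ /FUm]|[i _ /FVm]]. Qed.

Let indVW q p A B : FV q B -> <<s gens p q >> A -> P (A `&` B) = (P A * P B)%E.
Proof.
move=> FB; rewrite /gens -(J_E p) -(J_E q) setUC.
have indVU : indep_systems P <<s \bigcup_i FV i >> <<s \bigcup_i FU i >>.
  by move=> X Y sX sY; rewrite setIC muleC; exact: indUV.
apply: (indep_two_families _ _ _ _ FVm FUm iidVW.1 indVU (notin_J q) FB) => i;
  by [exact: g_sigma_algebra_preimageT|exact: g_sigma_algebra_preimageI].
Qed.

Let indU p q A B : FU p B -> <<s gens p q >> A -> P (A `&` B) = (P A * P B)%E.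
Proof.
move=> FB; rewrite /gens -(J_E p) -(J_E q).
apply: (indep_two_families _ _ _ _ FUm FVm iidU.1 indUV (notin_J p) FB) => i;
  by [exact: g_sigma_algebra_preimageT|exact: g_sigma_algebra_preimageI].
Qed.

Let filtration_gens n : A_ n = <<s gens n n >>.
Proof.
rewrite /urn_filtration; congr <<s _ >>; rewrite /gens -bigcupU.
exact: eq_bigcupr.
Qed.

Lemma urn_filtration_sub n : A_ n `<=` measurable.
Proof.
rewrite filtration_gens; apply: smallest_sub; last exact: gens_sub.
exact: sigma_algebra_measurable.
Qed.

Lemma urn_filtration_mono k n (f : T -> R) : (k <= n)%N ->
  bounded_mfun (f : g_sigma_algebraType (A_ k) -> R) ->
  bounded_mfun (f : g_sigma_algebraType (A_ n) -> R).
Proof.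
move=> kn; apply: bounded_mfun_sub_sigma_algebra => X AX.
apply: sub_sigma_algebra; move: AX; apply: sub_smallest2r; first exact: smallest_sigma_algebra.
by move=> Y [i ik FY]; exists i => //=; exact: leq_trans ik kn.
Qed.

Lemma measurable_urn_filtrationU k n : (k < n)%N ->
  measurable_fun (setT : set (g_sigma_algebraType (A_ n))) (U k).
Proof.
move=> kn _ B mB; rewrite setTI; do 2 apply: sub_sigma_algebra.
by exists k => //; left; exists B => //; rewrite setTI.
Qed.

Lemma measurable_urn_filtrationVW k n : (k < n)%N ->
  measurable_fun (setT : set (g_sigma_algebraType (A_ n))) (VW k).
Proof.
move=> kn _ B mB; rewrite setTI; do 2 apply: sub_sigma_algebra.
by exists k => //; right; exists B => //; rewrite setTI.
Qed.

Let S1 k := g_sigma_algebraType (gens k.+1 k).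

Let subG k : A_ k `<=` <<s gens k.+1 k >>.
Proof.
rewrite filtration_gens; apply: sub_smallest2r; first exact: smallest_sigma_algebra.
move=> X [[i ik FX]|XV]; [left|by right].
by exists i => //=; exact: ltnW.
Qed.

Let Rintegral_VW k (f : T -> R) (g : R * R -> R) :
  bounded_mfun (f : S1 k -> R) -> bounded_mfun g ->
  \int[P]_w (f w * g (VW k w)) = \int[P]_w f w * \int[P]_w g (VW k w).
Proof.
move=> bf bg; have P1 : P setT = 1%E by exact: probability_setT.
have idm1 := measurable_id_sigma_algebra (@gens_sub k.+1 k).
have ind1 (A : set (S1 k)) (B : set (R * R)) : measurable A -> measurable B ->
    P (id @^-1` A `&` VW k @^-1` B) = (P (id @^-1` A) * P (VW k @^-1` B))%E.
  by move=> mA mB; apply: indVW mA; exists B => //; rewrite setTI.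
have bfg : bounded_mfun (fun q : S1 k * (R * R) => f q.1 * g q.2).
  apply: bounded_mfunM; [have [mf [M fM]] := bf|have [mf [M fM]] := bg];
    split; by [apply: measurableT_comp|exists M].
rewrite (indep_Rintegral idm1 _ ind1 bfg)//=.
have bfT : bounded_mfun (f : T -> R) := bounded_mfun_sub (@gens_sub _ _) bf.
have bgVW : bounded_mfun (fun w => g (VW k w)) by exact: bounded_mfun_comp.
under eq_Rintegral do rewrite (RintegralZl_bounded P1 _ bgVW) mulrC.
by rewrite (RintegralZl_bounded P1 _ bfT) mulrC.
Qed.

Lemma Rintegral_reinforcement k (xi : T -> R) (g : R * R -> R) :
  bounded_mfun (xi : g_sigma_algebraType (A_ k) -> R) -> bounded_mfun g ->
  \int[P]_w (xi w * g (VW k w)) = \int[P]_w xi w * \int[P]_w g (VW k w).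
Proof.
move=> bxi; apply: Rintegral_VW.
exact: bounded_mfun_sub_sigma_algebra bxi.
Qed.

(* Given the past, the [k]-th draw and the reinforcements are independent. *)
Lemma Rintegral_draw k (xi z : T -> R) (g : R * R -> R) :
  bounded_mfun (xi : g_sigma_algebraType (A_ k) -> R) ->
  measurable_fun (setT : set (g_sigma_algebraType (A_ k))) z ->
  (forall w, 0 <= z w <= 1) -> bounded_mfun g ->
  \int[P]_w (xi w * (U k w <= z w)%R%:R * g (VW k w)) =
  \int[P]_w (xi w * z w) * \int[P]_w g (VW k w).
Proof.
move=> bxi mz z01 bg.
have P1 : P setT = 1%E by exact: probability_setT.
pose S := g_sigma_algebraType (A_ k).
(* The reinforcement is split off from the past enlarged by [U k]. *)
rewrite (@Rintegral_VW k (fun w => xi w * (U k w <= z w)%R%:R))//; last first.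
  apply: bounded_mfunM; first exact: bounded_mfun_sub_sigma_algebra bxi.
  apply: bounded_mfun_le; last exact: measurable_fun_sub_sigma_algebra mz.
  move=> _ B mB; rewrite setTI; apply: sub_sigma_algebra; left; exists k => //=.
  by exists B => //; rewrite setTI.
congr (_ * _).
have idm := measurable_id_sigma_algebra (@urn_filtration_sub k).
have ind2 (A : set S) (B : set R) : measurable A -> measurable B ->
    P (id @^-1` A `&` U k @^-1` B) = (P (id @^-1` A) * P (U k @^-1` B))%E.
  move=> mA mB; apply: (@indU k k).
    by exists B => //; rewrite setTI.
  rewrite -filtration_gens; apply: (smallest_sub _ _ mA) => //.
  exact: smallest_sigma_algebra.
have bxiz : bounded_mfun (fun q : S * R => xi q.1 * (q.2 <= z q.1)%R%:R).
  apply: bounded_mfunM.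
    by have [mf [M fM]] := bxi; split; [exact: measurableT_comp|exists M].
  by apply: bounded_mfun_le => //; exact: measurableT_comp.
rewrite (indep_Rintegral idm _ ind2 bxiz)//=.
(* With the past frozen, the indicator has mean [z w], because [U k] is uniform. *)
apply: eq_Rintegral => w _; rewrite RintegralZl_bounded// ?uniform01_le//.
exact: bounded_mfun_le.
Qed.

End urn_independence.

(** * Quantile transform *)

Section quantile.
Context (R : realType).
Local Notation RR := (measurableTypeR R).

Lemma eq_probability_itvNyc (m1 m2 : probability RR R) :
  (forall r, m1 `]-oo, r]%classic = m2 `]-oo, r]%classic) ->
  forall A, measurable A -> m1 A = m2 A.
Proof.
move=> m12 A mA.
have GT : [set X | ocitv X /\ X `<=` [set: R]] = @ocitv R.
  by apply/seteqP; split => [X []|X GX].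
have P1 (m : probability RR R) : m setT = 1%E by exact: probability_setT.
apply: (@g_sigma_algebra_measure_unique_trace _ R RR
  (@ocitv R) setT measurableT _ _ m1 m2); rewrite ?GT//.
- by move=> X oX; exact: sub_sigma_algebra.
- exact: ocitvI.
- exact: etrans (P1 m1) (esym (P1 m2)).
- move=> X [[a b]/= _ <-].
  have [ab | ba] := leP a b; last first.
    by rewrite set_itv_ge ?measure0// bnd_simp -leNgt ltW.
  have -> : `]a, b]%classic = `]-oo, b] `\` `]-oo, a] :> set RR.
    by rewrite -[RHS]setCK setCD setCitvl setUC -[LHS]setCK setCitv.
  rewrite !measureD ?setIidr//; try exact: subset_itvl.
  + by congr (_ - _)%E; exact: m12.
  + by apply: le_lt_trans (probability_le1 m2 _) (ltry _).
  + by apply: le_lt_trans (probability_le1 m1 _) (ltry _).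
- by apply: le_lt_trans (probability_le1 m1 _) (ltry _).
Qed.

Context (beta : R) (mu : probability RR R).
Hypotheses (beta0 : 0 < beta) (mu1 : mu `[0, beta]%classic = 1%E).
Local Notation F r := (mu `]-oo, r]%classic).
Local Notation S t := [set r : R | (t%:E <= F r)%E].

Let mono_F a b : a <= b -> (F a <= F b)%E.
Proof. by move=> ab; apply: le_measure; rewrite ?inE//; exact: subset_itvl. Qed.

Let F_neg (r : R) : r < 0 -> F r = 0%E.
Proof.
move=> r0; apply/eqP; rewrite eq_le measure_ge0 andbT.
have dis : `]-oo, r] `&` `[0, beta] = set0 :> set RR.
  apply/seteqP; split => // t [] /=; rewrite !in_itv/= => tr /andP[t0 _].
  by have := lt_le_trans r0 t0; rewrite ltNge tr.
have mU : measurable (`]-oo, r] `|` `[0, beta] : set RR) by exact: measurableU.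
have /le_trans/(_ (probability_le1 mu mU)) : (F r + 1 <= mu (`]-oo, r]%classic `|` `[0%R,
  beta]%classic))%E.
  by rewrite measureU// leeD2l// le_eqVlt; apply/orP; left; apply/eqP/esym; exact: mu1.
by move: (F r) => [s| |]//; rewrite -EFinD !lee_fin; lra.
Qed.

Let F_beta : F beta = 1%E.
Proof.
apply/eqP; rewrite eq_le probability_le1//=.
have : (mu `[0%R, beta]%classic <= F beta)%E.
  by apply: le_measure; rewrite ?inE// => t; rewrite /= !in_itv/= => /andP[].
by apply: le_trans; rewrite le_eqVlt; apply/orP; left; apply/eqP/esym; exact: mu1.
Qed.

Let lbS (t : R) : 0 < t -> lbound (S t) 0.
Proof.
move=> t0 r /= tF; rewrite leNgt; apply/negP => r0.
by move: tF; rewrite F_neg// lee_fin leNgt t0.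
Qed.

Let S_beta (t : R) : t <= 1 -> S t beta.
Proof. by move=> t1 /=; rewrite F_beta lee_fin. Qed.

Lemma quantile_out (t : R) : ~~ (0 < t <= 1) -> quantile mu t = 0.
Proof.
rewrite negb_and -leNgt -ltNge => /orP[t0|t1]; rewrite /quantile inf_out//.
- move=> [_ [b]]; rewrite /lbound /= => /(_ (b - 1)).
  have h : (t%:E <= F (b - 1)%R)%E by rewrite (@le_trans _ _ 0%E)// lee_fin.
  by move=> /(_ h); lra.
- move=> [[r /=]]; have := probability_le1 mu (measurable_itv `]-oo, r]).
  by move=> /[swap] /le_trans/[apply]; rewrite lee_fin leNgt t1.
Qed.

Lemma quantile_itv (t : R) : 0 <= quantile mu t <= beta.
Proof.
have [/andP[t0 t1]|/quantile_out ->] := boolP (0 < t <= 1); last first.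
  by rewrite lexx ltW.
apply/andP; split.
  by apply: lb_le_inf; [exists beta; exact: S_beta|exact: lbS].
by apply: ge_inf; [exists 0; exact: lbS|exact: S_beta].
Qed.

(** The Galois connection of quantile and distribution function. From left to right it rests on
    right continuity of [F]: there are points of [S t] within 1 / (n + 1) above the infimum, hence t
    <= F(r + 1 / (n + 1)) for all n. *)
Lemma quantile_le (t r : R) : 0 < t <= 1 -> (quantile mu t <= r) = (t%:E <= F r)%E.
Proof.
move=> /andP[t0 t1]; apply/idP/idP => [qr|tF]; last first.
  by apply: ge_inf => //; exists 0; exact: lbS.
have cvF : F (r + n.+1%:R^-1) @[n --> \oo] --> F r.
  have -> : `]-oo, r]%classic = \bigcap_n `]-oo, r + n.+1%:R^-1]%classic :> set RR.
    apply/seteqP; split => s /=; rewrite in_itv/= => sr.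
      by move=> n _ /=; rewrite in_itv/= (le_trans sr)// lerDl.
    rewrite leNgt; apply/negP => rs.
    have sr0 : 0 < s - r by rewrite subr_gt0.
    have := near_infty_natSinv_lt (PosNum sr0) => -[N _ /(_ N (leqnn N))] /= HN.
    move: HN; rewrite ltrBrDl ltNge => /negP; apply.
    by have := sr N I; rewrite /= in_itv.
  apply: nonincreasing_cvg_mu => //.
  - by rewrite (le_lt_trans (probability_le1 _ _))// ltry.
  - exact: bigcapT_measurable.
  - move=> n k nk; apply/subsetPset => s /=; rewrite !in_itv/= => /le_trans; apply.
    by rewrite lerD2l lef_pV2 ?posrE// ler_nat.
have <- : limn (fun n => F (r + n.+1%:R^-1)) = F r by exact/cvg_lim.
apply: lime_ge; first by apply/cvg_ex; exists (F r).
apply: nearW => n.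
have hS : has_inf (S t) by split; [exists beta; exact: S_beta|exists 0; exact: lbS].
have n0 : 0 < n.+1%:R^-1 :> R by rewrite invr_gt0.
have [s /= Ss sq] := inf_adherent n0 hS.
rewrite (le_trans Ss)//; apply: mono_F; rewrite (le_trans (ltW sq))// lerD2r.
exact: qr.
Qed.

Lemma quantile_preimage (r : R) : 0 <= r ->
  quantile mu @^-1` `]-oo, r]%classic `&` `[0, 1]%classic = `[0, fine (F r)]%classic.
Proof.
move=> r0; have F1 : fine (F r) <= 1.
  by rewrite -lee_fin fineK ?fin_num_measure//; exact: probability_le1.
(* At t = 0 the defining set is the whole line and [inf] returns 0; as 0 <= r, the endpoint 0 lies
   on both sides. *)
have q0 : quantile mu 0 = 0 by rewrite quantile_out// ltxx.
apply/seteqP; split => t /=; rewrite !in_itv/=.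
- move=> [qt /andP[t0 t1]]; rewrite t0/=; move: t0; rewrite le_eqVlt => /predU1P[<-|t0].
    exact: fine_ge0.
  by move: qt; rewrite quantile_le ?t0// => tF; rewrite -lee_fin fineK// fin_num_measure.
- move=> /andP[t0 tF]; have t1 := le_trans tF F1; rewrite t0 t1; split => //.
  move: t0; rewrite le_eqVlt => /predU1P[<-|t0]; first by rewrite q0.
  by rewrite quantile_le ?t0// -[leRHS]fineK ?fin_num_measure.
Qed.

Lemma measurable_quantile : measurable_fun [set: RR] (quantile mu).
Proof.
(* The default value 0 beyond 1 would destroy monotonicity. The clamped function is nondecreasing on
   the line, and multiplying it by the indicator of t <= 1 restores the default. *)
pose q (t : R) := quantile mu (Num.min (Num.max t 0) 1).
have mq : measurable_fun [set: RR] q.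
  apply: nondecreasing_measurable => // s t st; rewrite /q.
  have : Num.min (Num.max s 0) 1 <= Num.min (Num.max t 0) 1.
    by rewrite le_min !ge_min lexx !orbT andbT ge_max !le_max st lexx !orbT.
  have cb (u : R) : 0 <= Num.min (Num.max u 0) 1 <= 1.
    by rewrite le_min ge_min le_max !lexx ler01 !orbT.
  move: (cb s) (cb t); move: (Num.min (Num.max s 0) 1) (Num.min
    (Num.max t 0) 1) => s' t' /andP[s0 s1] /andP[t0 t1] {}st.
  move: s0; rewrite le_eqVlt => /predU1P[<-|s0].
    by rewrite quantile_out ?ltxx//; case/andP: (quantile_itv t').
  rewrite quantile_le ?s0// (@le_trans _ _ t'%:E) ?lee_fin//.
  by rewrite -quantile_le// t1 (lt_le_trans s0).
rewrite (_ : quantile mu = fun t => q t * (t <= 1)%R%:R).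
  by apply: measurable_funM => //; apply: (proj1 (bounded_mfun_le _ _)).
apply/funext => t; rewrite /q; have [t1|t1] := leP t 1; last first.
  by rewrite mulr0 quantile_out// negb_and -ltNge t1 orbT.
rewrite mulr1; have [t0|t0] := leP t 0; last by rewrite min_l.
by rewrite min_l// !quantile_out ?ltxx// negb_and -leNgt t0.
Qed.

Context d (T : measurableType d) (P : probability T R) (V : T -> R).
Hypotheses (mV : measurable_fun setT V) (uV : uniform01 P V).

Lemma quantile_distribution (A : set RR) : measurable A ->
  P ((fun w => quantile mu (V w)) @^-1` A) = mu A.
Proof.
have mqV : measurable_fun setT (fun w => quantile mu (V w) : RR).
  exact: measurableT_comp measurable_quantile mV.
pose X : {mfun T >-> RR} := HB.pack (fun w => quantile mu (V w) : RR)
  (isMeasurableFun.Build _ _ T RR _ mqV).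
suff : forall A : set RR, measurable A -> distribution P X A = mu A by exact.
apply: eq_probability_itvNyc => r.
have [r0|r0] := leP 0 r; last first.
  transitivity (P set0); last by rewrite measure0; exact/esym/F_neg.
  congr (P _); rewrite -subset0 => w /=; rewrite in_itv/= leNgt (lt_le_trans r0)//.
  by case/andP: (quantile_itv (V w)).
transitivity (uniform_prob (@ltr01 R) (quantile mu @^-1` `]-oo, r])).
  by apply: (uV (B := quantile mu @^-1` `]-oo, r]%classic)); rewrite -[_ @^-1` _]setTI;
    exact: measurable_quantile.
rewrite /uniform_prob integral_uniform_pdf quantile_preimage//.
have F1 : fine (F r) <= 1.
  by rewrite -lee_fin fineK ?fin_num_measure//; exact: probability_le1.
under eq_integral.
  move=> t; rewrite inE/= in_itv/= => /andP[t0 tr].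
  rewrite /uniform_pdf t0 (le_trans tr F1) subr0 invr1.
  over.
rewrite integral_cst//= mul1e lebesgue_measure_itv/= lte_fin.
case: ltP => [_|]; first by rewrite /= oppr0 addr0 fineK// fin_num_measure.
move=> Fr0; rewrite -[RHS]fineK ?fin_num_measure//; congr EFin.
by apply/eqP; rewrite eq_le Fr0 fine_ge0.
Qed.

Lemma Rintegral_quantile (h : R -> R) : measurable_fun [set: RR] h ->
  (exists M, forall r, 0 <= r <= beta -> `|h r| <= M) ->
  \int[P]_w h (quantile mu (V w)) = \int[mu]_r h r.
Proof.
move=> mh [M hM].
have mqV : measurable_fun setT (fun w => quantile mu (V w) : RR).
  exact: measurableT_comp measurable_quantile mV.
pose X : {mfun T >-> RR} := HB.pack (fun w => quantile mu (V w) : RR)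
  (isMeasurableFun.Build _ _ T RR _ mqV).
rewrite /Rintegral [in RHS](eq_measure_integral (distribution P X)); last first.
  by move=> A mA _; exact/esym/quantile_distribution.
rewrite integral_distribution//; first exact/measurable_EFinP.
apply: bounded_mfun_integrable; first exact: probability_setT.
split; first exact: (measurableT_comp mh mqV).
by exists M => w; exact/hM/quantile_itv.
Qed.

End quantile.

(** * One draw *)

Section taylor.
Context (R : realType).
Implicit Types u v b x : R.

(** Raises the order of an inequality by one integration from 0; the Taylor bounds below start from
    cos <= 1 and sin <= 1. *)
Lemma derive_ge0 (f f' : R -> R) : (forall x, is_derive x (1 : R) f (f' x)) ->
  f 0 = 0 -> (forall x, 0 <= x -> 0 <= f' x) -> forall x, 0 <= x -> 0 <= f x.
Proof.
move=> df f0 f'0 x; rewrite le_eqVlt => /predU1P[<-|x0]; first by rewrite f0.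
have cf : {within `[0, x], continuous f}.
  apply: continuous_subspaceT => y; apply: differentiable_continuous.
  by apply/derivable1_diffP; have [] := df y.
have [c] := MVT x0 (fun y _ => df y) cf.
rewrite in_itv/= f0 !subr0 => /andP[c0 _] ->.
by rewrite mulr_ge0 ?(ltW x0)//; apply: f'0; exact: ltW.
Qed.

Lemma sin_le_id u : 0 <= u -> 0 <= u - sin u.
Proof.
have d x : is_derive x (1 : R) (fun x : R => x - sin x) (1 - cos x).
  by apply: trigger_derive; rewrite /GRing.scale/=; ring.
apply: (derive_ge0 d) => [|x _]; first by rewrite sin0 subrr.
by rewrite subr_ge0 cos_le1.
Qed.

Lemma cos_ge_quadratic u : 0 <= u -> 0 <= cos u - 1 + u ^+ 2 / 2.
Proof.
have d x : is_derive x (1 : R) (fun x : R => cos x - 1 + x ^+ 2 / 2) (x - sin x).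
  by apply: trigger_derive; rewrite /GRing.scale/=; field.
apply: (derive_ge0 d); last exact: sin_le_id.
by rewrite cos0 expr0n mul0r subrr addr0.
Qed.

Lemma sin_ge_cubic u : 0 <= u -> 0 <= sin u - u + u ^+ 3 / 6.
Proof.
have d x : is_derive x (1 : R) (fun x : R => sin x - x + x ^+ 3 / 6)
    (cos x - 1 + x ^+ 2 / 2).
  by apply: trigger_derive; rewrite /GRing.scale/=; field.
apply: (derive_ge0 d); last exact: cos_ge_quadratic.
by rewrite sin0 expr0n mul0r subrr addr0.
Qed.

Lemma cos_le_cubic u : 0 <= u -> 0 <= u ^+ 3 / 6 - (cos u - 1 + u ^+ 2 / 2).
Proof.
have d3 x : is_derive x (1 : R)
    (fun x : R => x ^+ 3 / 6 - (cos x - 1 + x ^+ 2 / 2)) (x ^+ 2 / 2 - (x - sin x)).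
  by apply: trigger_derive; rewrite /GRing.scale/=; field.
have d2 x : is_derive x (1 : R)
    (fun x : R => x ^+ 2 / 2 - (x - sin x)) (x - (1 - cos x)).
  by apply: trigger_derive; rewrite /GRing.scale/=; field.
have d1 x : is_derive x (1 : R) (fun x : R => x - (1 - cos x)) (1 - sin x).
  by apply: trigger_derive; rewrite /GRing.scale/=; ring.
apply: (derive_ge0 d3); first by rewrite cos0 !expr0n !mul0r; ring.
apply: (derive_ge0 d2); first by rewrite sin0 expr0n mul0r; ring.
apply: (derive_ge0 d1) => [|x _]; first by rewrite cos0; ring.
by rewrite subr_ge0 sin_le1.
Qed.

Lemma cosD_taylor x u :
  `|cos (x + u) - (cos x - u * sin x - u ^+ 2 / 2 * cos x)| <= `|u| ^+ 3.
Proof.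
have H (w : R) : 0 <= w -> `|cos w - 1 + w ^+ 2 / 2| <= w ^+ 3 / 6 /\ `|sin w - w| <= w
  ^+ 3 / 6.
  move=> w0; split.
    rewrite ger0_norm; last exact: cos_ge_quadratic.
    by have := cos_le_cubic w0; lra.
  rewrite distrC ger0_norm; last exact: sin_le_id.
  by have := sin_ge_cubic w0; lra.
have [Hc Hs] : `|cos u - 1 + u ^+ 2 / 2| <= `|u| ^+ 3 / 6 /\ `|sin u - u| <= `|u| ^+ 3 / 6.
  have [u0|u0] := leP 0 u; first by rewrite (ger0_norm u0); exact: H.
  have u0' : 0 <= - u by rewrite oppr_ge0 ltW.
  have [h1 h2] := H _ u0'; rewrite (ltr0_norm u0); split.
    by move: h1; rewrite cosN sqrrN.
  by move: h2; rewrite sinN -opprD normrN.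
have -> : cos (x + u) - (cos x - u * sin x - u ^+ 2 / 2 * cos x) =
    cos x * (cos u - 1 + u ^+ 2 / 2) - sin x * (sin u - u).
  by rewrite cosD; ring.
have c1 : `|cos x| <= 1 by rewrite ler_norml cos_geN1 cos_le1.
have s1 : `|sin x| <= 1 by rewrite ler_norml sin_geN1 sin_le1.
rewrite (le_trans (ler_normB _ _))// !normrM.
have u3 : 0 <= `|u| ^+ 3 by rewrite exprn_ge0.
have h1 : `|cos x| * `|cos u - 1 + u ^+ 2 / 2| <= 1 * (`|u| ^+ 3 / 6) by exact: ler_pM.
have h2 : `|sin x| * `|sin u - u| <= 1 * (`|u| ^+ 3 / 6) by exact: ler_pM.
lra.
Qed.

(** Both exponentials are at most 1, which makes the remainder uniform in [b]. The larger of them is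
    factored out, according to the sign of [v]. *)
Lemma expRN_taylor b v : 0 <= b -> 0 <= b + v ->
  `|expR (- (b + v)) - expR (- b) * (1 - v)| <= v ^+ 2.
Proof.
move=> b0 bv0; have [v0|v0] := leP 0 v.
  have -> : expR (- (b + v)) - expR (- b) * (1 - v) = expR (- b) * (expR (- v) - 1 + v).
    by rewrite opprD expRD; ring.
  have e1 : expR (- b) <= 1 by rewrite -expR0 ler_expR oppr_le0.
  have h1 : 0 <= expR (- v) - 1 + v by have := expR_ge1Dx (- v); lra.
  have h2 : expR (- v) - 1 + v <= v ^+ 2.
    have h : expR (- v) * (1 + v) <= 1.
      by rewrite expRN mulrC ler_pdivrMr ?expR_gt0// mul1r expR_ge1Dx.
    have := expR_gt0 (- v); nra.
  rewrite ger0_norm ?mulr_ge0 ?expR_ge0//.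
  by rewrite (le_trans _ h2)// ler_piMl.
have -> : expR (- (b + v)) - expR (- b) * (1 - v) =
    expR (- (b + v)) * (1 - expR v * (1 - v)).
  have -> : expR (- b) = expR (- (b + v)) * expR v by rewrite -expRD; congr expR; ring.
  by ring.
have e1 : expR (- (b + v)) <= 1 by rewrite -expR0 ler_expR oppr_le0.
have h1 : 0 <= 1 - expR v * (1 - v).
  rewrite subr_ge0 mulrC.
  have : (1 - v) <= expR (- v) by have := expR_ge1Dx (- v); lra.
  by rewrite expRN -[X in _ <= X -> _]mul1r ler_pdivlMr ?expR_gt0.
have h2 : 1 - expR v * (1 - v) <= v ^+ 2 by have := expR_ge1Dx v; nra.
rewrite ger0_norm ?mulr_ge0 ?expR_ge0//.
by rewrite (le_trans _ h2)// ler_piMl.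
Qed.

Lemma expRN_lipschitz b v : 0 <= b -> 0 <= b + v ->
  `|expR (- (b + v)) - expR (- b)| <= `|v| /\ `|expR (- (b + v)) - expR (- b)| <= 1.
Proof.
move=> b0 bv0.
have e1 : expR (- b) <= 1 by rewrite -expR0 ler_expR oppr_le0.
have e2 : expR (- (b + v)) <= 1 by rewrite -expR0 ler_expR oppr_le0.
have p1 := expR_gt0 (- b); have p2 := expR_gt0 (- (b + v)).
have E : expR (- (b + v)) = expR (- b) * expR (- v) by rewrite opprD expRD.
have E' : expR (- b) = expR (- (b + v)) * expR v by rewrite -expRD; congr expR; ring.
have h1 := expR_ge1Dx (- v); have h2 := expR_ge1Dx v.
split; last by rewrite ler_norml; apply/andP; split; lra.
have [v0|v0] := leP 0 v.
  have m1 : expR (- (b + v)) <= expR (- b) by rewrite ler_expR; lra.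
  have k1 : 0 <= expR (- b) * (expR (- v) - (1 - v)) by rewrite mulr_ge0 ?subr_ge0 ?expR_ge0.
  have k2 : 0 <= (1 - expR (- b)) * v by rewrite mulr_ge0 ?subr_ge0.
  by rewrite (ger0_norm v0) ler_norml; apply/andP; split; rewrite E in m1 *; lra.
have m1 : expR (- b) <= expR (- (b + v)) by rewrite ler_expR; lra.
have k1 : 0 <= expR (- (b + v)) * (expR v - (1 + v)) by rewrite mulr_ge0 ?subr_ge0 ?expR_ge0.
have k2 : 0 <= (1 - expR (- (b + v))) * - v by rewrite mulr_ge0 ?subr_ge0// oppr_ge0 ltW.
by rewrite (ltr0_norm v0) ler_norml; apply/andP; split; rewrite E' in m1 *; lra.
Qed.

(** Second order in [u] but first order in [v]: the change of the exponent has the order of the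
    squared change of the angle. *)
Lemma cos_expRN_taylor x u b v : 0 <= b -> 0 <= b + v ->
  `|cos (x + u) * expR (- (b + v)) - expR (- b) *
     (cos x - u * sin x - u ^+ 2 / 2 * cos x - v * cos x)| <=
  2 * (`|u| ^+ 3 + `|u| * `|v| + v ^+ 2).
Proof.
move=> b0 bv0.
have := cosD_taylor x u; set c := cos x - u * sin x - _.
have := expRN_taylor b0 bv0.
have [] := expRN_lipschitz b0 bv0.
have e2 : expR (- (b + v)) <= 1 by rewrite -expR0 ler_expR oppr_le0.
have p2 := expR_gt0 (- (b + v)).
move: (expR (- (b + v))) (expR (- b)) e2 p2 => e' e e'1 e'0.
set r0 := e' - e; set r2 := e' - e * (1 - v); set r1 := cos (x + u) - c.
move=> r0v r01 r2v r1u.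
have -> : cos (x + u) * e' - e * (c - v * cos x) =
  r1 * e' + cos x * r2 - (u * sin x + u ^+ 2 / 2 * cos x) * r0.
  by rewrite /r1 /r2 /r0 /c; ring.
have c1 : `|cos x| <= 1 by rewrite ler_norml cos_geN1 cos_le1.
have s1 : `|sin x| <= 1 by rewrite ler_norml sin_geN1 sin_le1.
have h1 : `|r1 * e'| <= `|u| ^+ 3.
  by rewrite normrM (gtr0_norm e'0) -[leRHS]mulr1 ler_pM// ltW.
have h2 : `|cos x * r2| <= v ^+ 2 by rewrite normrM -[leRHS]mul1r ler_pM.
have h3 : `|u * sin x * r0| <= `|u| * `|v|.
  by rewrite !normrM ler_pM// -[leRHS]mulr1 ler_pM.
have h4 : `|u ^+ 2 / 2 * cos x * r0| <= `|u| ^+ 3 + `|u| * `|v|.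
  apply: (@le_trans _ _ (`|u| ^+ 2 * `|r0|)).
    have -> : u ^+ 2 / 2 * cos x * r0 = u ^+ 2 * (2^-1 * cos x * r0) by ring.
    rewrite normrM normrX ler_wpM2l ?exprn_ge0// normrM ler_piMl//.
    by rewrite normrM ger0_norm//; lra.
  (* If U <= 1, then U^2 r <= U r <= U V; otherwise r <= 1 gives U^2 r <= U^2 <= U^3. *)
  have aux (U r V : R) : 0 <= U -> 0 <= r -> r <= V -> r <= 1 ->
      U ^+ 2 * r <= U ^+ 3 + U * V.
    move=> U0 r0' rV r1'; have [U1|U1] := leP U 1.
      have k1 : 0 <= U * (V - r) by rewrite mulr_ge0 ?subr_ge0.
      have k2 : 0 <= U * r * (1 - U) by rewrite !mulr_ge0 ?subr_ge0.
      have k3 : 0 <= U ^+ 3 by rewrite exprn_ge0.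
      lra.
    have k1 : 0 <= U ^+ 2 * (1 - r) by rewrite mulr_ge0 ?sqr_ge0 ?subr_ge0.
    have k2 : 0 <= U ^+ 2 * (U - 1) by rewrite mulr_ge0 ?sqr_ge0 ?subr_ge0 ?ltW.
    have k3 : 0 <= U * V by rewrite mulr_ge0// (le_trans r0').
    rewrite exprS in k2 *; lra.
  exact: aux.
apply: (le_trans (ler_normB _ _)); rewrite [(u * sin x + _) * r0]mulrDl.
have := ler_normD (r1 * e') (cos x * r2).
have := ler_normD (u * sin x * r0) (u ^+ 2 / 2 * cos x * r0).
have := sqr_ge0 v; have : 0 <= `|u| ^+ 3 by rewrite exprn_ge0.
lra.
Qed.

End taylor.

Section domination.
Context (R : realType) (I : Type) (dom : I -> Prop).
Implicit Types f g h : I -> R.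

(** A Landau symbol over a whole domain instead of near a limit point: one constant has to serve all
    states of the urn and all scales. *)
Definition dominated f g := exists C : R, forall i, dom i -> `|f i| <= C * `|g i|.

Lemma dominated_ge0 f g : dominated f g ->
  exists2 C : R, 0 <= C & forall i, dom i -> `|f i| <= C * `|g i|.
Proof.
move=> [C fg]; exists `|C|; first exact: normr_ge0.
by move=> i di; rewrite (le_trans (fg i di))// ler_wpM2r// ler_norm.
Qed.

Lemma dominated_refl f : dominated f f.
Proof. by exists 1 => i _; rewrite mul1r. Qed.

Lemma eq_dominated f f' g : (forall i, dom i -> f i = f' i) ->
  dominated f g -> dominated f' g.
Proof. by move=> ff' [C fg]; exists C => i di; rewrite -ff'//; exact: fg. Qed.

Lemma dominated_trans f g h : dominated f g -> dominated g h -> dominated f h.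
Proof.
move=> /dominated_ge0[C C0 fg] [D gh]; exists (C * D) => i di.
by rewrite (le_trans (fg i di))// -mulrA ler_wpM2l// gh.
Qed.

Lemma dominated_cst f (C : R) : (forall i, dom i -> `|f i| <= C) ->
  dominated f (fun=> 1).
Proof. by move=> fC; exists C => i di; rewrite normr1 mulr1; exact: fC. Qed.

Lemma dominatedD f1 f2 g : dominated f1 g -> dominated f2 g ->
  dominated (fun i => f1 i + f2 i) g.
Proof.
move=> [C fg1] [D fg2]; exists (C + D) => i di.
by rewrite (le_trans (ler_normD _ _))// mulrDl lerD// ?fg1 ?fg2.
Qed.

Lemma dominatedN f g : dominated f g -> dominated (fun i => - f i) g.
Proof. by move=> [C fg]; exists C => i di; rewrite normrN fg. Qed.

Lemma dominatedB f1 f2 g : dominated f1 g -> dominated f2 g ->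
  dominated (fun i => f1 i - f2 i) g.
Proof. by move=> h1 h2; exact: (dominatedD h1 (dominatedN h2)). Qed.

Lemma dominatedM f1 f2 g1 g2 : dominated f1 g1 -> dominated f2 g2 ->
  dominated (fun i => f1 i * f2 i) (fun i => g1 i * g2 i).
Proof.
move=> /dominated_ge0[C C0 fg1] /dominated_ge0[D D0 fg2]; exists (C * D) => i di.
by rewrite !normrM mulrACA ler_pM// ?fg1 ?fg2.
Qed.

Lemma dominatedM1 f1 f2 g : dominated f1 (fun=> 1) -> dominated f2 g ->
  dominated (fun i => f1 i * f2 i) g.
Proof.
by move=> h1 h2; have [C HC] := dominatedM h1 h2; exists C => i di;
  rewrite (le_trans (HC i di))// mul1r.
Qed.

End domination.

(** * Expansion of the compensated cosine along one draw *)

Section one_draw.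
Context (R : realType).

(* The proportion [dZ] and the total [dD] before a draw, the colour drawn
   ([dbit]), the two potential reinforcements, a reference proportion [dZ0] and
   the scaling factor [dlam]. *)
Record draw := Draw {
  dZ : R; dD : R; dbit : bool; da : R; db : R; dZ0 : R; dlam : R }.

Context (beta s0 p q m t phi : R).
Hypotheses (beta0 : 0 < beta) (s00 : 0 < s0) (m0 : 0 < m) (p0 : 0 <= p) (q0 : 0 <= q).

Definition valid_draw i := [/\ 0 <= dZ i <= 1, s0 <= dD i, 0 <= da i <= beta,
  0 <= db i <= beta & 0 <= dZ0 i <= 1 /\ 1 <= dlam i].

Definition reinf i := if dbit i then da i else db i.
Definition incr i := if dbit i then (1 - dZ i) * da i else - (dZ i * db i).
Definition newD i := dD i + reinf i.
Definition newZ i := dZ i + incr i / newD i.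
Definition varS (z : R) := z * (1 - z) * ((1 - z) * p + z * q).
(** The derivative of [varS], written as a polynomial. *)
Definition dvarS (z : R) := p + 2 * (q - 2 * p) * z + 3 * (p - q) * z ^+ 2.
(** Solves m kappa l^2 S / D^2 = t^2 l^2 S / (2 D^2), the balance between the mean drift of the
    exponent and the quadratic term of the cosine. *)
Definition kappa := t ^+ 2 / (2 * m).
Definition charac (l z0 z D : R) :=
  cos (t * l * (z - z0) + phi) * expR (- (kappa * l ^+ 2 * (varS z / D))).
(** The leading part of the decrease of [charac]. It is built to have mean zero given the past:
    [incr] has mean 0, and [m * incr ^+ 2] and [varS (dZ i) * reinf i] both have mean m S. *)
Definition charac_lin i :=
  expR (- (kappa * dlam i ^+ 2 * (varS (dZ i) / dD i))) *
  (sin (t * dlam i * (dZ i - dZ0 i) + phi) * (t * dlam i) * (incr i / dD i) +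
   cos (t * dlam i * (dZ i - dZ0 i) + phi) * (kappa * dlam i ^+ 2 / dD i ^+ 2) *
     (m * incr i ^+ 2 - varS (dZ i) * reinf i + dvarS (dZ i) * incr i)).

Local Notation O := (dominated valid_draw).
Local Notation r := (fun i => (dD i)^-1).
Local Notation r' := (fun i => (newD i)^-1).

Let D0 i : valid_draw i -> 0 < dD i.
Proof. by move=> [_ sD _ _ _]; exact: lt_le_trans sD. Qed.

Lemma reinf_itv i : valid_draw i -> 0 <= reinf i <= beta.
Proof. by move=> [_ _ a b _]; rewrite /reinf; case: dbit. Qed.

Lemma newD_ge i : valid_draw i -> dD i <= newD i.
Proof. by move=> /reinf_itv/andP[h _]; rewrite /newD lerDl. Qed.

Let D'0 i : valid_draw i -> 0 < newD i.
Proof. by move=> vi; exact: lt_le_trans (D0 vi) (newD_ge vi). Qed.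

Lemma incr_bound i : valid_draw i -> `|incr i| <= beta.
Proof.
move=> [/andP[z0 z1] _ /andP[a0 a1] /andP[b0 b1] _]; rewrite /incr.
by case: dbit; rewrite ler_norml; apply/andP; split; nra.
Qed.

Lemma newZ_itv i : valid_draw i -> 0 <= newZ i <= 1.
Proof.
move=> vi; have D'p := D'0 vi; have Dp := D0 vi;
  have [/andP[z0 z1] _ /andP[a0 _] /andP[b0 _] _] := vi.
rewrite (_ : newZ i = (dZ i * newD i + incr i) / newD i); last first.
  by rewrite /newZ; field; rewrite gt_eqF.
have ZD0 : 0 <= dZ i * dD i by rewrite mulr_ge0// ltW.
have ZD1 : 0 <= (1 - dZ i) * dD i by rewrite mulr_ge0 ?subr_ge0// ltW.
apply/andP; split; first (apply: divr_ge0; last exact: ltW).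
  by rewrite /newD /reinf /incr; case: dbit; lra.
by rewrite ler_pdivrMr// mul1r /newD /reinf /incr; case: dbit; lra.
Qed.

Lemma varS_ge0 (z : R) : 0 <= z <= 1 -> 0 <= varS z.
Proof.
move=> /andP[z0 z1]; have z1' : 0 <= 1 - z by rewrite subr_ge0.
by rewrite /varS mulr_ge0// ?mulr_ge0// addr_ge0// mulr_ge0.
Qed.

Let O_incr : O incr (fun=> 1).
Proof. exact: dominated_cst incr_bound. Qed.

Let O_reinf : O reinf (fun=> 1).
Proof.
apply: (@dominated_cst _ _ _ _ beta) => i /reinf_itv/andP[h1 h2].
by rewrite ger0_norm.
Qed.

Let O_r'r : O r' r.
Proof.
exists 1 => i vi; rewrite mul1r !gtr0_norm ?invr_gt0 ?D0 ?D'0//.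
by rewrite lef_pV2 ?posrE ?D0 ?D'0// newD_ge.
Qed.

Let z_cst (f : draw -> R) : (forall i, valid_draw i -> 0 <= f i <= 1) -> O f (fun=> 1).
Proof.
move=> f01; apply: (@dominated_cst _ _ _ _ 1) => i /f01/andP[f0 f1].
by rewrite ger0_norm.
Qed.

Let O_cst (c : R) : O (fun=> c) (fun=> 1).
Proof. by apply: (@dominated_cst _ _ _ _ `|c|). Qed.

Let O_Z : O dZ (fun=> 1). Proof. by apply: z_cst => i []. Qed.

Let O_mul1 (f1 f2 : draw -> R) : O f1 (fun=> 1) -> O f2 (fun=> 1) -> O
  (fun i => f1 i * f2 i) (fun=> 1).
Proof. exact: dominatedM1. Qed.

Let O_S : O (fun i => varS (dZ i)) (fun=> 1).
Proof.
have O1 : O (fun i => 1 - dZ i) (fun=> 1) by exact: dominatedB.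
rewrite /varS; apply: O_mul1; first exact: O_mul1.
by apply: dominatedD; apply: O_mul1.
Qed.

Let O_dS : O (fun i => dvarS (dZ i)) (fun=> 1).
Proof.
rewrite /dvarS; apply: dominatedD; [apply: dominatedD => //|]; apply: O_mul1 => //.
by apply: (eq_dominated _ (O_mul1 O_Z O_Z)) => i _; rewrite expr2.
Qed.

Let h (i : draw) : R := incr i / newD i.

Let O_h : O h r.
Proof. exact: dominatedM1. Qed.

Let h_r : O (fun i => h i - incr i / dD i) (fun i => (dD i)^-1 * (dD i)^-1).
Proof.
have : O (fun i => - (incr i * reinf i) * ((dD i)^-1 * (newD i)^-1)) (fun i =>
  (dD i)^-1 * (dD i)^-1).
  apply: dominatedM1; first by apply: dominatedN; exact: O_mul1.
  by apply: dominatedM => //; exact: dominated_refl.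
apply: eq_dominated => i vi; have := D0 vi; have := D'0 vi; rewrite /h /newD => d' d.
by field; rewrite !gt_eqF.
Qed.

Let hh_rr : O (fun i => h i ^+ 2 - incr i ^+ 2 / dD i ^+ 2)
  (fun i => (dD i)^-1 * (dD i)^-1 * (dD i)^-1).
Proof.
have O2 : O (fun i => h i + incr i * (dD i)^-1) r.
  by apply: dominatedD => //; apply: dominatedM1 => //; exact: dominated_refl.
apply: (eq_dominated _ (dominatedM h_r O2)) => i vi.
by have := D0 vi => d; field; rewrite gt_eqF.
Qed.

Let dB i := varS (newZ i) / newD i - varS (dZ i) / dD i.

Let dB_r : O (fun i => dB i - (dvarS (dZ i) * incr i - varS (dZ i) * reinf i) / dD i ^+ 2)
  (fun i => (dD i)^-1 * (dD i)^-1 * (dD i)^-1).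
Proof.
(* As S is a cubic polynomial, its expansion is exact: S(z + h) = S(z) + S'(z) h + Q h^2. Together
   with newD = D + reinf this makes the remainder the sum of the four terms below. *)
pose Q i := (q - 2 * p) + (p - q) * (3 * dZ i + h i).
have O_newZ : O newZ (fun=> 1) by apply: z_cst; exact: newZ_itv.
have O_h1 : O h (fun=> 1).
  apply: (eq_dominated _ (dominatedB O_newZ O_Z)) => i _; rewrite /h /newZ; ring.
have OQ : O Q (fun=> 1).
  by apply: dominatedD => //; apply: O_mul1 => //; apply: dominatedD => //; apply: O_mul1.
have T1 : O (fun i => dvarS (dZ i) * ((h i - incr i / dD i) * (newD i)^-1))
    (fun i => (dD i)^-1 * (dD i)^-1 * (dD i)^-1).
  by apply: dominatedM1 => //; exact: dominatedM.
have T2 : O (fun i => (dvarS (dZ i) * - (incr i * reinf i)) * ((dD i)^-1 * (dD i)^-1 *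
  (newD i)^-1))
    (fun i => (dD i)^-1 * (dD i)^-1 * (dD i)^-1).
  apply: dominatedM1; first by apply: O_mul1 => //; apply: dominatedN; exact: O_mul1.
  by apply: dominatedM => //; exact: dominated_refl.
have T3 : O (fun i => Q i * (h i * h i * (newD i)^-1)) (fun i => (dD i)^-1 * (dD i)^-1 *
  (dD i)^-1).
  by apply: dominatedM1 => //; do 2! apply: dominatedM => //.
have T4 : O (fun i => (varS (dZ i) * (reinf i * reinf i)) * ((dD i)^-1 * (dD i)^-1 *
  (newD i)^-1))
    (fun i => (dD i)^-1 * (dD i)^-1 * (dD i)^-1).
  apply: dominatedM1; first by do 2! apply: O_mul1 => //.
  by apply: dominatedM => //; exact: dominated_refl.
apply: (eq_dominated _ (dominatedD (dominatedD T1 T2) (dominatedD T3 T4))) => i vi.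
have := D0 vi; have := D'0 vi; rewrite /dB /Q /h /newZ /varS /dvarS.
rewrite (_ : reinf i = newD i - dD i); last by rewrite /newD; ring.
by move=> d' d; field; rewrite !gt_eqF.
Qed.

(** The first term comes from writing 1 / D for 1 / newD in the angle, the second from |u|^3 and |u
    v|, the third from v^2. Replacing h^2 and [dB] by their leading terms costs l^2 / D^3, which the
    second term covers because l >= 1. *)
Definition charac_err i :=
  dlam i / dD i ^+ 2 + dlam i ^+ 3 / dD i ^+ 3 + dlam i ^+ 4 / dD i ^+ 4.

Let dominated_err (f : draw -> R) :
  (forall i, valid_draw i -> 0 <= f i <= charac_err i) -> O f charac_err.
Proof.
move=> f01; exists 1 => i /f01/andP[f0 f1].
by rewrite mul1r !ger0_norm// (le_trans f0).
Qed.

Let err_terms i (x := (dD i)^-1) (l := dlam i) : valid_draw i ->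
  charac_err i = l * (x * x) + l ^+ 3 * (x * x * x) + l ^+ 4 * (x * x * (x * x)) /\
  [/\ 0 <= l * (x * x), 0 <= l ^+ 2 * (x * x * x),
      l ^+ 2 * (x * x * x) <= l ^+ 3 * (x * x * x) &
      0 <= l ^+ 4 * (x * x * (x * x))].
Proof.
move=> vi; have d := D0 vi; have [_ _ _ _ [_ l1]] := vi.
have x0 : 0 <= x by rewrite invr_ge0 ltW.
have l0 : 0 <= l by rewrite (le_trans ler01).
split; first by rewrite /charac_err /x /l; field; rewrite gt_eqF.
by split; rewrite ?mulr_ge0 ?exprn_ge0// ler_wpM2r ?mulr_ge0// [leRHS]exprS ler_peMl//
  exprn_ge0.
Qed.

Let O_err21 : O (fun i => dlam i * ((dD i)^-1 * (dD i)^-1)) charac_err.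
Proof. by apply: dominated_err => i /err_terms[-> [*]]; apply/andP; split; lra. Qed.

Let O_err23 : O (fun i => dlam i ^+ 2 * ((dD i)^-1 * (dD i)^-1 * (dD i)^-1)) charac_err.
Proof. by apply: dominated_err => i /err_terms[-> [*]]; apply/andP; split; lra. Qed.

Let O_err33 : O (fun i => dlam i ^+ 3 * ((dD i)^-1 * (dD i)^-1 * (dD i)^-1)) charac_err.
Proof. by apply: dominated_err => i /err_terms[-> [*]]; apply/andP; split; lra. Qed.

Let O_err44 : O (fun i => dlam i ^+ 4 * ((dD i)^-1 * (dD i)^-1 * ((dD i)^-1 *
  (dD i)^-1))) charac_err.
Proof. by apply: dominated_err => i /err_terms[-> [*]]; apply/andP; split; lra. Qed.

Let O_lam : O dlam dlam. Proof. exact: dominated_refl. Qed.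

Let O_trig (f : R -> R) (g : draw -> R) : (forall x, `|f x| <= 1) ->
  O (fun i => f (g i)) (fun=> 1).
Proof. by move=> f1; exact: (@dominated_cst _ _ _ _ 1). Qed.

Let th i := t * dlam i * (dZ i - dZ0 i) + phi.
Let u i := t * dlam i * h i.
Let bb i := kappa * dlam i ^+ 2 * (varS (dZ i) / dD i).
Let v i := kappa * dlam i ^+ 2 * dB i.
Let lin i := (dvarS (dZ i) * incr i - varS (dZ i) * reinf i) / dD i ^+ 2.

Let O_lin : O lin (fun i => (dD i)^-1 * (dD i)^-1).
Proof.
apply: (@eq_dominated _ _ _ (fun i => (dvarS (dZ i) * incr i - varS (dZ i) * reinf i) *
  ((dD i)^-1 * (dD i)^-1))).
  by move=> i vi; rewrite /lin -exprVn expr2.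
by apply: dominatedM1; [apply: dominatedB; exact: O_mul1|exact: dominated_refl].
Qed.

Let O_r1 : O r (fun=> 1).
Proof.
apply: (@dominated_cst _ _ _ _ s0^-1) => i vi; have d := D0 vi; have [_ sD _ _ _] := vi.
by rewrite gtr0_norm ?invr_gt0// lef_pV2 ?posrE.
Qed.

Let O_dB : O dB (fun i => (dD i)^-1 * (dD i)^-1).
Proof.
have h3 : O (fun i => dB i - lin i) (fun i => (dD i)^-1 * (dD i)^-1).
  by apply: dominated_trans dB_r _;
    apply: (eq_dominated _ (dominatedM1 O_r1 (dominated_refl _ _))) => i _; rewrite mulrC.
apply: (eq_dominated _ (dominatedD h3 O_lin)) => i _; ring.
Qed.

Let O_u : O u (fun i => dlam i * (dD i)^-1).
Proof.
apply: (@eq_dominated _ _ _ (fun i => t * (dlam i * h i))).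
  by move=> i _; rewrite /u mulrA.
by apply: dominatedM1 => //; exact: dominatedM.
Qed.

Let O_lam2 : O (fun i => dlam i ^+ 2) (fun i => dlam i ^+ 2).
Proof. exact: dominated_refl. Qed.

Let O_v : O v (fun i => dlam i ^+ 2 * ((dD i)^-1 * (dD i)^-1)).
Proof.
apply: (@eq_dominated _ _ _ (fun i => kappa * (dlam i ^+ 2 * dB i))).
  by move=> i _; rewrite /v mulrA.
by apply: dominatedM1 => //; exact: dominatedM.
Qed.

Let O_taylor : O (fun i => cos (th i + u i) * expR (- (bb i + v i)) - expR (- bb i) *
     (cos (th i) - u i * sin (th i) - u i ^+ 2 / 2 * cos (th i) - v i * cos (th i)))
  charac_err.
Proof.
have Ou : O (fun i => `|u i|) (fun i => dlam i * (dD i)^-1).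
  by have [C HC] := O_u; exists C => i vi; rewrite normr_id; exact: HC.
have Ov : O (fun i => `|v i|) (fun i => dlam i ^+ 2 * ((dD i)^-1 * (dD i)^-1)).
  by have [C HC] := O_v; exists C => i vi; rewrite normr_id; exact: HC.
have E1 : O (fun i => `|u i| ^+ 3) charac_err.
  apply: dominated_trans O_err33.
  by have [C HC] := dominatedM Ou (dominatedM Ou Ou); exists C => i vi;
    have := HC i vi; rewrite !exprS expr0 mulr1; congr (_ <= _ * `|_|); ring.
have E2 : O (fun i => `|u i| * `|v i|) charac_err.
  apply: dominated_trans O_err33.
  by have [C HC] := dominatedM Ou Ov; exists C => i vi; have := HC i vi;
    congr (_ <= _ * `|_|); ring.
have E3 : O (fun i => `|v i| * `|v i|) charac_err.
  apply: dominated_trans O_err44.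
  by have [C HC] := dominatedM Ov Ov; exists C => i vi; have := HC i vi;
    congr (_ <= _ * `|_|); ring.
have E : O (fun i => 2 * (`|u i| ^+ 3 + `|u i| * `|v i| + v i ^+ 2)) charac_err.
  apply: dominatedM1 => //; apply: dominatedD; first exact: dominatedD.
  by apply: (eq_dominated _ E3) => i _; rewrite -normrM -expr2 ger0_norm// sqr_ge0.
have [C HC] := E; exists C => i vi; rewrite (le_trans _ (HC i vi))//.
have k0 : 0 <= kappa by rewrite /kappa divr_ge0 ?sqr_ge0// mulr_ge0// ltW.
have kl : 0 <= kappa * dlam i ^+ 2 by rewrite mulr_ge0// sqr_ge0.
have d := D0 vi; have d' := D'0 vi; have [Z01 _ _ _ _] := vi.
rewrite (le_trans _ (ler_norm _))// cos_expRN_taylor//.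
  by rewrite /bb mulr_ge0// divr_ge0 ?varS_ge0// ltW.
rewrite (_ : _ + _ = kappa * dlam i ^+ 2 * (varS (newZ i) / newD i));
  last by rewrite /bb /v /dB; ring.
by rewrite mulr_ge0// divr_ge0 ?varS_ge0 ?newZ_itv// ltW.
Qed.

Lemma charac_step : O (fun i =>
  charac (dlam i) (dZ0 i) (newZ i) (newD i) - charac (dlam i) (dZ0 i) (dZ i) (dD i)
   + charac_lin i) charac_err.
Proof.
have Oe : O (fun i => expR (- bb i)) (fun=> 1).
  apply: (@dominated_cst _ _ _ _ 1) => i vi; rewrite gtr0_norm ?expR_gt0//.
  have k0 : 0 <= kappa by rewrite /kappa divr_ge0 ?sqr_ge0// mulr_ge0// ltW.
  have d := D0 vi; have [Z01 _ _ _ _] := vi.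
  have kl : 0 <= kappa * dlam i ^+ 2 by rewrite mulr_ge0// sqr_ge0.
  by rewrite -expR0 ler_expR oppr_le0 /bb mulr_ge0// divr_ge0 ?varS_ge0// ltW.
have Os : O (fun i => sin (th i)) (fun=> 1).
  by apply: O_trig => x; rewrite ler_norml sin_geN1 sin_le1.
have Oc : O (fun i => cos (th i)) (fun=> 1).
  by apply: O_trig => x; rewrite ler_norml cos_geN1 cos_le1.
(* [T1], [T2] and [T3] account for replacing h, h^2 and [dB] by their leading terms in the Taylor
   expansion. *)
have T1 : O (fun i => (expR (- bb i) * sin (th i)) * (t * (dlam i *
  (h i - incr i / dD i)))) charac_err.
  apply: dominatedM1; first exact: O_mul1.
  by apply: dominatedM1 => //; apply: dominated_trans O_err21; exact: dominatedM.
have T2 : O (fun i => (expR (- bb i) * cos (th i)) *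
     (t ^+ 2 / 2 * (dlam i ^+ 2 * (h i ^+ 2 - incr i ^+ 2 / dD i ^+ 2)))) charac_err.
  apply: dominatedM1; first exact: O_mul1.
  by apply: dominatedM1 => //; apply: dominated_trans O_err23; exact: dominatedM.
have T3 : O (fun i => (expR (- bb i) * cos (th i)) *
     (kappa * (dlam i ^+ 2 * (dB i - lin i)))) charac_err.
  apply: dominatedM1; first exact: O_mul1.
  by apply: dominatedM1 => //; apply: dominated_trans O_err23; exact: dominatedM.
apply: (eq_dominated _ (dominatedB O_taylor (dominatedD T1 (dominatedD T2 T3)))) => i vi.
have d := D0 vi.
have -> : charac (dlam i) (dZ0 i) (newZ i) (newD i) = cos (th i + u i) * expR (- (bb i + v i)).
  rewrite /charac; congr (cos _ * expR (- _)); first by rewrite /th /u /newZ /h; ring.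
  by rewrite /bb /v /dB; ring.
rewrite /charac -/(th i) -/(bb i) /charac_lin -/(th i) -/(bb i).
move: (sin (th i)) (cos (th i)) (expR (- bb i)) (cos _ * _) => si co ex ps.
rewrite /u /v /lin /kappa; move: (dB i) (h i) (varS _) (dvarS _) => B H S dS.
by field; rewrite !gt_eqF.
Qed.

Lemma square_step : O (fun i => (newZ i - dZ0 i) ^+ 2 - (dZ i - dZ0 i) ^+ 2 -
  2 * (dZ i - dZ0 i) * (incr i / dD i)) (fun i => dD i ^- 2).
Proof.
have O_Z0 : O (fun i => 2 * (dZ i - dZ0 i)) (fun=> 1).
  by apply: O_mul1 => //; apply: dominatedB => //; apply: z_cst => i [] _ _ _ _ [].
have T : O (fun i => 2 * (dZ i - dZ0 i) * (h i - incr i / dD i) + h i * h i)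
    (fun i => (dD i)^-1 * (dD i)^-1).
  by apply: dominatedD; [exact: dominatedM1|exact: dominatedM].
have [C HC] := T; exists C => i vi; have := HC i vi; rewrite -exprVn expr2.
by congr (`|_| <= _); rewrite /newZ -/(h i); ring.
Qed.

(** The difference equals reinf / D^2 times D / newD, and D / newD is at least s0 / (s0 + beta),
    since D >= s0 and a draw adds at most beta. *)
Lemma inverse_step i : valid_draw i ->
  s0 / (s0 + beta) * (reinf i / dD i ^+ 2) <= (dD i)^-1 - (newD i)^-1.
Proof.
move=> vi; have d := D0 vi; have d' := D'0 vi; have [_ sD _ _ _] := vi.
have /andP[r0 rb] := reinf_itv vi; have sb : 0 < s0 + beta by rewrite addr_gt0.
have -> : (dD i)^-1 - (newD i)^-1 = reinf i / dD i ^+ 2 * (dD i / newD i).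
  by move: d'; rewrite /newD => d'; field; rewrite !gt_eqF.
rewrite mulrC ler_wpM2l ?divr_ge0 ?exprn_ge0 ?(ltW d)//.
rewrite ler_pdivrMr// mulrAC ler_pdivlMr// /newD; nra.
Qed.

End one_draw.

(** * Conditional distributions *)

Lemma bounded_cvg_Rintegral d (T : measurableType d) (R : realType)
    (mu : {measure set T -> \bar R}) (f_ : nat -> T -> R) (f : T -> R) (M : R) :
  mu setT = 1%E -> (forall n, measurable_fun setT (f_ n)) ->
  measurable_fun setT f -> (forall n x, `|f_ n x| <= M) ->
  {ae mu, forall x, f_ n x @[n --> \oo] --> f x} ->
  \int[mu]_x f_ n x @[n --> \oo] --> \int[mu]_x f x.
Proof.
move=> mu1 mf_ mf fM f_f.
have bM : bounded_mfun ((fun=> M) : T -> R) by exact: bounded_mfun_cst.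
have [||//|||] := @dominated_convergence _ T R mu setT measurableT
  (fun n => EFin \o f_ n) (EFin \o f) (cst M%:E).
- by move=> n; exact: measurableT_comp.
- exact: measurableT_comp.
- apply: filterS f_f => x fx _; apply: cvg_EFin; [exact: nearW|exact: fx].
- exact: (bounded_mfun_integrable mu1 bM).
- by apply: (aeW mu) => x n _; rewrite /= lee_fin.
move=> If _ h; rewrite /Rintegral.
apply: fine_cvg; rewrite fineK; first exact: h.
exact: integrable_fin_num If.
Qed.

(** The sum of the series is integrable by monotone convergence, hence almost everywhere finite,
    which forces its terms to 0. *)
Lemma ae_cvg0_summable d (T : measurableType d) (R : realType)
    (mu : {measure set T -> \bar R}) (f_ : nat -> T -> R) (M : R) :
  mu setT = 1%E -> (forall n, bounded_mfun (f_ n)) -> (forall n x, 0 <= f_ n x) ->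
  (forall N, \sum_(0 <= n < N) \int[mu]_x f_ n x <= M) ->
  {ae mu, forall x, f_ n x @[n --> \oo] --> 0}.
Proof.
move=> mu1 bf f0 sM; pose g x := (\sum_(0 <= n <oo) (f_ n x)%:E)%E.
have mf n : measurable_fun setT (EFin \o f_ n) by have [mf _] := bf n; exact: measurableT_comp.
have g0 x : (0 <= g x)%E by apply: nneseries_ge0 => n _ _; rewrite lee_fin.
have mg : measurable_fun setT g.
  apply: (@ge0_emeasurable_sum _ _ _ _ (fun n x => (f_ n x)%:E) xpredT) => [n x _ _|n _].
    by rewrite lee_fin.
  exact: mf.
have ig : mu.-integrable setT g.
  apply/integrableP; split => //.
  rewrite (_ : (\int[mu]_x `|g x|)%E = (\sum_(0 <= n <oo) \int[mu]_x (f_ n x)%:E)%E);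
    last first.
    rewrite -integral_nneseries//; last by move=> n x _; rewrite lee_fin.
    by apply: eq_integral => x _; rewrite gee0_abs.
  apply: (@le_lt_trans _ _ M%:E); last exact: ltry.
  apply: lime_le; first by apply: is_cvg_nneseries => n _ _; apply: integral_ge0 => x _;
    rewrite lee_fin.
  apply: nearW => N; rewrite (eq_bigr (fun n => (\int[mu]_x f_ n x)%:E)); last first.
    by move=> n _; rewrite EFin_Rintegral_bounded.
  by rewrite sumEFin lee_fin.
have := integrable_ae measurableT ig; apply: filterS => x /(_ I) gx.
apply: cvg_series_cvg_0; apply: nondecreasing_is_cvgn.
  by apply/nondecreasing_seqP => n; rewrite /series/= big_nat_recr//= lerDl.
exists (fine (g x)) => _ [n _ <-]; rewrite -lee_fin fineK// /series/= -sumEFin.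
by apply: nneseries_lim_ge => k _ _; rewrite lee_fin.
Qed.

Lemma bounded_mfun_continuous_comp d (T : measurableType d) (R : realType)
    (f : R -> R) (g : T -> R) (M : R) : continuous f -> (forall r, `|f r| <= M) ->
  measurable_fun setT g -> bounded_mfun (fun w => f (g w)).
Proof.
move=> cf fM mg; split; last by exists M.
by apply: measurableT_comp mg; exact: continuous_measurable_fun.
Qed.

Section mixtures.
Context d d' (T : measurableType d) (S : measurableType d') (R : realType).
Context (P : {measure set T -> \bar R}) (A : set T) (mA : measurable A).

Let evaluable (k : T -> {measure set S -> \bar R}) :=
  forall B, measurable B -> measurable_fun setT (fun w => k w B).

Import HBNNSimple.

Let mixture_nnsfun k (g : {nnsfun S >-> R}) : evaluable k ->
  (\int[P]_(w in A) \int[k w]_s (g s)%:E =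
   \sum_(r \in range g) (r%:E * \int[P]_(w in A) k w (g @^-1` [set r])))%E.
Proof.
move=> mk; have mkr r : measurable_fun A (fun w => k w (g @^-1` [set r])).
  by apply: measurable_funTS; exact: mk.
under eq_integral do rewrite integralT_nnsfun sintegralE.
rewrite ge0_integral_fsum//; last 2 first.
- by move=> r; exact: measurable_funeM.
- move=> r w _; apply: (mulemu_ge0 (fun r => g @^-1` [set r])).
  exact: preimage_nnfun0.
apply: eq_fsbigr => r; rewrite inE => -[s _ <-].
by rewrite ge0_integralZl// lee_fin.
Qed.

(** Meant for a conditional distribution against the Dirac kernel at X: the definition of the former
    is equality of the two mixtures on sets, and simple functions with monotone limits extend it to
    integrands. *)
Lemma eq_integral_mixture (k1 k2 : T -> {measure set S -> \bar R}) (f : S -> \bar R) :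
  evaluable k1 -> evaluable k2 ->
  (forall B, measurable B -> \int[P]_(w in A) k1 w B = \int[P]_(w in A) k2 w B)%E ->
  measurable_fun setT f -> (forall s, 0 <= f s)%E ->
  (\int[P]_(w in A) \int[k1 w]_s f s = \int[P]_(w in A) \int[k2 w]_s f s)%E.
Proof.
move=> mk1 mk2 E mf f0; pose g := nnsfun_approx measurableT mf.
have gle (a b : nat) s : (a <= b)%N -> ((g a s)%:E <= (g b s)%:E)%E.
  by move=> ab; rewrite lee_fin; exact/lefP/nd_nnsfun_approx.
have mg n : measurable_fun setT (fun s => (g n s)%:E) by exact/measurable_EFinP.
have cvg1 (m : {measure set S -> \bar R}) :
    (\int[m]_s (g n s)%:E @[n --> \oo] --> \int[m]_s f s)%E.
  rewrite (_ : (\int[m]_s f s)%E = (\int[m]_s limn (fun n => (g n s)%:E))%E).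
    apply: cvg_monotone_convergence => //.
    - by move=> n s _; rewrite lee_fin.
    - by move=> s _ a b; exact: gle.
  by apply: eq_integral => s _; apply/esym/cvg_lim => //; exact: cvg_nnsfun_approx.
have cvg2 k : evaluable k -> (\int[P]_(w in A) \int[k w]_s (g n s)%:E @[n --> \oo] -->
    \int[P]_(w in A) \int[k w]_s f s)%E.
  move=> mk.
  rewrite (_ : (\int[P]_(w in A) \int[k w]_s f s)%E =
      (\int[P]_(w in A) limn (fun n => \int[k w]_s (g n s)%:E))%E).
    apply: cvg_monotone_convergence => //.
    - move=> n; apply: measurable_funTS; apply: measurable_fun_integral_kernel => //.
      by move=> s; rewrite lee_fin.
    - by move=> n w _; apply: integral_ge0 => s _; rewrite lee_fin.
    - move=> w _ a b ab; apply: ge0_le_integral => //.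
      + by move=> s _; rewrite lee_fin.
      + by move=> s _; exact: gle.
  by apply: eq_integral => w _; apply/esym/cvg_lim => //; exact: cvg1.
have -> : (\int[P]_(w in A) \int[k1 w]_s f s =
  limn (fun n => \int[P]_(w in A) \int[k1 w]_s (g n s)%:E))%E.
  by apply/esym/cvg_lim => //; exact: cvg2.
rewrite -(cvg_lim _ (cvg2 k2 mk2))//; congr (limn _); apply/funext => n.
by rewrite !mixture_nnsfun//; apply: eq_fsbigr => r _; rewrite E.
Qed.

End mixtures.

Section conditional_distribution.
Context d d' (T : measurableType d) (S : measurableType d') (R : realType).
Context (P : probability T R) (G : set_system T) (X : T -> S).
Context (K : R.-pker g_sigma_algebraType G ~> S).
Hypotheses (GT : G `<=` measurable) (mX : measurable_fun setT X).
Hypothesis cK : cond_distribution P K X.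

Let mKG B : measurable B -> measurable_fun [set: g_sigma_algebraType G] (K ^~ B).
Proof. by move=> mB; exact: measurable_kernel. Qed.

Lemma integral_cond_distribution (A : set T) (f : S -> \bar R) : <<s G >> A ->
  measurable_fun setT f -> (forall s, 0 <= f s)%E ->
  (\int[P]_(w in A) \int[K w]_s f s = \int[P]_(w in A) f (X w))%E.
Proof.
move=> GA mf f0.
have mA : measurable A.
  by apply: (smallest_sub _ GT) GA; exact: sigma_algebra_measurable.
transitivity (\int[P]_(w in A) \int[\d_(X w)]_s f s)%E; last first.
  by apply: eq_integral => w _; rewrite integral_dirac// diracT mul1e.
have dE B w : \d_(X w) B = (\1_B (X w))%:E :> \bar R by rewrite diracE indicE.
apply: (@eq_integral_mixture _ _ T S R P A mA (fun w => K w) (fun w => \d_(X w))) => //.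
- move=> B mB; exact: (measurableT_comp (mKG mB) (measurable_id_sigma_algebra GT)).
- move=> B mB; rewrite (_ : (fun w => _) = EFin \o (\1_B \o X)); last first.
    by apply/funext => w; exact: dE.
  by apply/measurable_EFinP; exact: measurableT_comp.
- move=> B mB; transitivity (P (A `&` X @^-1` B)); first exact: cK.
  transitivity (\int[P]_(w in A) (\1_(X @^-1` B) w)%:E)%E; last first.
    by apply: eq_integral => w _; exact/esym/dE.
  have mXB : measurable (X @^-1` B) by rewrite -[_ @^-1` _]setTI; exact: mX.
  by rewrite setIC -integral_indic.
Qed.

Lemma Rintegral_cond_distribution (A : set T) (f : S -> R) : <<s G >> A ->
  bounded_mfun f ->
  bounded_mfun ((fun w => \int[K w]_s f s) : g_sigma_algebraType G -> R) /\
  \int[P]_w (\1_A w * \int[K w]_s f s) = \int[P]_w (\1_A w * f (X w)).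
Proof.
move=> GA; have mA : measurable A.
  by apply: (smallest_sub _ GT) GA; exact: sigma_algebra_measurable.
have K1 w : K w setT = 1%E by exact: prob_kernel.
have P1 : P setT = 1%E by exact: probability_setT.
have b1 := bounded_mfun_indic R mA.
have main (g : S -> R) : bounded_mfun g -> (forall s, 0 <= g s) ->
    bounded_mfun ((fun w => \int[K w]_s g s) : g_sigma_algebraType G -> R) /\
    \int[P]_w (\1_A w * \int[K w]_s g s) = \int[P]_w (\1_A w * g (X w)).
  move=> bg g0; have [mg [M gM]] := bg.
  have bK : bounded_mfun ((fun w => \int[K w]_s g s) : g_sigma_algebraType G -> R).
    split.
      apply: measurableT_comp => //.
      apply: measurable_fun_integral_kernel; first exact: mKG.
        by move=> s; rewrite lee_fin.
      exact/measurable_EFinP.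
    exists M => w; rewrite -[leRHS](Rintegral_cst1 (K1 w)).
    by apply: (le_normr_Rintegral_bounded (K1 w)) => //; exact: bounded_mfun_cst.
  split => //; apply: EFin_inj.
  have bgX : bounded_mfun (fun w => g (X w)).
    by split; [exact: measurableT_comp|exists M => w].
  have E h : bounded_mfun (h : T -> R) ->
      ((\int[P]_w (\1_A w * h w))%:E = \int[P]_(w in A) (h w)%:E)%E.
    move=> bh; rewrite (EFin_Rintegral_bounded P1 (bounded_mfunM b1 bh)).
    rewrite [RHS]integral_mkcond; apply: eq_integral => w _.
    by rewrite patchE indicE; case: (w \in A); rewrite ?mul1r ?mul0r.
  rewrite !E//; last exact: (bounded_mfun_sub GT bK).
  transitivity (\int[P]_(w in A) \int[K w]_s (g s)%:E)%E.
    by apply: eq_integral => w _; exact: (EFin_Rintegral_bounded (K1 w)).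
  apply: (@integral_cond_distribution A (EFin \o g)) => //.
  exact/measurable_EFinP.
move=> bf; have [mf [M fM]] := bf.
have bM : bounded_mfun ((fun=> M) : S -> R) by exact: bounded_mfun_cst.
(* Adding the bound [M] makes the integrand nonnegative; it is removed again because every [K w] has
   mass 1. *)
have [bK E] := main _ (bounded_mfunD bf bM)
  (fun s => ltac:(have := fM s; rewrite ler_norml => /andP[]; lra)).
have KE w : \int[K w]_s f s = \int[K w]_s (f s + M) - M.
  by rewrite (RintegralD_bounded (K1 w) bf bM) (Rintegral_cst1 (K1 w)) addrK.
have bKf : bounded_mfun ((fun w => \int[K w]_s f s) : g_sigma_algebraType G -> R).
  under eq_fun do rewrite KE.
  by apply: bounded_mfunB => //; exact: bounded_mfun_cst.
split => //.
have bfX : bounded_mfun (fun w => f (X w)).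
  by split; [exact: measurableT_comp|exists M => w].
have bMT : bounded_mfun ((fun=> M) : T -> R) by exact: bounded_mfun_cst.
have b2 := bounded_mfunM b1 (bounded_mfun_sub GT bKf).
have b3 := bounded_mfunM b1 bfX; have b4 := bounded_mfunM b1 bMT.
apply: (@addIr _ (\int[P]_w (\1_A w * M))).
rewrite -(RintegralD_bounded P1 b2 b4) -(RintegralD_bounded P1 b3 b4).
transitivity (\int[P]_w (\1_A w * \int[K w]_s (f s + M))).
  by apply: eq_Rintegral => w _; rewrite KE -mulrDr subrK.
by rewrite E; apply: eq_Rintegral => w _; rewrite mulrDr.
Qed.

End conditional_distribution.

(** The test set {g < f} belongs to the sub-sigma-algebra. On it the nonnegative f - g has integral
    at most 0, hence vanishes almost everywhere. *)
Lemma ae_le_sub_sigma_algebra d (T : measurableType d) (R : realType)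
    (P : {measure set T -> \bar R}) (G : set_system T) (f g : T -> R) :
  P setT = 1%E -> G `<=` measurable ->
  bounded_mfun (f : g_sigma_algebraType G -> R) ->
  bounded_mfun (g : g_sigma_algebraType G -> R) ->
  (forall A, <<s G >> A -> \int[P]_w (\1_A w * f w) <= \int[P]_w (\1_A w * g w)) ->
  {ae P, forall w, f w <= g w}.
Proof.
move=> P1 Gm bf bg fg; pose A := [set w | g w < f w].
have GA : <<s G >> A.
  have := measurable_fun_ltr bg.1 bf.1 => /(_ measurableT [set true] I).
  by rewrite setTI; congr (_ _); apply/seteqP; split.
have mA : measurable A by apply: (smallest_sub _ Gm) GA; exact: sigma_algebra_measurable.
have bA := bounded_mfun_indic R mA.
have bfT := bounded_mfun_sub Gm bf; have bgT := bounded_mfun_sub Gm bg.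
have bh := bounded_mfunM bA (bounded_mfunB bfT bgT).
have h0 w : 0 <= \1_A w * (f w - g w).
  by rewrite indicE; have [|] := boolP (w \in A);
    rewrite ?mul0r// inE /A/= mul1r => /ltW; rewrite subr_ge0.
have : (\int[P]_w `|(\1_A w * (f w - g w))%:E| = 0)%E.
  under eq_integral do rewrite gee0_abs ?lee_fin//.
  rewrite -(EFin_Rintegral_bounded P1 bh); congr (_%:E); apply/eqP.
  rewrite eq_le; apply/andP; split; last exact: Rintegral_ge0.
  have -> : \int[P]_w (\1_A w * (f w - g w)) =
    \int[P]_w (\1_A w * f w) - \int[P]_w (\1_A w * g w).
    rewrite -(RintegralB_bounded P1 (bounded_mfunM bA bfT) (bounded_mfunM bA bgT)).
    by apply: eq_Rintegral => w _; rewrite mulrBr.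
  by rewrite subr_le0 fg.
move/(ae_eq_integral_abs P measurableT) => /(_ _).
have mh : measurable_fun setT (fun w => (\1_A w *
  (f w - g w))%:E) by apply/measurable_EFinP; exact: bh.1.
move=> /(_ mh); apply: filterS => w /(_ I) [].
rewrite indicE; have [|] := boolP (w \in A); rewrite ?notin_setE ?inE /A/=.
  by move=> gf; rewrite mul1r => /eqP; rewrite subr_eq0 => /eqP ->.
by move=> /negP; rewrite -leNgt.
Qed.

Lemma ae_forall_countable d (T : measurableType d) (R : realType)
    (P : {measure set T -> \bar R}) (I : countType) (Q : I -> T -> Prop) :
  (forall i, {ae P, forall w, Q i w}) -> {ae P, forall w, forall i, Q i w}.
Proof.
move=> h; pose Q' (n : nat) w := if choice.unpickle n is Some i then Q i w else True.
have /ae_foralln : forall n, {ae P, forall w, Q' n w}.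
  move=> n; rewrite /Q'; case: choice.unpickle => [i|]; first exact: h.
  exact: aeW.
by apply: filterS => w Qw i; have := Qw (choice.pickle i); rewrite /Q' choice.pickleK.
Qed.

Lemma Rintegral_cos_gaussian (R : realType) (v t phi : R) : 0 <= v ->
  \int[gaussian 0 v]_r cos (t * r + phi) = cos phi * expR (- (v * t ^+ 2) / 2).
Proof.
move=> v0; rewrite /gaussian; case: ifPn => [/eqP ->|vn0].
  rewrite /Rintegral integral_dirac//=.
    by rewrite indicE in_setT mul1r mulr0 add0r mul0r oppr0 mul0r expR0 mulr1.
  apply/measurable_EFinP; apply: (measurableT_comp (f := @cos R)).
    by apply: continuous_measurable_fun; exact: continuous_cos.
  by apply: measurable_funD => //; exact: measurable_funM.
by rewrite Rintegral_cos_normal_prob ?sqrtr_gt0 ?lt_neqAle ?v0 ?(eq_sym 0) ?vn0// sqr_sqrtr.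
Qed.

(** * The urn process *)

Lemma measurable_fun_invr d (T : measurableType d) (R : realType) (f : T -> R) :
  measurable_fun setT f -> (forall x, 0 <= f x) ->
  measurable_fun setT (fun x => (f x)^-1).
Proof.
move=> mf f0; under eq_fun do rewrite -powR_inv1//.
apply: (@measurableT_comp _ _ _ _ _ _ (fun z : R => z `^ (-1))%R) mf.
exact: measurable_powR.
Qed.

Section urn_process.
Context d (T : measurableType d) (R : realType) (P : probability T R).
Local Notation RR := (measurableTypeR R).
Variables (U : {RV P >-> R}^nat) (VW : {RV P >-> (R * R)%type}^nat).
Variables (beta : R) (mu nu : probability RR R) (m x y : R).
Hypotheses (iidU : iid U) (uU : forall n, uniform01 P (U n)) (iidVW : iid VW).
Hypothesis uV : forall n, uniform01 P (fun w => (VW n w).1).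
Hypothesis uW : forall n, uniform01 P (fun w => (VW n w).2).
Hypothesis indUV : indep_systems P (sigma_seq U) (sigma_seq VW).
Hypotheses (beta0 : 0 < beta) (mu1 : mu `[0, beta]%classic = 1%E)
  (nu1 : nu `[0, beta]%classic = 1%E).
Hypotheses (x0 : 0 <= x) (y0 : 0 <= y) (xy0 : 0 < x + y) (m0 : 0 < m).
Hypotheses (Emu : \int[mu]_r r = m) (Enu : \int[nu]_r r = m).

Local Notation A_ := (urn_filtration U VW).
Local Notation S_ n := (g_sigma_algebraType (A_ n)).
Local Notation C n := (urn U VW mu nu x y n).
Local Notation Z := (urn_prop U VW mu nu x y).
Let D n w := (C n w).1 + (C n w).2.
Let Ra k w := quantile mu (VW k w).1.
Let Rb k w := quantile nu (VW k w).2.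
Let bit k w := U k w <= Z k w.

Let P1 : P setT = 1%E. Proof. exact: probability_setT. Qed.

Let Ra_itv k w : 0 <= Ra k w <= beta. Proof. exact: quantile_itv. Qed.

Let Rb_itv k w : 0 <= Rb k w <= beta. Proof. exact: quantile_itv. Qed.

Let Am n : A_ n `<=` measurable.
Proof. exact: urn_filtration_sub. Qed.

Let urnS n w : C n.+1 w =
  ((C n w).1 + (if bit n w then Ra n w else 0), (C n w).2 + (if bit n w then 0 else Rb n w)).
Proof.
rewrite /= -/(urn_prop _ _ _ _ _ _ _ _) -/(Ra n w) -/(Rb n w) -/(bit n w).
by case: bit; rewrite ?mulr1 ?mulr0 ?subrr ?mulr0 ?subr0 ?mulr1.
Qed.

Lemma urn_ge0 n w : 0 <= (C n w).1 /\ 0 <= (C n w).2.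
Proof.
elim: n => [|n [IH1 IH2]]; first by split.
rewrite urnS; have /andP[a0 _] := Ra_itv n w; have /andP[b0 _] := Rb_itv n w.
by split; case: bit; rewrite addr_ge0.
Qed.

Let DS n w : D n.+1 w = D n w + (if bit n w then Ra n w else Rb n w).
Proof. by rewrite /D urnS; case: bit => /=; ring. Qed.

Lemma urn_total_ge n w : x + y <= D n w.
Proof.
elim: n => [|n IH] //; rewrite DS (le_trans IH)// lerDl.
by case: bit; [case/andP: (Ra_itv n w)|case/andP: (Rb_itv n w)].
Qed.

Let D0 n w : 0 < D n w. Proof. exact: lt_le_trans xy0 (urn_total_ge n w). Qed.

Lemma urn_total_mono n k w : (n <= k)%N -> D n w <= D k w.
Proof.
move=> /subnKC <-; elim: (k - n)%N => [|j IH]; first by rewrite addn0.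
rewrite addnS DS (le_trans IH)// lerDl.
by case: bit; [case/andP: (Ra_itv (n + j) w)|case/andP: (Rb_itv (n + j) w)].
Qed.

Lemma urn_total_le n w : D n w <= x + y + n%:R * beta.
Proof.
elim: n => [|n IH]; first by rewrite /D/= mul0r addr0.
rewrite DS -natr1; have /andP[_ a0] := Ra_itv n w; have /andP[_ b0] := Rb_itv n w.
by case: bit; lra.
Qed.

Lemma urn_prop_itv n w : 0 <= Z n w <= 1.
Proof.
have [h1 h2] := urn_ge0 n w; have d0 := D0 n w; rewrite /urn_prop /first_fraction.
apply/andP; split; first by rewrite divr_ge0// addr_ge0.
by rewrite ler_pdivrMr// mul1r lerDl.
Qed.

(* The [k]-th step of the urn as a draw, relative to the proportion at time [n]. *)
Let dr k n l w := Draw (Z k w) (D k w) (bit k w) (Ra k w) (Rb k w) (Z n w) l.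

Let valid_dr k n l w : 1 <= l -> valid_draw beta (x + y) (dr k n l w).
Proof.
move=> l1; split => //=; try exact: urn_prop_itv.
exact: urn_total_ge.
by split => //; exact: urn_prop_itv.
Qed.

Let newD_dr k n l w : newD (dr k n l w) = D k.+1 w.
Proof. by rewrite DS. Qed.

Let newZ_dr k n l w : newZ (dr k n l w) = Z k.+1 w.
Proof.
have Zk : (C k w).1 = Z k w * D k w.
  by rewrite /urn_prop /first_fraction -/(D k w) divfK// gt_eqF.
have -> : Z k.+1 w = (Z k w * D k w + (if bit k w then Ra k w else 0)) / D k.+1 w.
  by rewrite -Zk {1}/urn_prop /first_fraction -/(D k.+1 w) urnS.
have := D0 k.+1 w; rewrite /newZ newD_dr DS /incr; cbn -[D Z bit Ra Rb].
by case: bit => d'; field; rewrite gt_eqF.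
Qed.

Let mC k n : (k <= n)%N ->
  measurable_fun (setT : set (S_ n)) (fun w => (C k w).1) /\
  measurable_fun (setT : set (S_ n)) (fun w => (C k w).2).
Proof.
elim: k => [|k IH] kn; first by split; exact: measurable_cst.
have [h1 h2] := IH (ltnW kn).
have mU : measurable_fun (setT : set (S_ n)) (U k) by exact: measurable_urn_filtrationU.
have mVW : measurable_fun (setT : set (S_ n)) (VW k) by exact: measurable_urn_filtrationVW.
have ma : measurable_fun (setT : set (S_ n)) (Ra k).
  apply: (measurableT_comp (measurable_quantile beta0 mu1)).
  exact: (measurableT_comp measurable_fst mVW).
have mb : measurable_fun (setT : set (S_ n)) (Rb k).
  apply: (measurableT_comp (measurable_quantile beta0 nu1)).
  exact: (measurableT_comp measurable_snd mVW).
have mZ : measurable_fun (setT : set (S_ n)) (Z k).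
  rewrite /urn_prop /first_fraction; apply: measurable_funM => //.
  apply: measurable_fun_invr; first exact: measurable_funD.
  by move=> w; exact: ltW (D0 k w).
have mbit : measurable_fun (setT : set (S_ n)) (bit k) by exact: measurable_fun_ler.
have mcst : measurable_fun (setT : set (S_ n)) (fun=> 0 : R) by exact: measurable_cst.
split.
  rewrite (_ : (fun w => _) = fun w => (C k w).1 + (if bit k w then Ra k w else 0));
    last by apply/funext => w; rewrite urnS.
  by apply: measurable_funD => //; exact: measurable_fun_ifT.
rewrite (_ : (fun w => _) = fun w => (C k w).2 + (if bit k w then 0 else Rb k w));
  last by apply/funext => w; rewrite urnS.
by apply: measurable_funD => //; exact: measurable_fun_ifT.
Qed.

Let mD k n : (k <= n)%N -> measurable_fun (setT : set (S_ n)) (D k).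
Proof. by move=> /mC[h1 h2]; exact: measurable_funD. Qed.

Let bD k n : (k <= n)%N -> bounded_mfun (D k : S_ n -> R).
Proof.
move=> kn; split; first exact: mD.
by exists (x + y + k%:R * beta) => w; rewrite gtr0_norm// urn_total_le.
Qed.

Let bDV k n : (k <= n)%N -> bounded_mfun ((fun w => (D k w)^-1) : S_ n -> R).
Proof.
move=> kn; split; first by apply: measurable_fun_invr; [exact: mD|move=> w; exact: ltW].
by exists (x + y)^-1 => w; rewrite gtr0_norm ?invr_gt0// lef_pV2 ?posrE// urn_total_ge.
Qed.

Let bZ k n : (k <= n)%N -> bounded_mfun (Z k : S_ n -> R).
Proof.
move=> kn; have [h1 h2] := mC kn; split.
  rewrite /urn_prop /first_fraction; apply: measurable_funM => //.
  apply: measurable_fun_invr; first exact: measurable_funD.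
  by move=> w; exact: ltW (D0 k w).
by exists 1 => w; have /andP[z0 z1] := urn_prop_itv k w; rewrite ger0_norm.
Qed.

Let bounded_T n (f : T -> R) : bounded_mfun (f : S_ n -> R) -> bounded_mfun f.
Proof. by move=> bf; apply: bounded_mfun_sub bf; exact: Am. Qed.

Let bif k n (f g : T -> R) : (k < n)%N -> bounded_mfun (f : S_ n -> R) ->
  bounded_mfun (g : S_ n -> R) ->
  bounded_mfun ((fun w => if bit k w then f w else g w) : S_ n -> R).
Proof.
move=> kn [mf [M fM]] [mg [N gN]]; split.
  have mU : measurable_fun (setT : set (S_ n)) (U k) by exact: measurable_urn_filtrationU.
  have [mZ _] := bZ (ltnW kn).
  by apply: measurable_fun_ifT => //; exact: measurable_fun_ler.
exists (M + N) => w; have := fM w; have := gN w.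
have := normr_ge0 (f w); have := normr_ge0 (g w); case: bit; lra.
Qed.

(** Boundedness is asked on [0, beta] only, where quantiles take their values, so that the identity
    and the square qualify. *)
Let admissible (g : R -> R) := measurable_fun [set: RR] g /\
  exists M : R, forall r, 0 <= r <= beta -> `|g r| <= M.

Let bg1 g : admissible g -> bounded_mfun (fun v : R * R => g (quantile mu v.1)).
Proof.
move=> [mg [M gM]]; split; last by exists M => v; exact/gM/quantile_itv.
apply: (measurableT_comp mg); apply: (measurableT_comp (measurable_quantile beta0 mu1)).
exact: measurable_fst.
Qed.

Let bg2 g : admissible g -> bounded_mfun (fun v : R * R => g (quantile nu v.2)).
Proof.
move=> [mg [M gM]]; split; last by exists M => v; exact/gM/quantile_itv.
apply: (measurableT_comp mg); apply: (measurableT_comp (measurable_quantile beta0 nu1)).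
exact: measurable_snd.
Qed.

Let bRa g k n : admissible g -> (k < n)%N -> bounded_mfun ((fun w => g (Ra k w)) : S_ n -> R).
Proof.
move=> ag kn; have [mg [M gM]] := bg1 ag; split; last by exists M => w; exact: gM.
by apply: (measurableT_comp mg); exact: measurable_urn_filtrationVW.
Qed.

Let bRb g k n : admissible g -> (k < n)%N -> bounded_mfun ((fun w => g (Rb k w)) : S_ n -> R).
Proof.
move=> ag kn; have [mg [M gM]] := bg2 ag; split; last by exists M => w; exact: gM.
by apply: (measurableT_comp mg); exact: measurable_urn_filtrationVW.
Qed.

Let Rintegral_Ra g k : admissible g -> \int[P]_w g (Ra k w) = \int[mu]_r g r.
Proof.
move=> [mg gM]; apply: (Rintegral_quantile beta0 mu1 _ (uV k) mg gM).
exact: measurableT_comp.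
Qed.

Let Rintegral_Rb g k : admissible g -> \int[P]_w g (Rb k w) = \int[nu]_r g r.
Proof.
move=> [mg gM]; apply: (Rintegral_quantile beta0 nu1 _ (uW k) mg gM).
exact: measurableT_comp.
Qed.

Let E_ifl k (xi : T -> R) g : bounded_mfun (xi : S_ k -> R) -> admissible g ->
  \int[P]_w (xi w * (if bit k w then g (Ra k w) else 0)) =
  \int[P]_w (xi w * Z k w) * \int[mu]_r g r.
Proof.
move=> bxi ag; rewrite -(Rintegral_Ra k ag); have [mZ _] := bZ (leqnn k).
rewrite -(Rintegral_draw iidU uU iidVW indUV bxi mZ (urn_prop_itv k) (bg1 ag)).
apply: eq_Rintegral => w _; rewrite -/(bit k w) -/(Ra k w).
by case: bit; rewrite ?mulr1 ?mulr0 ?mul0r.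
Qed.

Let E_ifr k (xi : T -> R) g : bounded_mfun (xi : S_ k -> R) -> admissible g ->
  \int[P]_w (xi w * (if bit k w then 0 else g (Rb k w))) =
  \int[P]_w (xi w * (1 - Z k w)) * \int[nu]_r g r.
Proof.
move=> bxi ag; rewrite -(Rintegral_Rb k ag); have [mZ _] := bZ (leqnn k).
have bxiZ := bounded_mfunM bxi (bZ (leqnn k)).
have -> : \int[P]_w (xi w * (1 - Z k w)) = \int[P]_w xi w - \int[P]_w (xi w * Z k w).
  rewrite -(RintegralB_bounded P1 (bounded_T bxi) (bounded_T bxiZ)).
  by apply: eq_Rintegral => w _; rewrite mulrBr mulr1.
rewrite mulrBl -(Rintegral_draw iidU uU iidVW indUV bxi mZ (urn_prop_itv k) (bg2 ag)).
rewrite -(Rintegral_reinforcement iidVW indUV bxi (bg2 ag)).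
have bR := bRb ag (ltnSn k).
have bxi' := urn_filtration_mono (leqnSn k) bxi.
have b1 := bounded_T (bounded_mfunM bxi' bR).
have b2 : bounded_mfun (fun w => xi w * (U k w <= Z k w)%R%:R * g (quantile nu (VW k w).2)).
  apply: bounded_T; apply: (bounded_mfunM _ bR); apply: (bounded_mfunM bxi').
  have := bif (ltnSn k) (bounded_mfun_cst _ 1) (bounded_mfun_cst _ 0).
  by congr bounded_mfun; apply/funext => w; rewrite /bit; case: (_ <= _).
rewrite -(RintegralB_bounded P1 b1 b2).
apply: eq_Rintegral => w _; rewrite -/(bit k w) -/(Rb k w).
by case: bit; rewrite ?mulr1 ?mulr0 ?mul0r ?subrr ?subr0.
Qed.

Let adm_id : admissible id.
Proof. by split => //; exists beta => r /andP[r0 r1]; rewrite ger0_norm. Qed.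

Let adm_sqr : admissible (fun r => r ^+ 2).
Proof.
split; first exact: measurable_funX.
by exists (beta ^+ 2) => r /andP[r0 r1]; rewrite ger0_norm ?sqr_ge0// lerXn2r// nnegrE ltW.
Qed.

Let p := \int[mu]_(k in `[0, beta]) k ^+ 2.
Let q := \int[nu]_(k in `[0, beta]) k ^+ 2.

(** Both integrals are the mean of the squared quantile transform, whose values never leave
    [0, beta]. *)
Let second_moment (rho : probability RR R) (V : T -> R) : rho `[0, beta]%classic = 1%E ->
  measurable_fun setT V -> uniform01 P V ->
  \int[rho]_r r ^+ 2 = \int[rho]_(k in `[0, beta]) k ^+ 2.
Proof.
move=> rho1 mV uV'; have [ms bs] := adm_sqr.
rewrite [RHS]Rintegral_mkcond -(Rintegral_quantile beta0 rho1 mV uV' ms bs).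
rewrite -(Rintegral_quantile beta0 rho1 mV uV').
- apply: eq_Rintegral => w _; rewrite patchE ifT// inE /= in_itv/=.
  exact: quantile_itv.
- by apply/measurable_restrict => //; exact: measurable_funTS.
- have [M HM] := bs; exists M => r r01; rewrite patchE ifT ?HM//.
  by rewrite inE /= in_itv.
Qed.

Let Ep : \int[mu]_r r ^+ 2 = p.
Proof. by apply: (second_moment mu1 _ (uV 0)); exact: measurableT_comp. Qed.

Let Eq : \int[nu]_r r ^+ 2 = q.
Proof. by apply: (second_moment nu1 _ (uW 0)); exact: measurableT_comp. Qed.

Let p0 : 0 <= p. Proof. by apply: Rintegral_ge0 => r _; exact: sqr_ge0. Qed.
Let q0 : 0 <= q. Proof. by apply: Rintegral_ge0 => r _; exact: sqr_ge0. Qed.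

(** The reference time [k] and the scale 1 are dummies: [incr] and [reinf] read neither of these
    fields. *)
Let inc k w := incr (dr k k 1 w).
Let rei k w := reinf (dr k k 1 w).

Let b_ifl k (g : R -> R) : admissible g ->
  bounded_mfun ((fun w => if bit k w then g (Ra k w) else 0) : S_ k.+1 -> R).
Proof. by move=> ag; apply: bif => //; [exact: bRa|exact: bounded_mfun_cst]. Qed.

Let b_ifr k (g : R -> R) : admissible g ->
  bounded_mfun ((fun w => if bit k w then 0 else g (Rb k w)) : S_ k.+1 -> R).
Proof. by move=> ag; apply: bif => //; [exact: bounded_mfun_cst|exact: bRb]. Qed.

(** The conditional mean over one draw, tested against a weight from the past: the first colour has
    probability Z_k, and the reinforcement is independent of the choice. [inc], its square and [rei]
    all have this shape. *)
Let E_lr k (xi xa xb : T -> R) ga gb : bounded_mfun (xi : S_ k -> R) ->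
  bounded_mfun (xa : S_ k -> R) -> bounded_mfun (xb : S_ k -> R) ->
  admissible ga -> admissible gb ->
  bounded_mfun ((fun w => xi w * (if bit k w then xa w * ga (Ra k w) else xb w * gb
    (Rb k w))) : S_ k.+1 -> R) /\
  \int[P]_w (xi w * (if bit k w then xa w * ga (Ra k w) else xb w * gb (Rb k w))) =
  \int[P]_w (xi w * (xa w * Z k w * \int[mu]_r ga r + xb w * (1 - Z k w) * \int[nu]_r gb r)).
Proof.
move=> bxi bxa bxb aga agb.
have E : (fun w => xi w * (if bit k w then xa w * ga (Ra k w) else xb w * gb (Rb k w))) =
    (fun w => (xi w * xa w) * (if bit k w then ga (Ra k w) else 0) +
     (xi w * xb w) * (if bit k w then 0 else gb (Rb k w))).
  by apply/funext => w; case: bit; ring.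
have ba := bounded_mfunM bxi bxa; have bb := bounded_mfunM bxi bxb.
have ba' := bounded_mfunM (urn_filtration_mono (leqnSn k) ba) (b_ifl k aga).
have bb' := bounded_mfunM (urn_filtration_mono (leqnSn k) bb) (b_ifr k agb).
have bZk := bZ (leqnn k).
have bZ1 : bounded_mfun ((fun w => 1 - Z k w) : S_ k -> R).
  by apply: bounded_mfunB => //; exact: bounded_mfun_cst.
split; first by rewrite E; exact: bounded_mfunD.
rewrite E (RintegralD_bounded P1 (bounded_T ba') (bounded_T bb')) (E_ifl ba aga)
  (E_ifr bb agb).
have c1 := bounded_T (bounded_mfunM ba bZk); have c2 := bounded_T (bounded_mfunM bb bZ1).
rewrite (mulrC _ (\int[mu]_r ga r)) (mulrC _ (\int[nu]_r gb r)).
rewrite -(RintegralZl_bounded P1 _ c1) -(RintegralZl_bounded P1 _ c2).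
rewrite -(RintegralD_bounded P1); last 2 first.
- exact: (bounded_mfunM (bounded_mfun_cst _ _) c1).
- exact: (bounded_mfunM (bounded_mfun_cst _ _) c2).
by apply: eq_Rintegral => w _; ring.
Qed.

Let incE k w : inc k w = if bit k w then (1 - Z k w) * Ra k w else - (Z k w * Rb k w).
Proof. by []. Qed.

Let reiE k w : rei k w = if bit k w then Ra k w else Rb k w.
Proof. by []. Qed.

(** The mean is proportional to Z (1 - Z) times the difference of the two means, which are both
    [m]. *)
Let bxi_inc k (xi : T -> R) : bounded_mfun (xi : S_ k -> R) ->
  bounded_mfun ((fun w => xi w * inc k w) : S_ k.+1 -> R) /\ \int[P]_w (xi w * inc k w) = 0.
Proof.
move=> bxi; have bZk := bZ (leqnn k).
have bZ1 : bounded_mfun ((fun w => 1 - Z k w) : S_ k -> R).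
  by apply: bounded_mfunB => //; exact: bounded_mfun_cst.
have [] := E_lr bxi bZ1 (bounded_mfunN bZk) adm_id adm_id.
have -> : (fun w => xi w * (if bit k w then (1 - Z k w) * id (Ra k w) else - Z k w * id
  (Rb k w))) =
    (fun w => xi w * inc k w).
  by apply/funext => w; rewrite incE; case: bit; rewrite ?mulNr.
move=> h1 h2; split => //.
transitivity (\int[P]_w (0 : R)); last exact: Rintegral_cst1.
rewrite h2; apply: eq_Rintegral => w _; rewrite Emu Enu; ring.
Qed.

Let sqr_if (b : bool) (u v w : R) :
  (if b then (1 - u) ^+ 2 * v ^+ 2 else u ^+ 2 * w ^+ 2) =
  (if b then (1 - u) * v else - (u * w)) ^+ 2.
Proof. by case: b; ring. Qed.

Let bxi_inc2 k (xi : T -> R) : bounded_mfun (xi : S_ k -> R) ->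
  bounded_mfun ((fun w => xi w * inc k w ^+ 2) : S_ k.+1 -> R) /\
  \int[P]_w (xi w * inc k w ^+ 2) = \int[P]_w (xi w * varS p q (Z k w)).
Proof.
move=> bxi; have bZk := bZ (leqnn k).
have bZ1 : bounded_mfun ((fun w => 1 - Z k w) : S_ k -> R).
  by apply: bounded_mfunB => //; exact: bounded_mfun_cst.
have [] := E_lr bxi (bounded_mfunX 2 bZ1) (bounded_mfunX 2 bZk) adm_sqr adm_sqr.
have -> : (fun w => xi w * (if bit k w then (1 - Z k w) ^+ 2 *
  (Ra k w) ^+ 2 else Z k w ^+ 2 * (Rb k w) ^+ 2)) =
    (fun w => xi w * inc k w ^+ 2).
  by apply/funext => w; rewrite incE; congr (_ * _); exact: sqr_if.
move=> h1 ->; split => //.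
by apply: eq_Rintegral => w _; rewrite Ep Eq /varS; ring.
Qed.

Let bxi_rei k (xi : T -> R) : bounded_mfun (xi : S_ k -> R) ->
  bounded_mfun ((fun w => xi w * rei k w) : S_ k.+1 -> R) /\
  \int[P]_w (xi w * rei k w) = m * \int[P]_w xi w.
Proof.
move=> bxi; have b1 : bounded_mfun ((fun=> 1) : S_ k -> R) by exact: bounded_mfun_cst.
have [] := E_lr bxi b1 b1 adm_id adm_id.
have -> : (fun w => xi w * (if bit k w then 1 * id (Ra k w) else 1 * id (Rb k w))) =
    (fun w => xi w * rei k w).
  by apply/funext => w; rewrite reiE !mul1r.
move=> h1 ->; split => //; rewrite -(RintegralZl_bounded P1 _ (bounded_T bxi)).
by apply: eq_Rintegral => w _; rewrite Emu Enu; ring.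
Qed.

(** * The potential 1 / D_k and accumulated drift *)

Let W k w := (D k w)^-1.

Let W0 k w : 0 < W k w. Proof. by rewrite invr_gt0. Qed.

Let bW k n : (k <= n)%N -> bounded_mfun (W k : S_ n -> R).
Proof. exact: bDV. Qed.

Let mono k n f : (k <= n)%N -> bounded_mfun (f : S_ k -> R) -> bounded_mfun (f : S_ n -> R).
Proof. by move=> kn; exact: urn_filtration_mono. Qed.

(** The constant of [inverse_step] for the lower bound x + y of the total, times the mean
    reinforcement. *)
Let rate : R := (x + y) / (x + y + beta) * m.

Let rate0 : 0 < rate.
Proof. by rewrite mulr_gt0// divr_gt0// addr_gt0. Qed.

Let potential k (xi : T -> R) : bounded_mfun (xi : S_ k -> R) -> (forall w, 0 <= xi w) ->
  rate * \int[P]_w (xi w * W k w ^+ 2) <=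
  \int[P]_w (xi w * W k w) - \int[P]_w (xi w * W k.+1 w).
Proof.
move=> bxi xi0; have b2 := bounded_mfunM bxi (bounded_mfunX 2 (bW (leqnn k))).
have [bR ER] := bxi_rei b2; rewrite /rate -mulrA -ER.
rewrite -(RintegralZl_bounded P1 _ (bounded_T bR)).
have b3 := bounded_T (bounded_mfunM bxi (bW (leqnn k))).
have b4 := bounded_T (bounded_mfunM (mono (leqnSn k) bxi) (bW (leqnn k.+1))).
rewrite -(RintegralB_bounded P1 b3 b4); apply: (le_Rintegral_bounded P1).
- exact: (bounded_mfunM (bounded_mfun_cst _ _) (bounded_T bR)).
- exact: bounded_mfunB.
have aux (c X r u u' : R) : 0 <= X -> c * (r / u ^+ 2) <= u^-1 - u' ->
    c * (X * u^-1 ^+ 2 * r) <= X * u^-1 - X * u'.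
  by move=> X0; rewrite -subr_ge0 => /(mulr_ge0 X0); rewrite -exprVn; lra.
move=> w; apply: aux => //.
by have := inverse_step beta0 xy0 (valid_dr k k w (lexx 1)); rewrite newD_dr.
Qed.

(* A process whose conditional drift is of order [G / D_k ^ 2] moves by at most
   [G / D_n] in mean after time [n]. *)
Let drift n (Phi lin : nat -> T -> R) (xi G : T -> R) :
  bounded_mfun (xi : S_ n -> R) -> (forall w, 0 <= xi w) ->
  bounded_mfun (G : S_ n -> R) -> (forall w, 0 <= G w) ->
  (forall k, (n <= k)%N -> bounded_mfun (Phi k)) ->
  (forall k, (n <= k)%N -> bounded_mfun (fun w => xi w * lin k w) /\
     \int[P]_w (xi w * lin k w) = 0) ->
  (forall k w, (n <= k)%N ->
     `|Phi k.+1 w - Phi k w + lin k w| <= G w * W k w ^+ 2) ->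
  forall N, (n <= N)%N ->
  `|\int[P]_w (xi w * Phi N w) - \int[P]_w (xi w * Phi n w)| <=
  rate^-1 * \int[P]_w (xi w * G w * W n w).
Proof.
move=> bxi xi0 bG G0 bPhi blin H N /subnKC <-.
have bxT := bounded_T bxi.
have bxG := bounded_mfunM bxi bG.
have xG0 w : 0 <= xi w * G w by rewrite mulr_ge0.
have step k : (n <= k)%N ->
    `|\int[P]_w (xi w * Phi k.+1 w) - \int[P]_w (xi w * Phi k w)| <=
    rate^-1 * (\int[P]_w (xi w * G w * W k w) - \int[P]_w (xi w * G w * W k.+1 w)).
  move=> nk; have [bl El] := blin _ nk.
  have bP := bounded_mfunM bxT (bPhi _ nk).
  have bP' := bounded_mfunM bxT (bPhi _ (leqW nk)).
  rewrite -[X in `|X|]addr0 -El -(RintegralB_bounded P1 bP' bP).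
  rewrite -(RintegralD_bounded P1 (bounded_mfunB bP' bP) bl).
  apply: (@le_trans _ _ (\int[P]_w (xi w * G w * W k w ^+ 2))).
    apply: (le_normr_Rintegral_bounded P1).
    - exact: bounded_mfunD (bounded_mfunB bP' bP) bl.
    - exact: bounded_T (bounded_mfunM (mono nk bxG) (bounded_mfunX 2 (bW (leqnn k)))).
    - move=> w; rewrite -mulrBr -mulrDr normrM ger0_norm// -mulrA ler_wpM2l//; exact: H.
  by rewrite ler_pdivlMl//; apply: potential => //; exact: mono nk bxG.
suff h j : `|\int[P]_w (xi w * Phi (n + j)%N w) - \int[P]_w (xi w * Phi n w)| <=
    rate^-1 * (\int[P]_w (xi w * G w * W n w) - \int[P]_w (xi w * G w * W (n + j)%N w)).
  apply: le_trans (h _) _; rewrite ler_wpM2l ?invr_ge0 ?(ltW rate0)// gerBl.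
  by apply: Rintegral_ge0 => w _; rewrite mulr_ge0// ltW.
elim: j => [|j IH]; first by rewrite addn0 !subrr normr0 mulr0.
rewrite addnS.
have := step (n + j)%N (leq_addr _ _).
set a := \int[P]_w (xi w * Phi n w); set b := \int[P]_w (xi w * Phi (n + j)%N w).
set c := \int[P]_w (xi w * Phi (n + j).+1 w) => h.
have -> : c - a = (c - b) + (b - a) by ring.
by apply: le_trans (ler_normD _ _) _; apply: le_trans (lerD h IH) _;
  rewrite -mulrDr addrC subrKA.
Qed.

Variable Zoo : T -> R.
Hypotheses (mZoo : measurable_fun setT Zoo) (Zoo01 : forall w, 0 <= Zoo w <= 1).
Hypothesis cvgZ : {ae P, forall w, Z n w @[n --> \oo] --> Zoo w}.

Let bZT n : bounded_mfun (Z n). Proof. exact: bounded_T (bZ (leqnn n)). Qed.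

Let bZoo : bounded_mfun Zoo.
Proof. by split => //; exists 1 => w; have /andP[z0 z1] := Zoo01 w; rewrite ger0_norm. Qed.

Let norm_subZ (a b : R) : 0 <= a <= 1 -> 0 <= b <= 1 -> `|a - b| <= 1.
Proof. by move=> /andP[a0 a1] /andP[b0 b1]; rewrite ler_norml; apply/andP; split; lra. Qed.

Let square_lin (a b c i u : R) : (a - c) ^+ 2 - (b - c) ^+ 2 - 2 * (b - c) * (i / u) =
  (a - c) ^+ 2 - (b - c) ^+ 2 + - (2 * (b - c) * u^-1) * i.
Proof. by ring. Qed.

(** [drift] applied to (Z_k - Z_n)^2, which starts from 0 at k = n; bounded convergence then lets k
    tend to infinity. *)
Lemma square_mean : exists C : R, forall n (xi : T -> R),
  bounded_mfun (xi : S_ n -> R) -> (forall w, 0 <= xi w) ->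
  \int[P]_w (xi w * (Z n w - Zoo w) ^+ 2) <= C * \int[P]_w (xi w * W n w).
Proof.
have [C C0 HC] := dominated_ge0 (square_step beta xy0).
exists (rate^-1 * C) => n xi bxi xi0.
have bxiT := bounded_T bxi.
have [M xiM] := bxiT.2.
have h N : (n <= N)%N -> \int[P]_w (xi w * (Z N w - Z n w) ^+ 2) <=
    rate^-1 * C * \int[P]_w (xi w * W n w).
  move=> nN; pose Phi k w : R := (Z k w - Z n w) ^+ 2.
  pose lin k w : R := - (2 * (Z k w - Z n w) * W k w) * inc k w.
  have := @drift n Phi lin xi (fun=> C) bxi xi0 (bounded_mfun_cst _ _) (fun=> C0).
  have E0 : \int[P]_w (xi w * Phi n w) = 0.
    transitivity (\int[P]_w (0 : R)); last exact: Rintegral_cst1.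
    by apply: eq_Rintegral => w _; rewrite /Phi subrr expr0n/= mulr0.
  have EC : \int[P]_w (xi w * C * W n w) = C * \int[P]_w (xi w * W n w).
    rewrite -(RintegralZl_bounded P1 _ (bounded_T (bounded_mfunM bxi (bW (leqnn n))))).
    by apply: eq_Rintegral => w _; ring.
  rewrite E0 EC mulrA => H; apply: le_trans (ler_norm _) _.
  rewrite -[X in `|X|]subr0; apply: H => //.
  - by move=> k nk; apply: bounded_mfunX; exact: bounded_mfunB.
  - move=> k nk.
    have bD' : bounded_mfun ((fun w => - (2 * (Z k w - Z n w) * W k w)) : S_ k -> R).
      apply: bounded_mfunN; apply: bounded_mfunM; last exact: bW.
      by apply: bounded_mfunM; [exact: bounded_mfun_cst|apply: bounded_mfunB; exact: bZ].
    have [b1 E1] := bxi_inc (bounded_mfunM (mono nk bxi) bD').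
    rewrite (_ : (fun w => xi w * lin k w) =
      (fun w => xi w * - (2 * (Z k w - Z n w) * W k w) * inc k w)).
      by split => //; exact: bounded_T b1.
    by apply/funext => w; rewrite /lin mulrA.
  - move=> k w nk; have := HC _ (valid_dr k n w (lexx 1)).
    rewrite newZ_dr; congr (_ <= _); last first.
      by rewrite ger0_norm ?invr_ge0 ?exprn_ge0 ?(ltW (D0 _ _))// /W exprVn.
    by congr (`|_|); exact: square_lin.
have -> : \int[P]_w (xi w * (Z n w - Zoo w) ^+ 2) = \int[P]_w (xi w * (Zoo w - Z n w) ^+ 2).
  by apply: eq_Rintegral => w _; rewrite -sqrrN opprB.
have cvg : \int[P]_w (xi w * (Z N w - Z n w) ^+ 2) @[N --> \oo] -->
    \int[P]_w (xi w * (Zoo w - Z n w) ^+ 2).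
  apply: (@bounded_cvg_Rintegral _ _ _ P _ _ M) => //.
  - by move=> N; have [] := bounded_mfunM bxiT (bounded_mfunX 2 (bounded_mfunB (bZT N)
    (bZT n))).
  - by have [] := bounded_mfunM bxiT (bounded_mfunX 2 (bounded_mfunB bZoo (bZT n))).
  - move=> N w; rewrite normrM normrX -[leRHS]mulr1 ler_pM// exprn_ile1//.
    by rewrite norm_subZ// urn_prop_itv.
  - apply: filterS cvgZ => w Zw; apply: cvgMr; rewrite expr2; under eq_fun do rewrite expr2.
    by apply: cvgM; apply: cvgB => //; exact: cvg_cst.
rewrite -(cvg_lim _ cvg)//; apply: limr_le; first by apply/cvg_ex; eexists; exact: cvg.
by exists n => // N /= nN; exact: h.
Qed.

(** * Strong law for the total, through the moments of the martingale D_k - (x + y) - k m *)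

Let N_ k w : R := D k w - (x + y) - k%:R * m.
Let res k w : R := rei k w - m.
Let b : R := beta + m.

Let NS k w : N_ k.+1 w = N_ k w + res k w.
Proof. by rewrite /N_ DS /res reiE -natr1; ring. Qed.

Let res_le k w : `|res k w| <= b.
Proof.
have /andP[r0 r1] : 0 <= rei k w <= beta.
  by rewrite reiE; case: bit; [exact: Ra_itv|exact: Rb_itv].
by rewrite /res /b ler_norml; apply/andP; split; have := ltW m0; lra.
Qed.

Let bN k : bounded_mfun (N_ k : S_ k -> R).
Proof.
by apply: bounded_mfunB; [apply: bounded_mfunB; first exact: bD|]; exact: bounded_mfun_cst.
Qed.

Let bNT k : bounded_mfun (N_ k). Proof. exact: bounded_T (bN k). Qed.

Let E_res k (xi : T -> R) : bounded_mfun (xi : S_ k -> R) ->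
  bounded_mfun (fun w => xi w * res k w) /\ \int[P]_w (xi w * res k w) = 0.
Proof.
move=> bxi; have [bR ER] := bxi_rei bxi.
have bxm := bounded_T (bounded_mfunM (bounded_mfun_cst _ m) bxi).
have -> : (fun w => xi w * res k w) = (fun w => xi w * rei k w - m * xi w).
  by apply/funext => w; rewrite /res; ring.
split; first exact: bounded_mfunB (bounded_T bR) bxm.
by rewrite (RintegralB_bounded P1 (bounded_T bR) bxm) ER (RintegralZl_bounded P1 _
  (bounded_T bxi)) subrr.
Qed.

(** One step of a moment recursion: the term linear in [res] has mean zero. *)
Let E_step k (f g h : T -> R) (C : R) : bounded_mfun f -> bounded_mfun g ->
  bounded_mfun (h : S_ k -> R) -> (forall w, f w <= g w + h w * res k w + C) ->
  \int[P]_w f w <= \int[P]_w g w + C.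
Proof.
move=> bf bg bh fg; have [b1 E1] := E_res bh.
have bC : bounded_mfun ((fun=> C) : T -> R) by exact: bounded_mfun_cst.
have b2 := bounded_mfunD bg b1.
apply: le_trans (le_Rintegral_bounded P1 bf (bounded_mfunD b2 bC) fg) _.
by rewrite (RintegralD_bounded P1 b2 bC) (RintegralD_bounded P1 bg b1) E1 addr0
  (Rintegral_cst1 P1).
Qed.

Let N_init (j : nat) : \int[P]_w (N_ 0 w ^+ j.+1) = 0.
Proof.
transitivity (\int[P]_w (0 : R)); last exact: Rintegral_cst1.
by apply: eq_Rintegral => w _; rewrite /N_ /D /= mul0r !subr0 subrr expr0n.
Qed.

Let N2_le k : \int[P]_w (N_ k w ^+ 2) <= b ^+ 2 * k%:R.
Proof.
elim: k => [|k IH]; first by rewrite N_init mulr0.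
have h w : N_ k.+1 w ^+ 2 <= N_ k w ^+ 2 + (2 * N_ k w) * res k w + b ^+ 2.
  have aux (u r : R) : `|r| <= b -> (u + r) ^+ 2 <= u ^+ 2 + (2 * u) * r + b ^+ 2.
    by rewrite ler_norml => /andP[h1 h2]; nra.
  by rewrite NS; exact: aux.
have := E_step (bounded_mfunX 2 (bNT k.+1)) (bounded_mfunX 2 (bNT k))
  (bounded_mfunM (bounded_mfun_cst _ 2) (bN k)) h.
by move=> /le_trans; apply; rewrite -natr1 mulrDr mulr1 lerD2r.
Qed.

(** Fourth moments make the mean of (N_k / k)^4 of order 1 / k^2, hence summable; second moments
    would only give 1 / k. *)
Let N4_le k : \int[P]_w (N_ k w ^+ 4) <= 4 * b ^+ 4 * k%:R ^+ 2.
Proof.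
elim: k => [|k IH]; first by rewrite N_init expr0n mulr0.
have h w : N_ k.+1 w ^+ 4 <= (N_ k w ^+ 4 + (8 * b ^+ 2) * N_ k w ^+ 2) +
    (4 * N_ k w ^+ 3) * res k w + 3 * b ^+ 4.
  have aux (u r : R) : `|r| <= b ->
      (u + r) ^+ 4 <= u ^+ 4 + (8 * b ^+ 2) * u ^+ 2 + (4 * u ^+ 3) * r + 3 * b ^+ 4.
    rewrite ler_norml => /andP[h1 h2].
    have r2 : r ^+ 2 <= b ^+ 2 by nra.
    have c1 : 0 <= (b ^+ 2 - r ^+ 2) * u ^+ 2 by rewrite mulr_ge0 ?sqr_ge0 ?subr_ge0.
    have c2 : 0 <= (b ^+ 2 - r ^+ 2) * (b ^+ 2 + r ^+ 2).
      by rewrite mulr_ge0 ?subr_ge0// addr_ge0 ?sqr_ge0.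
    (* Yields 4 u r^3 <= 2 u^2 r^2 + 2 r^4, whence the coefficients 8 and 3. *)
    have c3 : 0 <= r ^+ 2 * (u - r) ^+ 2 by rewrite mulr_ge0 ?sqr_ge0.
    lra.
  by rewrite NS; exact: aux.
have b2 := bounded_mfunM (bounded_mfun_cst _ (8 * b ^+ 2)) (bounded_mfunX 2 (bNT k)).
have := E_step (bounded_mfunX 4 (bNT k.+1)) (bounded_mfunD (bounded_mfunX 4 (bNT k)) b2)
  (bounded_mfunM (bounded_mfun_cst _ 4) (bounded_mfunX 3 (bN k))) h.
rewrite (RintegralD_bounded P1 (bounded_mfunX 4 (bNT k)) b2).
rewrite (RintegralZl_bounded P1 _ (bounded_mfunX 2 (bNT k))).
move=> /le_trans; apply; rewrite -natr1.
have : 8 * b ^+ 2 * (\int[P]_w (N_ k w ^+ 2)) <= 8 * b ^+ 2 * (b ^+ 2 * k%:R).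
  by rewrite ler_wpM2l ?N2_le// mulr_ge0 ?sqr_ge0.
have : 0 <= b ^+ 4 by rewrite exprn_even_ge0.
lra.
Qed.

Lemma urn_total_cvg : {ae P, forall w, D n w / n.+1%:R @[n --> \oo] --> m}.
Proof.
have b40 : 0 <= b ^+ 4 by rewrite exprn_even_ge0.
pose f k w : R := k.+1%:R ^- 4 * N_ k w ^+ 4.
have bf k : bounded_mfun (f k).
  by apply: bounded_mfunM; [exact: bounded_mfun_cst|exact: bounded_mfunX].
have f0 k w : 0 <= f k w.
  by apply: mulr_ge0; [rewrite invr_ge0 exprn_ge0|exact: exprn_even_ge0].
have fE k : \int[P]_w f k w <= 4 * b ^+ 4 * k.+1%:R ^- 2.
  rewrite (RintegralZl_bounded P1 _ (bounded_mfunX 4 (bNT k))).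
  have k0 : 0 < k.+1%:R :> R by rewrite ltr0n.
  rewrite ler_pdivrMl ?exprn_gt0//; apply: (le_trans (N4_le k)).
  have -> : k.+1%:R ^+ 4 * (4 * b ^+ 4 / k.+1%:R ^+ 2) = 4 * b ^+ 4 * k.+1%:R ^+ 2.
    by move: k0; move: (k.+1%:R : R) => a a0; field; rewrite gt_eqF.
  apply: ler_wpM2l; first by rewrite mulr_ge0.
  by apply: lerXn2r; rewrite ?nnegrE ?ler_nat.
(* A telescoping majorant: 1 / (n + 1)^2 is at most 2 (1 / (n + 1) - 1 / (n + 2)). *)
have sf n : \sum_(0 <= k < n) \int[P]_w f k w <= 8 * b ^+ 4 * (1 - n.+1%:R^-1).
  elim: n => [|n IH]; first by rewrite big_nil invr1 subrr mulr0.
  rewrite big_nat_recr//=; apply: le_trans (lerD IH (fE n)) _.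
  rewrite -subr_ge0.
  have -> : 8 * b ^+ 4 * (1 - n.+2%:R^-1) -
      (8 * b ^+ 4 * (1 - n.+1%:R^-1) + 4 * b ^+ 4 / n.+1%:R ^+ 2) =
      4 * b ^+ 4 * (n%:R * (n.+1%:R ^- 2 / n.+2%:R)).
    rewrite -[n.+2]addn2 -[n.+1]addn1 !natrD; have : 0 <= n%:R :> R by [].
    move: (n%:R : R) => a a0; field.
    by apply/andP; split; rewrite gt_eqF//; lra.
  apply: mulr_ge0; first by rewrite mulr_ge0.
  by apply: mulr_ge0 => //; apply: divr_ge0 => //; rewrite invr_ge0 exprn_ge0.
have /(ae_cvg0_summable P1 bf f0) : forall n, \sum_(0 <= k < n) \int[P]_w f k w <= 8 * b ^+ 4.
  move=> n; apply: le_trans (sf n) _; apply: ler_piMr; first by rewrite mulr_ge0.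
  by rewrite lerBlDr lerDl invr_ge0.
apply: filterS => w fw.
have N0 : N_ n w / n.+1%:R @[n --> \oo] --> (0 : R).
  apply/norm_cvg0P.
  have E n : `|N_ n w / n.+1%:R| = Num.sqrt (Num.sqrt (f n w)).
    have -> : f n w = ((N_ n w / n.+1%:R) ^+ 2) ^+ 2.
      by rewrite /f -exprM exprMn mulrC exprVn.
    by rewrite sqrtr_sqr (ger0_norm (sqr_ge0 _)) sqrtr_sqr.
  rewrite (eq_cvg _ _ E).
  have : Num.sqrt (Num.sqrt (f n w)) @[n --> \oo] --> Num.sqrt (Num.sqrt (0 : R)).
    by do 2! (apply: continuous_cvg; first exact: sqrt_continuous).
  by rewrite !sqrtr0.
have E n : D n w / n.+1%:R = N_ n w / n.+1%:R + (x + y - m) * n.+1%:R^-1 + m.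
  have n0 : 0 < n.+1%:R :> R by rewrite ltr0n.
  have -> : N_ n w = D n w - (x + y) - (n.+1%:R - 1) * m by rewrite /N_ -natr1; ring.
  by move: n0; move: (n.+1%:R : R) => a a0; field; rewrite gt_eqF.
rewrite (eq_cvg _ _ E).
have : N_ n w / n.+1%:R + (x + y - m) * n.+1%:R^-1 + m @[n --> \oo] -->
    0 + (x + y - m) * 0 + m.
  apply: cvgD; last exact: cvg_cst.
  by apply: cvgD => //; apply: cvgMr; exact: cvg_harmonic.
by rewrite mulr0 !add0r.
Qed.

Lemma urn_total_inv_cvg0 : {ae P, forall w, (D n w)^-1 @[n --> \oo] --> 0}.
Proof.
apply: filterS urn_total_cvg => w Dw.
have E n : (D n w)^-1 = n.+1%:R^-1 * (D n w / n.+1%:R)^-1.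
  by rewrite invf_div mulrA mulVf ?mul1r// pnatr_eq0.
rewrite (eq_cvg _ _ E).
have : n.+1%:R^-1 * (D n w / n.+1%:R)^-1 @[n --> \oo] --> 0 * m^-1.
  by apply: cvgM; [exact: cvg_harmonic|apply: cvgV => //; rewrite gt_eqF].
by rewrite mul0r.
Qed.

Let bS k : bounded_mfun ((fun w => varS p q (Z k w)) : S_ k -> R).
Proof.
have b1 := bZ (leqnn k).
have b2 : bounded_mfun ((fun w => 1 - Z k w) : S_ k -> R).
  by apply: bounded_mfunB => //; exact: bounded_mfun_cst.
apply: bounded_mfunM; first exact: bounded_mfunM.
by apply: bounded_mfunD; apply: bounded_mfunM => //; exact: bounded_mfun_cst.
Qed.

Let exp_varS_itv (c : R) k w : 0 <= c ->
  0 <= expR (- (c * (varS p q (Z k w) / D k w))) <= 1.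
Proof.
move=> c0; rewrite expR_ge0 /= -expR0 ler_expR oppr_le0 mulr_ge0//.
by rewrite divr_ge0 ?(ltW (D0 _ _))// varS_ge0// urn_prop_itv.
Qed.

Let bexp_varS (c : R) k : 0 <= c ->
  bounded_mfun ((fun w => expR (- (c * (varS p q (Z k w) / D k w)))) : S_ k -> R).
Proof.
move=> c0; split; last first.
  by exists 1 => w; have /andP[e0 e1] := exp_varS_itv k w c0; rewrite ger0_norm.
have [mg _] : bounded_mfun ((fun w => - (c * (varS p q (Z k w) / D k w))) : S_ k -> R).
  apply: bounded_mfunN; apply: bounded_mfunM; first exact: bounded_mfun_cst.
  exact: (bounded_mfunM (bS k) (bW (leqnn k))).
by apply: measurableT_comp mg; apply: continuous_measurable_fun; exact: continuous_expR.
Qed.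

Let kappa_ge0 (t : R) : 0 <= kappa m t.
Proof. by rewrite /kappa divr_ge0 ?sqr_ge0// mulr_ge0// ltW. Qed.

(** * Mean of the compensated cosine at a fixed scale *)

Section characteristic_function.
Variables (t phi l : R).
Hypothesis l1 : 1 <= l.

Let kap := kappa m t.
Let arg k n w : R := t * l * (Z k w - Z n w) + phi.
Let expo k w : R := expR (- (kap * l ^+ 2 * (varS p q (Z k w) / D k w))).

Let kap0 : 0 <= kap.
Proof. exact: kappa_ge0. Qed.

Let cos1 (r : R) : `|cos r| <= 1.
Proof. by rewrite ler_norml cos_geN1 cos_le1. Qed.

Let sin1 (r : R) : `|sin r| <= 1.
Proof. by rewrite ler_norml sin_geN1 sin_le1. Qed.

Let barg k n : (n <= k)%N -> bounded_mfun (arg k n : S_ k -> R).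
Proof.
move=> nk; apply: bounded_mfunD; last exact: bounded_mfun_cst.
by apply: bounded_mfunM; [exact: bounded_mfun_cst|apply: bounded_mfunB; exact: bZ].
Qed.

Let bdS k : bounded_mfun ((fun w => dvarS p q (Z k w)) : S_ k -> R).
Proof.
have b1 := bZ (leqnn k).
apply: bounded_mfunD; first apply: bounded_mfunD; first exact: bounded_mfun_cst.
  by apply: bounded_mfunM => //; exact: bounded_mfun_cst.
by apply: bounded_mfunM; [exact: bounded_mfun_cst|exact: bounded_mfunX].
Qed.

Let kl0 : 0 <= kap * l ^+ 2.
Proof. by rewrite mulr_ge0// sqr_ge0. Qed.

Let expo_itv k w : 0 <= expo k w <= 1. Proof. exact: exp_varS_itv. Qed.

Let bexpo k : bounded_mfun (expo k : S_ k -> R). Proof. exact: bexp_varS. Qed.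

Let Phi n k w := charac p q m t phi l (Z n w) (Z k w) (D k w).
Let lin n k w := charac_lin p q m t phi (dr k n l w).

Let bPhi n k : (n <= k)%N -> bounded_mfun (Phi n k : S_ k -> R).
Proof.
move=> nk; apply: bounded_mfunM (bexpo k).
by exact: (bounded_mfun_continuous_comp (@continuous_cos R) cos1 (barg nk).1).
Qed.

Let lin_split (X e s c K u i S dS r : R) :
  X * (e * (s * (t * l) * (i / u) + c * (K * l ^+ 2 / u ^+ 2) *
    (m * i ^+ 2 - S * r + dS * i))) =
  X * (e * s * (t * l * u^-1) + e * c * (K * l ^+ 2 * u^-1 ^+ 2) * dS) * i +
  (m * (X * (e * c * (K * l ^+ 2 * u^-1 ^+ 2)) * i ^+ 2) -
   X * (e * c * (K * l ^+ 2 * u^-1 ^+ 2)) * S * r).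
Proof. by rewrite -exprVn; ring. Qed.

(** [lin_split] sorts the terms by what the draw contributes. The part in [inc] has mean zero, and
    those in [inc ^+ 2] and [rei] both have mean m times that of xi A2 S, with opposite signs. *)
Let lin_mean0 n k (xi : T -> R) : (n <= k)%N -> bounded_mfun (xi : S_ n -> R) ->
  bounded_mfun (fun w => xi w * lin n k w) /\ \int[P]_w (xi w * lin n k w) = 0.
Proof.
move=> nk bxi.
pose A2 w : R := expo k w * cos (arg k n w) * (kap * l ^+ 2 * W k w ^+ 2).
pose A1 w : R := expo k w * sin (arg k n w) * (t * l * W k w) + A2 w * dvarS p q (Z k w).
have bcst (a : R) : bounded_mfun ((fun=> a) : S_ k -> R) by exact: bounded_mfun_cst.
have bA2 : bounded_mfun (A2 : S_ k -> R).
  apply: bounded_mfunM; first apply: bounded_mfunM => //.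
    by exact: (bounded_mfun_continuous_comp (@continuous_cos R) cos1 (barg nk).1).
  by apply: bounded_mfunM => //; apply: bounded_mfunX; exact: bW.
have bA1 : bounded_mfun (A1 : S_ k -> R).
  apply: bounded_mfunD; last exact: bounded_mfunM.
  apply: bounded_mfunM; first apply: bounded_mfunM => //.
    by exact: (bounded_mfun_continuous_comp (@continuous_sin R) sin1 (barg nk).1).
  by apply: bounded_mfunM => //; exact: bW.
have bxk := mono nk bxi.
have [c1 E1] := bxi_inc (bounded_mfunM bxk bA1).
have [c2 E2] := bxi_inc2 (bounded_mfunM bxk bA2).
have bA2S := bounded_mfunM (bounded_mfunM bxk bA2) (bS k).
have [c3 E3] := bxi_rei bA2S.
have c1' := bounded_T c1; have c2' := bounded_T c2; have c3' := bounded_T c3.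
have c2m := bounded_mfunM (bounded_mfun_cst _ m) c2'.
have -> : (fun w => xi w * lin n k w) = (fun w => xi w * A1 w * inc k w +
    (m * (xi w * A2 w * inc k w ^+ 2) - xi w * A2 w * varS p q (Z k w) * rei k w)).
  apply/funext => w; rewrite /lin /charac_lin /A1 /A2 /W; cbn -[D Z].
  rewrite -/(arg k n w) -/(expo k w) -/(inc k w) -/(rei k w) -/kap.
  exact: lin_split.
have b23 := bounded_mfunB c2m c3'.
split; first exact: bounded_mfunD.
rewrite (RintegralD_bounded P1 c1' b23) (RintegralB_bounded P1 c2m c3').
by rewrite (RintegralZl_bounded P1 _ c2') E1 E2 E3 subrr addr0.
Qed.

(** With u = 1 / D_k and v = 1 / D_n, all but two powers of u are frozen at time n, which is the
    form required by [drift]. *)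
Let err_le (u v : R) : 0 < u -> u <= v ->
  `|l * u ^+ 2 + l ^+ 3 * u ^+ 3 + l ^+ 4 * u ^+ 4| <=
    (l + l ^+ 3 * v + l ^+ 4 * v ^+ 2) * u ^+ 2.
Proof.
move=> u0 uv; have l0 : 0 < l by exact: lt_le_trans l1.
rewrite ger0_norm; last by rewrite !addr_ge0// mulr_ge0// ?exprn_ge0// ltW.
have c1 : 0 <= l ^+ 3 * (u ^+ 2 * (v - u)).
  by rewrite mulr_ge0 ?exprn_ge0 ?(ltW l0)// mulr_ge0 ?sqr_ge0// subr_ge0.
have c2 : 0 <= l ^+ 4 * (u ^+ 2 * ((v - u) * (v + u))).
  rewrite mulr_ge0 ?exprn_ge0 ?(ltW l0)// mulr_ge0 ?sqr_ge0// mulr_ge0 ?subr_ge0//.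
  by rewrite addr_ge0 ?(ltW u0)// (le_trans (ltW u0)).
lra.
Qed.

Lemma charac_mean_scaled (C : R) n (xi : T -> R) : 0 <= C ->
  (forall i, valid_draw beta (x + y) i ->
    `|charac p q m t phi (dlam i) (dZ0 i) (newZ i) (newD i) -
      charac p q m t phi (dlam i) (dZ0 i) (dZ i) (dD i) +
      charac_lin p q m t phi i| <= C * `|charac_err i|) ->
  bounded_mfun (xi : S_ n -> R) -> (forall w, 0 <= xi w) ->
  `|\int[P]_w (xi w * cos (t * l * (Zoo w - Z n w) + phi)) -
    \int[P]_w (xi w * (cos phi * expo n w))| <=
  rate^-1 * C * \int[P]_w (xi w * (l * W n w + l ^+ 3 * W n w ^+ 2 + l ^+ 4 * W n w ^+ 3)).
Proof.
move=> C0 HC bxi xi0; have l0 : 0 < l by exact: lt_le_trans l1.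
have bxiT := bounded_T bxi; have [M xiM] := bxiT.2.
pose G w : R := C * (l + l ^+ 3 * W n w + l ^+ 4 * W n w ^+ 2).
have bWn := bW (leqnn n).
have bcst (a : R) : bounded_mfun ((fun=> a) : S_ n -> R) by exact: bounded_mfun_cst.
have bG : bounded_mfun (G : S_ n -> R).
  apply: bounded_mfunM => //; apply: bounded_mfunD.
    by apply: bounded_mfunD => //; exact: bounded_mfunM.
  by apply: bounded_mfunM => //; exact: bounded_mfunX.
have G0 w : 0 <= G w.
  rewrite mulr_ge0// !addr_ge0// ?(ltW l0)// mulr_ge0 ?exprn_ge0 ?(ltW l0)// ?exprn_ge0//.
    by rewrite ltW.
  by rewrite ltW.
have EG : rate^-1 * \int[P]_w (xi w * G w * W n w) =
    rate^-1 * C * \int[P]_w (xi w * (l * W n w + l ^+ 3 * W n w ^+ 2 + l ^+ 4 * W n w ^+ 3)).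
  rewrite -mulrA; congr (_ * _).
  rewrite -(RintegralZl_bounded P1).
    by apply: eq_Rintegral => w _; rewrite /G; ring.
  apply: (@bounded_T n); apply: bounded_mfunM => //; apply: bounded_mfunD.
    by apply: bounded_mfunD; apply: bounded_mfunM => //; exact: bounded_mfunX.
  by apply: bounded_mfunM => //; exact: bounded_mfunX.
have En : \int[P]_w (xi w * Phi n n w) = \int[P]_w (xi w * (cos phi * expo n w)).
  by apply: eq_Rintegral => w _; rewrite /Phi /charac subrr mulr0 add0r.
have H N : (n <= N)%N -> `|\int[P]_w (xi w * Phi n N w) - \int[P]_w (xi w *
  (cos phi * expo n w))| <=
    rate^-1 * C * \int[P]_w (xi w * (l * W n w + l ^+ 3 * W n w ^+ 2 + l ^+ 4 * W n w ^+ 3)).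
  rewrite -EG -En; apply: (@drift n (Phi n) (lin n) xi G) => //.
  - by move=> k nk; exact: bounded_T (bPhi nk).
  - by move=> k nk; exact: lin_mean0.
  - move=> k w nk; have := HC _ (valid_dr k n w l1); rewrite newZ_dr newD_dr.
    move/le_trans; apply; rewrite /G -mulrA ler_wpM2l//.
    have -> : charac_err (dr k n l w) =
      l * W k w ^+ 2 + l ^+ 3 * W k w ^+ 3 + l ^+ 4 * W k w ^+ 4.
      by rewrite /charac_err /W !exprVn.
    by apply: err_le => //; rewrite /W lef_pV2 ?posrE// urn_total_mono.
have cvg : \int[P]_w (xi w * Phi n N w) @[N --> \oo] -->
    \int[P]_w (xi w * cos (t * l * (Zoo w - Z n w) + phi)).
  apply: (@bounded_cvg_Rintegral _ _ _ P (fun N w => xi w * Phi n N w) _ M) => //.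
  - move=> N; suff : bounded_mfun (fun w => xi w * Phi n N w) by case.
    apply: bounded_mfunM => //.
    have barg' : bounded_mfun (arg N n).
      apply: bounded_mfunD; last exact: bounded_mfun_cst.
      by apply: bounded_mfunM; [exact: bounded_mfun_cst|exact: bounded_mfunB].
    exact: bounded_mfunM (bounded_mfun_continuous_comp (@continuous_cos R) cos1 barg'.1)
      (bounded_T (bexpo N)).
  - have bargoo : bounded_mfun (fun w => t * l * (Zoo w - Z n w) + phi).
      apply: bounded_mfunD; last exact: bounded_mfun_cst.
      by apply: bounded_mfunM; [exact: bounded_mfun_cst|exact: bounded_mfunB].
    by have [] := bounded_mfunM bxiT (bounded_mfun_continuous_comp
      (@continuous_cos R) cos1 bargoo.1).
  - move=> N w; rewrite normrM -[leRHS]mulr1 ler_pM// normrM -[leRHS]mulr1 ler_pM//.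
    by have /andP[e0 e1] := expo_itv N w; rewrite ger0_norm.
  - apply: filterS2 cvgZ urn_total_inv_cvg0 => w Zw Dw.
    apply: cvgMr.
    have cS : varS p q (Z N w) @[N --> \oo] --> varS p q (Zoo w).
      have c1 : 1 - Z N w @[N --> \oo] --> 1 - Zoo w by apply: cvgB => //; exact: cvg_cst.
      apply: cvgM; first exact: cvgM.
      by apply: cvgD; apply: cvgM => //; exact: cvg_cst.
    have c1 : cos (t * l * (Z N w - Z n w) + phi) @[N --> \oo] --> cos (t * l *
      (Zoo w - Z n w) + phi).
      apply: continuous_cvg; first exact: continuous_cos.
      apply: cvgD; last exact: cvg_cst.
      by apply: cvgMr; apply: cvgB => //; exact: cvg_cst.
    (* The compensating exponential tends to 1, as the scale is fixed and 1 / D_N tends to 0. *)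
    have c2 : expo N w @[N --> \oo] --> expR (- (kap * l ^+ 2 * (varS p q (Zoo w) * 0))).
      apply: continuous_cvg; first exact: continuous_expR.
      by apply: cvgN; apply: cvgMr; exact: cvgM.
    have := cvgM c1 c2; rewrite mulr0 mulr0 oppr0 expR0 mulr1; exact.
have cvg' : `|\int[P]_w (xi w * Phi n N w) - \int[P]_w (xi w *
  (cos phi * expo n w))| @[N --> \oo] -->
    `|\int[P]_w (xi w * cos (t * l * (Zoo w - Z n w) + phi)) - \int[P]_w (xi w *
      (cos phi * expo n w))|.
  by apply: cvg_norm; apply: cvgB => //; exact: cvg_cst.
rewrite -(cvg_lim _ cvg')//; apply: limr_le; first by apply/cvg_ex; eexists; exact: cvg'.
by exists n => // N /= nN; exact: H.
Qed.

End characteristic_function.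

(** The order of quantifiers is the point: the constant of [charac_step] precedes n and l, so that l
    = sqrt n may be substituted. *)
Lemma charac_mean (t phi : R) : exists C : R, forall n (l : R) (xi : T -> R), 1 <= l ->
  bounded_mfun (xi : S_ n -> R) -> (forall w, 0 <= xi w) ->
  `|\int[P]_w (xi w * cos (t * l * (Zoo w - Z n w) + phi)) -
    \int[P]_w (xi w * (cos phi * expR (- (kappa m t * l ^+ 2 * (varS p q
      (Z n w) / D n w)))))| <=
  C * \int[P]_w (xi w * (l * W n w + l ^+ 3 * W n w ^+ 2 + l ^+ 4 * W n w ^+ 3)).
Proof.
have [C C0 HC] := dominated_ge0 (charac_step beta t phi xy0 m0 p0 q0).
by exists (rate^-1 * C) => n l xi l1 bxi xi0; exact: charac_mean_scaled.
Qed.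

(** * Asymptotics of the conditional distributions *)

Variable K : forall n, R.-pker g_sigma_algebraType (A_ n) ~> RR.
Hypothesis cK : forall n, (0 < n)%N ->
  cond_distribution P (K n) (fun w => Num.sqrt n%:R * (Z n w - Zoo w)).

Let K1 n w : K n w setT = 1%E. Proof. exact: prob_kernel. Qed.

Let mX n : measurable_fun [set: T] (fun w => Num.sqrt n%:R * (Z n w - Zoo w)).
Proof.
suff : bounded_mfun (fun w => Num.sqrt n%:R * (Z n w - Zoo w)) by case.
by apply: bounded_mfunM; [exact: bounded_mfun_cst|exact: bounded_mfunB].
Qed.

Let cond_mean n A (f : RR -> R) : (0 < n)%N -> <<s A_ n >> A -> bounded_mfun f ->
  bounded_mfun ((fun w => \int[K n w]_r f r) : S_ n -> R) /\
  \int[P]_w (\1_A w * \int[K n w]_r f r) =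
  \int[P]_w (\1_A w * f (Num.sqrt n%:R * (Z n w - Zoo w))).
Proof.
move=> n0; exact: (@Rintegral_cond_distribution _ _ T RR R P (A_ n) _ (K n) (@Am n)
  (mX n) (cK n0)).
Qed.

Let err n w : R := Num.sqrt n%:R * W n w + Num.sqrt n%:R ^+ 3 * W n w ^+ 2 +
  Num.sqrt n%:R ^+ 4 * W n w ^+ 3.

Let berr n : bounded_mfun (err n : S_ n -> R).
Proof.
have bcst (a : R) : bounded_mfun ((fun=> a) : S_ n -> R) by exact: bounded_mfun_cst.
have bWn := bW (leqnn n).
apply: bounded_mfunD; first apply: bounded_mfunD; apply: bounded_mfunM => //.
  exact: bounded_mfunX.
exact: bounded_mfunX.
Qed.

Let limit_charac t phi n w : R :=
  cos phi * expR (- (kappa m t * n%:R * (varS p q (Z n w) / D n w))).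

Let blimit_charac t phi n : bounded_mfun (limit_charac t phi n : S_ n -> R).
Proof.
apply: bounded_mfunM; first exact: bounded_mfun_cst.
by apply: bexp_varS; rewrite mulr_ge0.
Qed.

(** The weights in [charac_mean] are indicators of the sets of [A_n], so both one-sided bounds pass
    from integrals to almost every point. *)
Let cond_charac t phi : exists c : R, {ae P, forall w, forall n, (0 < n)%N ->
  `|\int[K n w]_r cos (t * r + phi) - limit_charac t phi n w| <= c * err n w}.
Proof.
(* The sign changes because [K n] concerns Z_n - Zoo, whereas [charac_mean] is about Zoo - Z_n;
   [kappa] is even in t. *)
have [c Hc] := charac_mean (- t) phi; exists c.
apply: ae_foralln => -[|n]; first exact: aeW.
have bc : bounded_mfun ((fun r => cos (t * r + phi)) : RR -> R).
  apply: (bounded_mfun_continuous_comp (M := 1) (@continuous_cos R)).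
    by move=> r; rewrite ler_norml cos_geN1 cos_le1.
  by apply: measurable_funD => //; exact: measurable_funM.
pose F (w : T) : R := \int[K n.+1 w]_r cos (t * r + phi).
have [bF _] := cond_mean (ltn0Sn n) (@measurableT _ (S_ n.+1)) bc.
have bl := blimit_charac t phi n.+1.
have be := bounded_mfunM (bounded_mfun_cst (S_ n.+1) c) (berr n.+1).
have l1 : 1 <= Num.sqrt n.+1%:R :> R by rewrite -[leLHS]sqrtr1 ler_wsqrtr// ler1n.
have main A : <<s A_ n.+1 >> A ->
    `|\int[P]_w (\1_A w * F w) - \int[P]_w (\1_A w * limit_charac t phi n.+1 w)| <=
    \int[P]_w (\1_A w * (c * err n.+1 w)).
  move=> GA; have bA : bounded_mfun (\1_A : S_ n.+1 -> R) by exact: bounded_mfun_indic.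
  have [_ ->] := cond_mean (ltn0Sn n) GA bc.
  have dist_eq (a u e a' u' e' : R) : a = a' -> u = u' -> e = e' ->
      `|a - u| <= e -> `|a' - u'| <= e' by move=> -> -> ->.
  have A0 w : 0 <= \1_A w :> R by rewrite indicE.
  apply: dist_eq (Hc n.+1 _ _ l1 bA A0).
  - by apply: eq_Rintegral => w _; congr (_ * cos (_ + _)); ring.
  - apply: eq_Rintegral => w _; rewrite /limit_charac sqr_sqrtr//.
    by rewrite /kappa sqrrN.
  - rewrite -(RintegralZl_bounded P1); last exact: bounded_T (bounded_mfunM bA (berr n.+1)).
    by apply: eq_Rintegral => w _; rewrite mulrCA.
have dec A : <<s A_ n.+1 >> A ->
    \int[P]_w (\1_A w * (limit_charac t phi n.+1 w + c * err n.+1 w)) =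
    \int[P]_w (\1_A w * limit_charac t phi n.+1 w) + \int[P]_w (\1_A w * (c * err n.+1 w)) /\
    \int[P]_w (\1_A w * (limit_charac t phi n.+1 w - c * err n.+1 w)) =
    \int[P]_w (\1_A w * limit_charac t phi n.+1 w) - \int[P]_w (\1_A w * (c * err n.+1 w)).
  move=> GA; have bA : bounded_mfun (\1_A : S_ n.+1 -> R) by exact: bounded_mfun_indic.
  have b1 := bounded_T (bounded_mfunM bA bl); have b2 := bounded_T (bounded_mfunM bA be).
  rewrite -(RintegralD_bounded P1 b1 b2) -(RintegralB_bounded P1 b1 b2).
  by split; (apply: eq_Rintegral => w _); first [exact: mulrBr|exact: mulrDr].
have h1 : {ae P, forall w, F w <= limit_charac t phi n.+1 w + c * err n.+1 w}.
  apply: (ae_le_sub_sigma_algebra P1 (@Am n.+1) bF (bounded_mfunD bl be)) => A GA.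
  have [-> _] := dec A GA; have := main A GA; rewrite ler_norml => /andP[_].
  by rewrite lerBlDl.
have h2 : {ae P, forall w, limit_charac t phi n.+1 w - c * err n.+1 w <= F w}.
  apply: (ae_le_sub_sigma_algebra P1 (@Am n.+1) (bounded_mfunB bl be) bF) => A GA.
  have [_ ->] := dec A GA; have := main A GA; rewrite ler_norml => /andP[+ _].
  by rewrite lerBrDr addrC.
apply: filterS2 h1 h2 => w H1 H2 _; rewrite ler_norml; apply/andP; split.
  by rewrite lerBrDr addrC.
by rewrite lerBlDl.
Qed.

(** Chebyshev's inequality given [A_n], from [square_mean] with indicator weights. *)
Let cond_tail : exists c : R, {ae P, forall w, forall n, (0 < n)%N ->
  forall M : nat, (K n w [set r : RR | (M.+1%:R < `|r|)%R] <= (c *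
    (n%:R * W n w) / M.+1%:R ^+ 2)%:E)%E}.
Proof.
have [c Hc] := square_mean; exists c.
suff main (nM : nat * nat) : {ae P, forall w, (0 < nM.1)%N ->
    (K nM.1 w [set r : RR | (nM.2.+1%:R < `|r|)%R] <= (c *
      (nM.1%:R * W nM.1 w) / nM.2.+1%:R ^+ 2)%:E)%E}.
  apply: filterS (ae_forall_countable main) => w Hw n n0 M; exact: (Hw (n, M)).
case: nM => -[|n] M /=; first exact: aeW.
set B := [set r | _].
have mB : measurable (B : set RR).
  rewrite -[B]setTI.
  by apply: measurable_fun_ltr => //; exact: normr_measurable.
have bB : bounded_mfun (\1_B : RR -> R) by exact: bounded_mfun_indic.
pose F (w : T) : R := \int[K n.+1 w]_r \1_B r.
pose a : R := c * n.+1%:R / M.+1%:R ^+ 2.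
have bc := bounded_mfunM (bounded_mfun_cst (S_ n.+1) a) (bW (leqnn n.+1)).
have [bF _] := cond_mean (ltn0Sn n) (@measurableT _ (S_ n.+1)) bB.
have FK w : (K n.+1 w B = (F w)%:E)%E.
  by rewrite /F (EFin_Rintegral_bounded (K1 w) bB) integral_indic// setIT.
have h : {ae P, forall w, F w <= a * W n.+1 w}.
  apply: (ae_le_sub_sigma_algebra P1 (@Am n.+1) bF bc) => A GA.
  have bA : bounded_mfun (\1_A : S_ n.+1 -> R) by exact: bounded_mfun_indic.
  have A0 w : 0 <= \1_A w :> R by rewrite indicE.
  have [_ ->] := cond_mean (ltn0Sn n) GA bB.
  have M0 : 0 < M.+1%:R ^+ 2 :> R by rewrite exprn_gt0// ltr0n.
  have b1 := bounded_mfunM (bounded_T bA) (bounded_mfunX 2 (bounded_mfunB (bZT n.+1) bZoo)).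
  apply: (@le_trans _ _ (\int[P]_w (n.+1%:R / M.+1%:R ^+ 2 * (\1_A w *
    (Z n.+1 w - Zoo w) ^+ 2)))).
    apply: (le_Rintegral_bounded P1).
    - apply: bounded_mfunM; first exact: bounded_T bA.
      by split; [apply: measurableT_comp bB.1 (mX n.+1)|exists 1 => w;
        rewrite ger0_norm indicE//; case: (_ \in _)].
    - by apply: bounded_mfunM => //; exact: bounded_mfun_cst.
    - move=> w; rewrite mulrCA ler_wpM2l//.
      rewrite indicE; have [|_] := boolP (_ \in B); last first.
        by rewrite mulr_ge0 ?sqr_ge0// divr_ge0// ltW.
      rewrite inE /B /= => hB; rewrite mulrAC ler_pdivlMr// mul1r.
      have -> : n.+1%:R * (Z n.+1 w - Zoo w) ^+ 2 =
        `|Num.sqrt n.+1%:R * (Z n.+1 w - Zoo w)| ^+ 2.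
        by rewrite real_normK ?num_real// exprMn sqr_sqrtr.
      by apply: lerXn2r; rewrite ?nnegrE// ltW.
  rewrite (RintegralZl_bounded P1 _ b1).
  have := Hc n.+1 _ bA A0.
  have -> : \int[P]_w (\1_A w * (a * W n.+1 w)) = a * \int[P]_w (\1_A w * W n.+1 w).
    rewrite -(RintegralZl_bounded P1);
      last exact: bounded_T (bounded_mfunM bA (bW (leqnn n.+1))).
    by apply: eq_Rintegral => w _; rewrite mulrCA.
  have nM0 : 0 <= n.+1%:R / M.+1%:R ^+ 2 :> R by rewrite divr_ge0// ltW.
  move=> /(ler_wpM2l nM0) /le_trans; apply; rewrite /a.
  by rewrite [leLHS](_ : _ = c * n.+1%:R / M.+1%:R ^+ 2 * \int[P]_w
    (\1_A w * W n.+1 w))//; ring.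
apply: filterS h => w hw _; rewrite FK lee_fin (le_trans hw)// /a.
by rewrite [leLHS](_ : _ = c * (n.+1%:R * W n.+1 w) / M.+1%:R ^+ 2)//; ring.
Qed.

Let ratio_cvg : {ae P, forall w, n%:R * W n w @[n --> \oo] --> m^-1}.
Proof.
apply: filterS urn_total_cvg => w Dw.
have E n : n%:R * W n w = (1 - n.+1%:R^-1) * (D n w / n.+1%:R)^-1.
  have d0 := D0 n w; have n0 : 0 < n.+1%:R :> R by rewrite ltr0n.
  have -> : n%:R = n.+1%:R - 1 :> R by rewrite -natr1 addrK.
  by rewrite /W; move: n0 d0; move: (n.+1%:R : R) (D n w) => a u a0 u0; field; rewrite !gt_eqF.
rewrite (eq_cvg _ _ E).
have : (1 - n.+1%:R^-1) * (D n w / n.+1%:R)^-1 @[n --> \oo] --> (1 - 0) * m^-1.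
  apply: cvgM; last by apply: cvgV => //; rewrite gt_eqF.
  by apply: cvgB; [exact: cvg_cst|exact: cvg_harmonic].
by rewrite subr0 mul1r.
Qed.

Let sqrtV_cvg0 : (Num.sqrt n%:R)^-1 @[n --> \oo] --> (0 : R).
Proof.
rewrite -cvg_shiftS.
have E (n : nat) : (Num.sqrt n.+1%:R)^-1 = Num.sqrt n.+1%:R^-1 :> R by rewrite sqrtrV.
rewrite (eq_cvg _ _ E).
have : Num.sqrt n.+1%:R^-1 @[n --> \oo] --> Num.sqrt (0 : R).
  by apply: continuous_cvg; [exact: sqrt_continuous|exact: cvg_harmonic].
by rewrite sqrtr0.
Qed.

(** Here [a] tends to 1 / m by the strong law, and every term keeps a factor s. At n = 0 both sides
    vanish, the inverse of 0 being 0. *)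
Let errE n w (s := (Num.sqrt n%:R)^-1) (a := n%:R * W n w) :
  err n w = (a + a ^+ 2) * s + a ^+ 3 * s ^+ 2.
Proof.
have aux (r u N : R) : r ^+ 2 = N -> r * u + r ^+ 3 * u ^+ 2 + r ^+ 4 * u ^+ 3 =
    (N * u + (N * u) ^+ 2) * r^-1 + (N * u) ^+ 3 * r^-1 ^+ 2.
  move=> <-; have [->|r0] := eqVneq r 0; last by field.
  by rewrite invr0 !expr0n/=; ring.
by apply: aux; rewrite sqr_sqrtr.
Qed.

(** Equal to H Zoo (1 - Zoo): the last factor of [varS], divided by m^2, is H. *)
Let clt_var w : R := varS p q (Zoo w) / m ^+ 2.

Let charac_cvg t phi : {ae P, forall w,
  \int[K n w]_r cos (t * r + phi) @[n --> \oo] -->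
  cos phi * expR (- (clt_var w * t ^+ 2) / 2)}.
Proof.
have [c Hc] := cond_charac t phi.
apply: filterS3 Hc cvgZ ratio_cvg => w Hw Zw Rw.
have cS : varS p q (Z n w) @[n --> \oo] --> varS p q (Zoo w).
  have c1 : 1 - Z n w @[n --> \oo] --> 1 - Zoo w by apply: cvgB => //; exact: cvg_cst.
  apply: cvgM; first exact: cvgM.
  by apply: cvgD; apply: cvgM => //; exact: cvg_cst.
have err0 : c * err n w @[n --> \oo] --> (0 : R).
  rewrite (eq_cvg _ _ (fun n => congr1 ( *%R c) (errE n w))).
  have : c * ((n%:R * W n w + (n%:R * W n w) ^+ 2) * (Num.sqrt n%:R)^-1 +
      (n%:R * W n w) ^+ 3 * (Num.sqrt n%:R)^-1 ^+ 2) @[n --> \oo] -->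
      c * ((m^-1 + m^-1 ^+ 2) * 0 + m^-1 ^+ 3 * 0 ^+ 2).
    have pow k (u : nat -> R)
      (v : R) : u n @[n --> \oo] --> v -> u n ^+ k @[n --> \oo] --> v ^+ k.
      by move=> uv; exact: (cvg_comp _ _ uv (@exprn_continuous R k v)).
    apply: cvgMr; apply: cvgD; apply: cvgM => //.
    - by apply: cvgD => //; exact: pow.
    - exact: pow.
    - exact: pow.
  by rewrite expr0n/= !mulr0 addr0 mulr0.
have lim : limit_charac t phi n w @[n --> \oo] --> cos phi * expR (- (clt_var w * t ^+ 2) / 2).
  apply: cvgMr; apply: continuous_cvg; first exact: continuous_expR.
  rewrite (_ : _ / 2 = - (kappa m t * (varS p q (Zoo w) * m^-1))); last first.
    by rewrite /kappa /clt_var; field; rewrite gt_eqF.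
  apply: cvgN.
  have E n : kappa m t * n%:R * (varS p q (Z n w) / D n w) =
    kappa m t * (varS p q (Z n w) * (n%:R * W n w)).
    by rewrite /W; ring.
  by rewrite (eq_cvg _ _ E); apply: cvgMr; exact: cvgM.
have diff : \int[K n w]_r cos (t * r + phi) - limit_charac t phi n w @[n --> \oo] --> (0 : R).
  have err0' : - (c * err n w) @[n --> \oo] --> (0 : R) by rewrite -oppr0; exact: cvgN.
  apply: squeeze_cvgr err0' err0.
  near=> n; rewrite -ler_norml; apply: Hw.
  by near: n; exists 1%N.
have E n : \int[K n w]_r cos (t * r + phi) =
    (\int[K n w]_r cos (t * r + phi) - limit_charac t phi n w) + limit_charac t phi n w.
  by rewrite subrK.
by rewrite (eq_cvg _ _ E); have := cvgD diff lim; rewrite add0r; exact.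
Unshelve. all: by end_near. Qed.

Let tail_cvg : {ae P, forall w, exists C : R, forall M : nat, \forall n \near \oo,
  (K n w [set r : RR | (M.+1%:R < `|r|)%R] <= (C / M.+1%:R)%:E)%E}.
Proof.
have [c Hc] := cond_tail.
apply: filterS2 Hc ratio_cvg => w Hw Rw; exists (`|c| * (m^-1 + 1)) => M.
near=> n.
have n0 : (0 < n)%N by near: n; exists 1%N.
apply: (le_trans (Hw n n0 M)); rewrite lee_fin.
have nW0 : 0 <= n%:R * W n w by rewrite mulr_ge0// ltW.
have nW : n%:R * W n w <= m^-1 + 1.
  by near: n; apply: (cvgr_le _ Rw); rewrite ltrDl.
have M1 : 1 <= M.+1%:R :> R by rewrite ler1n.
have M0 : 0 < M.+1%:R :> R by rewrite ltr0n.
(* The square in the Chebyshev bound is weakened to a first power, which is enough for tightness. *)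
rewrite -exprVn expr2 mulrA ler_pM2r ?invr_gt0// ler_pdivrMr//.
apply: (@le_trans _ _ (`|c| * (m^-1 + 1))).
  apply: (@le_trans _ _ (`|c| * (n%:R * W n w))); first by rewrite ler_wpM2r// ler_norm.
  by rewrite ler_wpM2l.
by rewrite ler_peMr// mulr_ge0// addr_ge0// invr_ge0 ltW.
Unshelve. all: by end_near. Qed.

Lemma urn_conditional_clt : {ae P, forall w,
  weak_cvg (K ^~ w) (gaussian 0 (clt_var w))}.
Proof.
have h := ae_forall_countable (fun i : nat * int * int =>
  charac_cvg (i.1.2%:~R / i.1.1.+1%:R) (i.2%:~R * (pi / 2))).
apply: filterS2 h tail_cvg => w Hw Tw.
apply: weak_cvg_trig => //.
move=> M j k; rewrite Rintegral_cos_gaussian; first exact: (Hw (M, j, k)).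
by rewrite /clt_var divr_ge0 ?sqr_ge0// varS_ge0.
Qed.

End urn_process.

Theorem theorem3p1 (d : measure_display) (T : measurableType d) (R : realType)
    (P : probability T R)
    (U : {RV P >-> R}^nat)
    (VW : {RV P >-> (R * R)%type}^nat)
    (beta : R) (mu nu : probability (measurableTypeR R) R) (m x y : R)
    (Zoo : {RV P >-> R})
    (Z := urn_prop U VW mu nu x y) (A_ := urn_filtration U VW)
    (K : forall n, R.-pker g_sigma_algebraType (A_ n) ~> measurableTypeR R)
    (H := fun w => m ^- 2 * (Zoo w * \int[nu]_(k in `[0, beta]) k ^+ 2 +
                    (1 - Zoo w) * \int[mu]_(k in `[0, beta]) k ^+ 2)) :
  iid U -> (forall n, uniform01 P (U n)) ->
  iid VW -> (forall n, uniform01 P (fun w => (VW n w).1)) ->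
  (forall n, uniform01 P (fun w => (VW n w).2)) ->
  indep_systems P (sigma_seq U) (sigma_seq VW) ->
  0 < beta -> mu `[0, beta]%classic = 1%E -> nu `[0, beta]%classic = 1%E ->
  0 <= x -> 0 <= y -> 0 < x + y ->
  0 < m -> ('E_mu[id] = m%:E)%E -> ('E_nu[id] = m%:E)%E ->
  (forall w, 0 <= Zoo w <= 1) ->
  {ae P, forall w, Z n w @[n --> \oo] --> Zoo w} ->
  (forall n, (0 < n)%N ->
    cond_distribution P (K n) (fun w => Num.sqrt n%:R * (Z n w - Zoo w))) ->
  {ae P, forall w,
    weak_cvg (K^~ w) (gaussian 0 (H w * Zoo w * (1 - Zoo w)))}.
Proof.
move=> iidU uU iidVW uV uW indUV beta0 mu1 nu1 x0 y0 xy0 m0 Emu Enu Z01 cvgZ cK.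
have mean (rho : probability (measurableTypeR R) R) :
    ('E_rho[id] = m%:E)%E -> \int[rho]_r r = m.
  by rewrite unlock /Rintegral => ->.
have := urn_conditional_clt iidU uU iidVW uV uW indUV beta0 mu1 nu1 x0 y0 xy0 m0
  (mean _ Emu) (mean _ Enu) (measurable_funPT Zoo) Z01 cvgZ cK.
apply: filterS => w; congr (weak_cvg _ (gaussian 0 _)).
by rewrite /H /varS; field; rewrite gt_eqF.
Qed.
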